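(* If $X$ and $Y$ are strongly $\Delta$-equivalent operator spaces, then their second duals $X^{\#\#}$ and $Y^{\#\#}$ are $\Delta$-equivalent as dual operator spaces.
   Context: An operator space is a norm closed subspace of $\mathcal{B}(K_1,K_2)$ ($K_1,K_2$ Hilbert spaces). $[S]^{-\|\cdot\|}$ and $[S]^{-w^*}$ denote the norm closed, respectively w*-closed, linear span of $S$. A TRO is an operator space $M$ with $MM^*M\subseteq M$. $X\subseteq \mathcal{B}(K_1,K_2)$ and $Y\subseteq \mathcal{B}(H_1,H_2)$ are strongly TRO equivalent if there exist TRO's $M_1\subseteq \mathcal{B}(H_1,K_1)$ and $M_2\subseteq\mathcal{B}(H_2,K_2)$ with $X=[M_2YM_1^*]^{-\|\cdot\|}$ and $Y=[M_2^*XM_1]^{-\|\cdot\|}$. Operator spaces $X$ and $Y$ are strongly $\Delta$-equivalent if there are completely isometric linear maps $\phi$ of $X$ and $\psi$ of $Y$ into spaces of operators between Hilbert spaces such that $\phi(X)$ and $\psi(Y)$ are strongly TRO equivalent. $X^{\#\#}$ denotes the operator space second dual of $X$, a dual operator space. Two dual operator spaces $V$ and $W$ are $\Delta$-equivalent as dual operator spaces if there are completely isometric normal (i.e. w*-continuous) representations $\phi$ of $V$ and $\psi$ of $W$ as spaces of operators between Hilbert spaces, and TRO's $M_1$ and $M_2$ between the respective Hilbert spaces, such that $\phi(V)=[M_2\psi(W)M_1^*]^{-w^*}$ and $\psi(W)=[M_2^*\phi(V)M_1]^{-w^*}$. *)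

(* Defs.v *)
From HB Require Import structures.
From mathcomp Require Import all_boot all_order all_algebra.
From mathcomp Require Import sesquilinear complex.
From mathcomp Require Import all_classical all_reals ereal topology normedtype.
From mathcomp Require Import sequences.

Set Implicit Arguments.
Unset Strict Implicit.
Unset Printing Implicit Defensive.

Import Order.TTheory GRing.Theory Num.Theory.
Import numFieldNormedType.Exports.

Local Open Scope classical_set_scope.
Local Open Scope ring_scope.
Local Open Scope complex_scope.

(* Norms of complex normed modules take values in the nonnegative reals of     *)
(* R[i]; rnorm is the same norm with values in R.                              *)
Definition rnorm (R : realType) (V : normedModType R[i]) (x : V) : R :=
  complex.Re `|x|.

Section RnormTheory.
Variables (R : realType) (V : normedModType R[i]).

Lemma rnormE (x : V) : `|x| = (rnorm x)%:C.
Proof.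
rewrite /rnorm; move: (normr_ge0 x); case: `|x| => a b /=.
by rewrite lecE /= => /andP[/eqP -> _].
Qed.

Lemma rnorm_ge0 (x : V) : 0 <= rnorm x.
Proof. by rewrite -lecR -rnormE normr_ge0. Qed.

Lemma rnormD (x y : V) : rnorm (x + y) <= rnorm x + rnorm y.
Proof. by rewrite -lecR rmorphD/= -!rnormE ler_normD. Qed.

Lemma rnormZ (a : R[i]) (x : V) :
  rnorm (a *: x) = rnorm (a : R[i]^o) * rnorm x.
Proof.
by apply: (@complexI R); rewrite rmorphM/= -!rnormE normrZ.
Qed.

Lemma rnorm0 : rnorm (0 : V) = 0.
Proof. by rewrite /rnorm normr0. Qed.

End RnormTheory.

(* Num.conj-sesquilinear forms are linear in the first variable.               *)
Record hilbert (R : realType) := Hilbert {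
  hsort :> completeNormedModType R[i];
  hdot : {dot hsort for Num.conj};
  hdotE : forall x : hsort, `|x| ^+ 2 = hdot x x
}.

Definition is_bop (R : realType) (V W : normedModType R[i]) : {pred V -> W} :=
  fun f => `[< linear f /\ continuous f >].

Record bop (R : realType) (V W : normedModType R[i]) := Bop {
  bop_fun :> V -> W;
  bopP : bop_fun \in @is_bop R V W
}.

Section BopLmodule.
Variables (R : realType) (V W : normedModType R[i]).

Lemma is_bop_submod : submod_closed (@is_bop R V W).
Proof.
split.
  apply/asboolP; split; first by move=> a x y; rewrite /= scaler0 addr0.
  exact: cst_continuous.
move=> a f g /asboolP[lf cf] /asboolP[lg cg]; apply/asboolP; split.
  move=> b x y; rewrite !addrfctE !scalrfctE lf lg.
  by rewrite !scalerDr !scalerA mulrC addrACA.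
move=> x; apply: (@continuousD _ _ _ (a \*: f) g); last exact: cg.
by apply: continuousZl_tmp; exact: cf.
Qed.

HB.instance Definition _ := GRing.isSubmodClosed.Build R[i] (V -> W)
  (@is_bop R V W) is_bop_submod.
HB.instance Definition _ := [isSub for @bop_fun R V W].
HB.instance Definition _ := [Choice of bop V W by <:].
HB.instance Definition _ := [SubChoice_isSubLmodule of bop V W by <:].

End BopLmodule.

Section BopNorm.
Variables (R : realType) (V W : normedModType R[i]).
Implicit Types T S : bop V W.

Lemma bop_linear T : linear T.
Proof. by case: T => f /= /asboolP[]. Qed.

HB.instance Definition _ T := GRing.isLinear.Build R[i] V W *:%R
  (bop_fun T) (bop_linear T).

Lemma bop_continuous T : continuous T.
Proof. by case: T => f /= /asboolP[]. Qed.

Definition opnorm T : R := sup [set rnorm (T x) | x in [set x | rnorm x <= 1]].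

Lemma opnorm_has_sup T :
  has_sup [set rnorm (T x) | x in [set x | rnorm x <= 1]].
Proof.
split; first by exists (rnorm (T 0)), 0 => //=; rewrite rnorm0 ler01.
have /linear_bounded_continuous/linear_boundedP := @bop_continuous T.
move=> /pinfty_ex_gt0[M M0 TM]; exists (complex.Re M) => _ [x /= x1 <-].
have ME : M = (complex.Re M)%:C.
  by move: M0; case: (M) => a b; rewrite ltcE /= => /andP[/eqP ->].
rewrite -lecR -rnormE -ME (le_trans (TM x))// ler_piMr//; first exact: ltW.
by rewrite rnormE lecR.
Qed.

Lemma opnorm_le T (M : R) :
  (forall x, rnorm x <= 1 -> rnorm (T x) <= M) -> opnorm T <= M.
Proof.
move=> TM; apply: ge_sup; first by case: (opnorm_has_sup T).
by move=> _ [x /= x1 <-]; exact: TM.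
Qed.

Lemma opnorm_ub T x : rnorm x <= 1 -> rnorm (T x) <= opnorm T.
Proof.
by move=> x1; apply: ub_le_sup; [case: (opnorm_has_sup T)|exists x].
Qed.

Lemma opnorm_ge0 T : 0 <= opnorm T.
Proof.
by apply: le_trans (rnorm_ge0 (T 0)) (opnorm_ub _ _); rewrite rnorm0 ler01.
Qed.

Lemma opnormP T x : rnorm (T x) <= opnorm T * rnorm x.
Proof.
have [x0|x0] := eqVneq (rnorm x) 0.
  have -> : x = 0 by apply/eqP; rewrite -normr_eq0 rnormE x0.
  by rewrite linear0 !rnorm0 mulr0.
have xgt0 : 0 < rnorm x by rewrite lt_neqAle eq_sym x0 rnorm_ge0.
have E : rnorm ((rnorm x)^-1%:C : R[i]^o) = (rnorm x)^-1.
  apply: (@complexI R); rewrite -rnormE ger0_norm//.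
  by rewrite lecR invr_ge0 rnorm_ge0.
rewrite -ler_pdivrMr// mulrC -E -rnormZ -linearZ opnorm_ub//.
by rewrite rnormZ E mulVf.
Qed.

Lemma opnormD T S : opnorm (T + S) <= opnorm T + opnorm S.
Proof.
apply: opnorm_le => x x1; rewrite (le_trans (rnormD _ _))//.
by rewrite lerD// opnorm_ub.
Qed.

Lemma opnormZ (a : R[i]) T :
  opnorm (a *: T) = rnorm (a : R[i]^o) * opnorm T.
Proof.
have le b S : opnorm (b *: S) <= rnorm (b : R[i]^o) * opnorm S.
  apply: opnorm_le => x x1.
  by rewrite [X in rnorm X]/(b *: S x) rnormZ ler_wpM2l ?rnorm_ge0// opnorm_ub.
apply/eqP; rewrite eq_le le /=; have [->|a0] := eqVneq a 0.
  by rewrite rnorm0 mul0r opnorm_ge0.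
have r0 : rnorm (a : R[i]^o) != 0.
  by rewrite -(inj_eq (@complexI R)) -rnormE normr_eq0.
have rp : 0 < rnorm (a : R[i]^o) by rewrite lt_neqAle eq_sym r0 rnorm_ge0.
rewrite mulrC -ler_pdivlMr// mulrC.
have := le a^-1 (a *: T); rewrite scalerA mulVf// scale1r.
suff -> : rnorm (a^-1 : R[i]^o) = (rnorm (a : R[i]^o))^-1 by [].
apply: (mulfI r0); rewrite -rnormZ divff//.
apply: (@complexI R); rewrite -rnormE.
by rewrite [X in `|X|](_ : _ = 1) ?normr1//; exact: divff.
Qed.

Definition bop_norm T : R[i] := (opnorm T)%:C.

Lemma bop_normD T S : bop_norm (T + S) <= bop_norm T + bop_norm S.
Proof. by rewrite -rmorphD lecR opnormD. Qed.

Lemma bop_normZ (a : R[i]) T : bop_norm (a *: T) = `|a| * bop_norm T.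
Proof. by rewrite /bop_norm opnormZ rmorphM /= -rnormE. Qed.

Lemma bop_norm0_eq0 T : bop_norm T = 0 -> T = 0.
Proof.
move=> /complexI T0; apply/val_inj/funext => x; apply/eqP.
rewrite -normr_eq0 rnormE; apply/eqP; congr (_%:C); apply/eqP.
by rewrite eq_le rnorm_ge0 andbT (le_trans (opnormP _ _))// T0 mul0r.
Qed.

HB.instance Definition _ := @Lmodule_isNormed.Build R[i] (bop V W)
  bop_norm bop_normD bop_normZ bop_norm0_eq0.

End BopNorm.

Section BopComp.
Variables (R : realType) (U V W : normedModType R[i]).

Lemma bop_comp_subproof (S : bop V W) (T : bop U V) :
  (S \o T) \in @is_bop R U W.
Proof.
apply/asboolP; split; first by move=> a x y /=; rewrite !linearP.
by move=> x; apply: continuous_comp; exact: bop_continuous.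
Qed.

Definition bop_comp (S : bop V W) (T : bop U V) : bop U W :=
  Bop (bop_comp_subproof S T).

End BopComp.

Definition is_adjoint (R : realType) (H K : hilbert R)
    (T : bop H K) (S : bop K H) : Prop :=
  forall x y, hdot K (T x) y = hdot H x (S y).

(* M^*. Adjoints enter as a relation, since the Riesz representation theorem   *)
(* is not in the library.                                                      *)
Definition adjoints (R : realType) (H K : hilbert R) (M : set (bop H K)) :
    set (bop K H) :=
  [set S | exists2 T, M T & is_adjoint T S].

(* The set of products A B, without linear span.                               *)
Definition prod_set (R : realType) (U V W : normedModType R[i])
    (A : set (bop V W)) (B : set (bop U V)) : set (bop U W) :=
  [set bop_comp S T | S in A & T in B].

Definition linear_subspace (R : realType) (V : lmodType R[i]) (A : set V) : Prop :=
  submod_closed [in A].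

Definition lspan (R : realType) (V : lmodType R[i]) (A : set V) : set V :=
  smallest (@linear_subspace R V) A.

Definition norm_span (R : realType) (V : normedModType R[i]) (A : set V) :
    set V :=
  closure (lspan A).

Definition operator_space (R : realType) (H K : hilbert R)
    (X : set (bop H K)) : Prop :=
  linear_subspace X /\ closed X.

Definition tro (R : realType) (H K : hilbert R) (M : set (bop H K)) : Prop :=
  operator_space M /\ prod_set (prod_set M (adjoints M)) M `<=` M.

Definition strongly_TRO_equivalent (R : realType) (K1 K2 H1 H2 : hilbert R)
    (X : set (bop K1 K2)) (Y : set (bop H1 H2)) : Prop :=
  exists (M1 : set (bop H1 K1)) (M2 : set (bop H2 K2)),
    [/\ tro M1, tro M2,
        X = norm_span (prod_set (prod_set M2 Y) (adjoints M1)) &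
        Y = norm_span (prod_set (prod_set (adjoints M2) X) M1)].

(* The norm of the operator H^I -> K^I with matrix T, for the l^2-norms.       *)
Definition opmx_norm (R : realType) (I : finType) (H K : normedModType R[i])
    (T : I -> I -> H -> K) : \bar R :=
  ereal_sup [set (Num.sqrt (\sum_i rnorm (\sum_j T i j (h j)) ^+ 2))%:E
    | h in [set h : I -> H | \sum_j rnorm (h j) ^+ 2 <= 1]].

Definition bop_mxnorm (R : realType) (H K : hilbert R) (n : nat)
    (T : 'M[bop H K]_n) : \bar R :=
  opmx_norm (fun i j => T i j : H -> K).

(* The norm of the matrix A as an operator on the Hilbert space l^2(I).        *)
Definition scalar_mxnorm (R : realType) (I : finType) (A : I -> I -> R[i]) :
    \bar R :=
  opmx_norm (fun i j (z : R[i]^o) => A i j * z : R[i]^o).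

(* A complex normed space with a norm on each space of square matrices over    *)
(* it: the data of an abstract operator space. Only the structures built below *)
(* from concrete operator spaces by duality are used, so Ruan's axioms are not *)
(* recorded.                                                                   *)
Record mxnormed (R : realType) := MxNormed {
  mxn_sort :> normedModType R[i];
  mxnorm : forall n : nat, 'M[mxn_sort]_n -> \bar R
}.

Record opspace (R : realType) (H K : hilbert R) := OpSpace {
  opset : set (bop H K);
  opsetP : operator_space opset
}.

Definition opspace_pred (R : realType) (H K : hilbert R) (X : opspace H K) :
  {pred bop H K} := [in opset X].

Record opelt (R : realType) (H K : hilbert R) (X : opspace H K) := OpElt {
  opelt_val :> bop H K;
  opeltP : opelt_val \in opspace_pred X
}.

Section OpElt.
Variables (R : realType) (H K : hilbert R) (X : opspace H K).

Lemma opspace_submod : submod_closed (opspace_pred X).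
Proof. by case: (opsetP X). Qed.

HB.instance Definition _ := GRing.isSubmodClosed.Build R[i] (bop H K)
  (opspace_pred X) opspace_submod.
HB.instance Definition _ := [isSub for @opelt_val R H K X].
HB.instance Definition _ := [Choice of opelt X by <:].
HB.instance Definition _ := [SubChoice_isSubLmodule of opelt X by <:].

Definition opelt_norm (x : opelt X) : R[i] := `|opelt_val x|.

Lemma opelt_normD x y : opelt_norm (x + y) <= opelt_norm x + opelt_norm y.
Proof. exact: ler_normD. Qed.

Lemma opelt_normZ (a : R[i]) x : opelt_norm (a *: x) = `|a| * opelt_norm x.
Proof. exact: normrZ. Qed.

Lemma opelt_norm0_eq0 x : opelt_norm x = 0 -> x = 0.
Proof. by move=> /normr0_eq0 x0; apply: val_inj. Qed.

HB.instance Definition _ := @Lmodule_isNormed.Build R[i] (opelt X)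
  opelt_norm opelt_normD opelt_normZ opelt_norm0_eq0.

End OpElt.

Definition opspace_mxnormed (R : realType) (H K : hilbert R)
    (X : opspace H K) : mxnormed R :=
  @MxNormed R (opelt X)
    (fun n x => bop_mxnorm (\matrix_(i, j) opelt_val (x i j))).

Coercion opspace_mxnormed : opspace >-> mxnormed.

Definition complete_isometry (R : realType) (V : mxnormed R)
    (H K : hilbert R) (phi : {linear V -> bop H K}) : Prop :=
  forall (n : nat) (x : 'M[V]_n), bop_mxnorm (map_mx phi x) = mxnorm x.

Definition strongly_Delta_equivalent (R : realType) (X Y : mxnormed R) : Prop :=
  exists (K1 K2 H1 H2 : hilbert R)
         (phi : {linear X -> bop K1 K2}) (psi : {linear Y -> bop H1 H2}),
    [/\ complete_isometry phi, complete_isometry psi &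
        strongly_TRO_equivalent (range phi) (range psi)].

(* The operator space dual V^#: a matrix f over V^# is normed as the map       *)
(* x |-> [f k l x] from V to scalar matrices, by its completely bounded norm.  *)
Definition dual_mxnorm (R : realType) (V : mxnormed R) (n : nat)
    (f : 'M[bop V R[i]^o]_n) : \bar R :=
  ereal_sup [set r | exists (p : nat) (x : 'M[V]_p),
    (mxnorm x <= 1)%E /\
    r = scalar_mxnorm
      (fun s t : 'I_n * 'I_p => f s.1 t.1 (x s.2 t.2))].

(* Dual operator spaces come with a given predual.                             *)
Record dual_opspace (R : realType) := Dual { predual : mxnormed R }.

Definition dual_mxnormed (R : realType) (V : dual_opspace R) : mxnormed R :=
  @MxNormed R (bop (predual V) R[i]^o) (@dual_mxnorm R (predual V)).

Coercion dual_mxnormed : dual_opspace >-> mxnormed.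

Definition bidual (R : realType) (X : mxnormed R) : dual_opspace R :=
  Dual (Dual X).

(* The w*-topology of a dual operator space: pointwise convergence on the      *)
(* predual.                                                                    *)
Definition wstar_dual (R : realType) (V : dual_opspace R) : topologicalType :=
  initial_topology
    (fun f : bop (predual V) R[i]^o => (f : {ptws predual V -> R[i]^o})).

Definition square_summable (R : realType) (H : hilbert R) (xi : nat -> H) :
    Prop :=
  (\sum_(0 <= n <oo) (rnorm (xi n) ^+ 2)%:E < +oo)%E.

(* The elements of the predual of B(H,K): T |-> sum_n <T xi_n, eta_n> with xi  *)
(* and eta square summable.                                                    *)
Definition sigma_weak (R : realType) (H K : hilbert R)
    (w : bop H K -> R[i]^o) : Prop :=
  exists (xi : nat -> H) (eta : nat -> K),
    [/\ square_summable xi, square_summable eta &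
        forall T : bop H K,
          series (fun n => hdot K (T (xi n)) (eta n) : R[i]^o) @ \oo --> w T].

Definition wstar_bop (R : realType) (H K : hilbert R) : topologicalType :=
  initial_topology
    (fun (T : bop H K) =>
      (fun w : {w : bop H K -> R[i]^o | sigma_weak w} => sval w T)
        : {ptws {w : bop H K -> R[i]^o | sigma_weak w} -> R[i]^o}).

Definition wstar_span (R : realType) (H K : hilbert R) (A : set (bop H K)) :
    set (bop H K) :=
  @closure (wstar_bop H K) (lspan A).

Definition wstar_continuous (R : realType) (V : dual_opspace R) (H K : hilbert R)
    (phi : V -> bop H K) : Prop :=
  continuous (phi : wstar_dual V -> wstar_bop H K).

Definition Delta_equivalent_dual (R : realType) (V W : dual_opspace R) : Prop :=
  exists (K1 K2 H1 H2 : hilbert R)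
         (phi : {linear V -> bop K1 K2}) (psi : {linear W -> bop H1 H2})
         (M1 : set (bop H1 K1)) (M2 : set (bop H2 K2)),
    [/\ complete_isometry phi /\ wstar_continuous phi,
        complete_isometry psi /\ wstar_continuous psi,
        tro M1 /\ tro M2,
        range phi = wstar_span (prod_set (prod_set M2 (range psi)) (adjoints M1)) &
        range psi = wstar_span (prod_set (prod_set (adjoints M2) (range phi)) M1)].

(* Main.v *)
(* Write X and Y for the completely isometric copies, which are strongly TRO   *)
(* equivalent through M1 and M2. Fix an ultrafilter U on a set of indices i    *)
(* carrying a rank r(i), and send a Hilbert space K to the ultraproduct K^U of *)
(* the spaces K^r(i). An operator T acts diagonally on K^U; the resulting map  *)
(* T |-> T^U is isometric, multiplicative and compatible with adjoints, so it  *)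
(* carries TROs to TROs and the relation X = [M2 Y M1^*] to its image.         *)
(*   If U is fine enough, a Hahn-Banach argument shows that every functional f *)
(* on X is a vector functional x |-> <x^U xi, eta> with |xi| |eta| <= |f|, and *)
(* likewise for functionals on the spaces of matrices over X. Hence an element *)
(* F of the bidual acts on X^U by <Phi F xi, eta> = F (x |-> <x^U xi, eta>).   *)
(*   Phi is completely contractive because n vectors span at most n dimensions *)
(* (Gram-Schmidt); it is completely isometric because a matrix F with          *)
(* |Phi F| <= 1 is a w*-limit of matrices of norm at most 1 over X             *)
(* (Goldstine), by a second Hahn-Banach argument. A w*-continuous functional w *)
(* satisfies w (Phi F) = F (w o Phi | X), so Phi is normal, and an operator in *)
(* the w*-closure of X^U defines a functional on the dual of X by evaluating   *)
(* it at representing vectors, so the range of Phi is w*-closed. All of this   *)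
(* is natural in X, hence M1^U and M2^U implement the equivalence.             *)

From HB Require Import structures.
Require Import Defs.
From mathcomp Require Import all_boot all_order all_algebra.
From mathcomp Require Import sesquilinear complex ring lra.
From mathcomp Require Import all_classical all_reals ereal topology normedtype.
From mathcomp Require Import sequences.

Set Implicit Arguments.
Unset Strict Implicit.
Unset Printing Implicit Defensive.

Import Order.TTheory GRing.Theory Num.Theory.
Import numFieldNormedType.Exports.

Local Open Scope classical_set_scope.
Local Open Scope complex_scope.
Local Open Scope ring_scope.

Local Notation Re := complex.Re.
Local Notation Im := complex.Im.

(** The mechanism is a duality between operators and finite linear relations. On the ultraproducts
    every functional on X is a single vector functional, and an operator T lies in the range of
    [Phi] exactly when it satisfies every relation sum a <T xi, eta> = 0 that holds for all x^U:
    [Phi_vanish] is one direction, [Phi_range] the other. Relations survive linear spans and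
    w*-closures ([lspan_vanish], [wstar_closure_vanish]). If m2 Y m1 lies in X, then applying m1 and
    the adjoint of m2 to the vectors of a relation for X gives a relation for Y. Hence the w*-span
    of the products built from the bidual of Y lies in the range belonging to X. Conversely each
    [Phi F] is a w*-limit of operators x^U ([Phi_wstar_limit]), and x is a norm limit of sums of
    products m2 y m1. This is [bidual_range], applied once in each direction.

    The analysis rests on [balanced_convex_approx], a Hahn-Banach theorem in finite dimension. It
    gives first [functional_approx], hence the exact representation [matrix_functional_repr] in the
    ultraproduct, and then, with that representation, [goldstine]. Complete isometry is [Phi_le]
    together with [Phi_ge]; normality comes from [sigma_weak_Phi]. On the side of the TRO's,
    [compression_exists] provides a contractive left inverse of T |-> T^U, which keeps images of
    closed sets closed. *)

Definition cabs (R : realType) (z : R[i]) : R := rnorm (z : R[i]^o).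

(** * Semi-inner products and the norm of a matrix of operators *)

Section ComplexModulus.
Variable R : realType.
Implicit Types (z w : R[i]) (t : R).

Lemma cabsE z : `|z| = (cabs z)%:C.
Proof. exact: (@rnormE R R[i]^o). Qed.

Lemma cabs_ge0 z : 0 <= cabs z.
Proof. exact: rnorm_ge0. Qed.

Lemma cabs0 : cabs 0 = 0 :> R.
Proof. exact: (@rnorm0 R R[i]^o). Qed.

Lemma cabsD z w : cabs (z + w) <= cabs z + cabs w.
Proof. exact: (@rnormD R R[i]^o). Qed.

Lemma cabsM z w : cabs (z * w) = cabs z * cabs w.
Proof. exact: (@rnormZ R R[i]^o). Qed.

Lemma cabsN z : cabs (- z) = cabs z.
Proof. by apply: (@complexI R); rewrite -!cabsE normrN. Qed.

Lemma cabsB z w : cabs (z - w) = cabs (w - z).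
Proof. by rewrite -cabsN opprB. Qed.

Lemma cabs_conj z : cabs z^* = cabs z.
Proof. by apply: (@complexI R); rewrite -!cabsE norm_conjC. Qed.

Lemma cabs_real t : cabs t%:C = `|t|.
Proof. by apply: (@complexI R); rewrite -cabsE normc_def /= expr0n/= addr0 sqrtr_sqr. Qed.

Lemma cabs_eq0 z : (cabs z == 0) = (z == 0).
Proof. by rewrite -(inj_eq (@complexI R)) -cabsE normr_eq0. Qed.

Lemma cabs_sqr z : cabs z ^+ 2 = Re z ^+ 2 + Im z ^+ 2.
Proof. by apply: (@complexI R); rewrite rmorphXn/= -cabsE -add_Re2_Im2. Qed.

Lemma Re_le_cabs z : Re z <= cabs z.
Proof.
rewrite (le_trans (ler_norm _))// -[leLHS]ger0_norm// -ler_sqr ?nnegrE ?cabs_ge0//.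
by rewrite cabs_sqr normr_id real_normK ?num_real// lerDl sqr_ge0.
Qed.

Lemma mul_conj z : z * z^* = (cabs z ^+ 2)%:C.
Proof. by rewrite -normCK cabsE rmorphXn. Qed.

Lemma ReD z w : Re (z + w) = Re z + Re w.
Proof. by case: z; case: w. Qed.

Lemma ReN z : Re (- z) = - Re z.
Proof. by case: z. Qed.

Lemma ReB z w : Re (z - w) = Re z - Re w.
Proof. by rewrite ReD ReN. Qed.

Lemma ReMl t z : Re (t%:C * z) = t * Re z.
Proof. by case: z => a b /=; rewrite mul0r subr0. Qed.

Lemma norm_Re_le z : `|Re z| <= cabs z.
Proof. by rewrite ler_norml lerNl -ReN (le_trans (Re_le_cabs _)) ?cabsN//= Re_le_cabs. Qed.

Lemma Re_conj z : Re z^* = Re z.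
Proof. by case: z. Qed.

Lemma conj_real t : (t%:C)^* = t%:C.
Proof. exact: conjc_real. Qed.

Lemma Re_sum I (r : seq I) (P : pred I) (F : I -> R[i]) :
  Re (\sum_(i <- r | P i) F i) = \sum_(i <- r | P i) Re (F i).
Proof. by elim/big_rec2: _ => [|i y x _ <-]; rewrite ?ReD. Qed.

Lemma cabs_sum I (r : seq I) (P : pred I) (F : I -> R[i]) :
  cabs (\sum_(i <- r | P i) F i) <= \sum_(i <- r | P i) cabs (F i).
Proof.
elim/big_rec2: _ => [|i y x _ h]; first by rewrite cabs0.
by rewrite (le_trans (cabsD _ _))// lerD2l.
Qed.

(** Rotating by such a [u] turns a bound on real parts into a bound on moduli. *)
Lemma phase_exists z : exists2 u : R[i], cabs u = 1 & u * z = (cabs z)%:C.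
Proof.
have [->|z0] := eqVneq z 0.
  by exists 1; rewrite ?mulr0 ?cabs0// -[1]/(1%:C) cabs_real normr1.
have c0 : (cabs z)%:C != 0 by rewrite -cabsE normr_eq0.
exists ((cabs z)^-1%:C * z^*).
  rewrite cabsM cabs_conj cabs_real ger0_norm ?invr_ge0 ?cabs_ge0// mulVf//.
  by rewrite cabs_eq0.
rewrite -mulrA [_^* * z]mulrC mul_conj -rmorphM/= expr2 mulKf// cabs_eq0//.
Qed.

Lemma real_of_ge0 z : 0 <= z -> z = (Re z)%:C.
Proof. by case: z => a b; rewrite lecE /= => /andP[/eqP -> _]. Qed.

Lemma ler_eps (a b : R) : (forall e : R, 0 < e -> a <= b + e) -> a <= b.
Proof. by move=> h; apply/ler_addgt0Pr. Qed.

(** The quadratic is smallest at [t = b / c]. When [c = 0] it is affine in [t], and a nonzero [b]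
    would give it the value [-1] at [t = (a + 1) / (2 * b)]. *)
Lemma discriminant_le (a b c : R) : 0 <= c ->
  (forall t, 0 <= a - 2 * t * b + t ^+ 2 * c) -> b ^+ 2 <= a * c.
Proof.
move=> cge0 h; have [c0|c0] := eqVneq c 0.
  have [->|b0] := eqVneq b 0; first by rewrite c0 mulr0 expr0n.
  have := h ((a + 1) / (2 * b)); rewrite c0 mulr0 addr0.
  have -> : 2 * ((a + 1) / (2 * b)) * b = a + 1 by field.
  by move=> ?; lra.
have cgt0 : 0 < c by rewrite lt_neqAle eq_sym c0.
have := h (b / c).
have -> : a - 2 * (b / c) * b + (b / c) ^+ 2 * c = (a * c - b ^+ 2) / c by field.
by rewrite pmulr_lge0 ?invr_gt0// subr_ge0.
Qed.

End ComplexModulus.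

(** Only semidefinite, since the ultralimit of inner products is degenerate on bounded families; the
    kernel is divided out in [squo]. *)
Record semidot (R : realType) (E : lmodType R[i]) := Semidot {
  sdot :> E -> E -> R[i];
  sdot_linear : forall a x y z, sdot (a *: x + y) z = a * sdot x z + sdot y z;
  sdot_herm : forall x y, sdot y x = (sdot x y)^*;
  sdot_ge0 : forall x, 0 <= sdot x x
}.

Section SemidotTheory.
Variables (R : realType) (E : lmodType R[i]) (d : semidot E).
Implicit Types (x y z : E) (a : R[i]).

Definition sdsq x : R := Re (d x x).
Definition sdn x : R := Num.sqrt (sdsq x).

Lemma sdot0l z : d 0 z = 0.
Proof. by have := sdot_linear d (-1) 0 0 z; rewrite scaler0 addr0 mulN1r addNr. Qed.

Lemma sdotZl a x z : d (a *: x) z = a * d x z.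
Proof. by have := sdot_linear d a x 0 z; rewrite addr0 sdot0l addr0. Qed.

Lemma sdotDl x y z : d (x + y) z = d x z + d y z.
Proof. by have := sdot_linear d 1 x y z; rewrite scale1r mul1r. Qed.

Lemma sdotNl x z : d (- x) z = - d x z.
Proof. by rewrite -scaleN1r sdotZl mulN1r. Qed.

Lemma sdotBl x y z : d (x - y) z = d x z - d y z.
Proof. by rewrite sdotDl sdotNl. Qed.

Lemma sdot0r z : d z 0 = 0.
Proof. by rewrite sdot_herm sdot0l conjC0. Qed.

Lemma sdotDr x y z : d z (x + y) = d z x + d z y.
Proof. by rewrite sdot_herm sdotDl rmorphD/= -!sdot_herm. Qed.

Lemma sdotZr a x z : d z (a *: x) = a^* * d z x.
Proof. by rewrite sdot_herm sdotZl rmorphM/= -sdot_herm. Qed.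

Lemma sdotNr x z : d z (- x) = - d z x.
Proof. by rewrite sdot_herm sdotNl rmorphN/= -sdot_herm. Qed.

Lemma sdotBr x y z : d z (x - y) = d z x - d z y.
Proof. by rewrite sdotDr sdotNr. Qed.

Lemma sdot_suml I (r : seq I) (P : pred I) (F : I -> E) z :
  d (\sum_(i <- r | P i) F i) z = \sum_(i <- r | P i) d (F i) z.
Proof.
by elim/big_rec2: _ => [|i y x _ <-]; rewrite ?sdot0l// sdotDl.
Qed.

Lemma sdot_sumr I (r : seq I) (P : pred I) (F : I -> E) z :
  d z (\sum_(i <- r | P i) F i) = \sum_(i <- r | P i) d z (F i).
Proof.
by elim/big_rec2: _ => [|i y x _ <-]; rewrite ?sdot0r// sdotDr.
Qed.

Lemma sdsq_ge0 x : 0 <= sdsq x.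
Proof. by have := sdot_ge0 d x; rewrite lecE => /andP[]. Qed.

Lemma sdsqE x : d x x = (sdsq x)%:C.
Proof. exact/real_of_ge0/sdot_ge0. Qed.

Lemma sdsqD x y : sdsq (x + y) = sdsq x + sdsq y + 2 * Re (d x y).
Proof.
rewrite /sdsq sdotDl !sdotDr !ReD (sdot_herm d x y) Re_conj; ring.
Qed.

Lemma sdsqZ a x : sdsq (a *: x) = cabs a ^+ 2 * sdsq x.
Proof. by rewrite /sdsq sdotZl sdotZr mulrA mul_conj ReMl. Qed.

Lemma sdsqN x : sdsq (- x) = sdsq x.
Proof. by rewrite /sdsq sdotNl sdotNr opprK. Qed.

Lemma sdsqB x y : sdsq (x - y) = sdsq x + sdsq y - 2 * Re (d x y).
Proof. by rewrite sdsqD sdsqN sdotNr ReN mulrN. Qed.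

Lemma sdsq0 : sdsq 0 = 0.
Proof. by rewrite /sdsq sdot0l. Qed.

Lemma sdn_ge0 x : 0 <= sdn x.
Proof. exact: sqrtr_ge0. Qed.

Lemma sdn_sqr x : sdn x ^+ 2 = sdsq x.
Proof. by rewrite sqr_sqrtr// sdsq_ge0. Qed.

Lemma sdot_CauchySchwarz x y : cabs (d x y) <= sdn x * sdn y.
Proof.
rewrite -ler_sqr ?nnegrE ?cabs_ge0 ?mulr_ge0 ?sdn_ge0// exprMn !sdn_sqr.
have [u u1 uz] := phase_exists (d x y).
apply: discriminant_le; first exact: sdsq_ge0.
move=> t; have := sdsq_ge0 (x - (t%:C * u^*) *: y).
rewrite sdsqB sdsqZ cabsM cabs_real cabs_conj u1 mulr1 real_normK ?num_real//.
rewrite sdotZr rmorphM/= conjCK -mulrA uz conj_real.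
rewrite ReMl /=; set A := cabs _; set B := sdsq x; set D := sdsq y.
by congr (0 <= _); ring.
Qed.

Lemma sdn_eq0_dot x y : sdn x = 0 -> d x y = 0.
Proof.
move=> x0; apply/eqP; rewrite -cabs_eq0 -[_ == _]/(_ == _) eq_le cabs_ge0 andbT.
by rewrite (le_trans (sdot_CauchySchwarz _ _))// x0 mul0r.
Qed.

Lemma sdnD x y : sdn (x + y) <= sdn x + sdn y.
Proof.
rewrite -ler_sqr ?nnegrE ?addr_ge0 ?sdn_ge0// sdn_sqr sdsqD sqrrD !sdn_sqr.
have := le_trans (Re_le_cabs _) (sdot_CauchySchwarz x y).
by rewrite -mulr_natl => ?; lra.
Qed.

Lemma sdnZ a x : sdn (a *: x) = cabs a * sdn x.
Proof.
by rewrite /sdn sdsqZ sqrtrM ?sqr_ge0// sqrtr_sqr ger0_norm// cabs_ge0.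
Qed.

Lemma sdn0 : sdn 0 = 0.
Proof. by rewrite /sdn sdsq0 sqrtr0. Qed.

Lemma parallelogram x y :
  sdsq (x + y) + sdsq (x - y) = 2 * sdsq x + 2 * sdsq y.
Proof. by rewrite sdsqD sdsqB; ring. Qed.

End SemidotTheory.

Section PairSums.
Variables (W : nmodType) (I J : finType).

Lemma sum_pair (F : I * J -> W) : \sum_p F p = \sum_i \sum_j F (i, j).
Proof. by rewrite pair_bigA; apply: eq_bigr => -[]. Qed.

Lemma sum_swap (F : I * J -> W) : \sum_p F p = \sum_(p : J * I) F (p.2, p.1).
Proof.
by rewrite sum_pair exchange_big pair_bigA; apply: eq_bigr => -[].
Qed.

End PairSums.

Section FamilySemidot.
Variables (R : realType) (I : finType) (E : lmodType R[i]) (d : semidot E).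

Definition family_dot (x y : I -> E) : R[i] := \sum_i d (x i) (y i).

Lemma family_dot_linear a (x y z : I -> E) :
  family_dot (a *: x + y) z = a * family_dot x z + family_dot y z.
Proof.
rewrite /family_dot mulr_sumr -big_split/=; apply: eq_bigr => i _.
exact: sdot_linear.
Qed.

Lemma family_dot_herm (x y : I -> E) : family_dot y x = (family_dot x y)^*.
Proof. by rewrite /family_dot rmorph_sum/=; apply: eq_bigr => i _; rewrite -sdot_herm. Qed.

Lemma family_dot_ge0 (x : I -> E) : 0 <= family_dot x x.
Proof. by rewrite sumr_ge0// => i _; exact: sdot_ge0. Qed.

Definition family_semidot : semidot (I -> E) :=
  Semidot family_dot_linear family_dot_herm family_dot_ge0.

Lemma family_sdsq (x : I -> E) : sdsq family_semidot x = \sum_i sdsq d (x i).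
Proof. exact: Re_sum. Qed.

End FamilySemidot.

Section ComplexSemidot.
Variable R : realType.

Definition complex_dot (x y : R[i]^o) : R[i] := x * (y : R[i])^*.

Lemma complex_dot_linear (a : R[i]) (x y z : R[i]^o) :
  complex_dot (a *: x + y) z = a * complex_dot x z + complex_dot y z.
Proof. by rewrite /complex_dot mulrDl -mulrA. Qed.

Lemma complex_dot_herm (x y : R[i]^o) : complex_dot y x = (complex_dot x y)^*.
Proof. by rewrite /complex_dot rmorphM/= conjCK mulrC. Qed.

Lemma complex_dot_ge0 (x : R[i]^o) : 0 <= complex_dot x x.
Proof. exact: mul_conjC_ge0. Qed.

Definition complex_semidot : semidot R[i]^o :=
  Semidot complex_dot_linear complex_dot_herm complex_dot_ge0.

Lemma complex_sdsq x : sdsq complex_semidot x = cabs x ^+ 2.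
Proof. by rewrite /sdsq /= /complex_dot mul_conj. Qed.

Lemma complex_sdn x : sdn complex_semidot x = cabs x.
Proof. by rewrite /sdn complex_sdsq sqrtr_sqr ger0_norm// cabs_ge0. Qed.

End ComplexSemidot.

Section HilbertSemidot.
Variables (R : realType) (H : hilbert R).
Implicit Types x y z : H.

Lemma hdot_linear (a : R[i]) x y z :
  hdot H (a *: x + y) z = a * hdot H x z + hdot H y z.
Proof. exact: linearPl. Qed.

Lemma hdot_herm x y : hdot H y x = (hdot H x y)^*.
Proof. by rewrite (hermC _ y x) /= mul1r. Qed.

Lemma hdot_ge0 x : 0 <= hdot H x x.
Proof. exact: dnorm_ge0. Qed.

Definition hilbert_semidot : semidot H := Semidot hdot_linear hdot_herm hdot_ge0.

Lemma hdotxx x : hdot H x x = (rnorm x ^+ 2)%:C.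
Proof. by rewrite -hdotE rnormE rmorphXn. Qed.

Lemma hilbert_sdsq x : sdsq hilbert_semidot x = rnorm x ^+ 2.
Proof.
by apply: (@complexI R); rewrite -sdsqE/= hdotxx.
Qed.

Lemma hilbert_sdn x : sdn hilbert_semidot x = rnorm x.
Proof. by rewrite /sdn hilbert_sdsq sqrtr_sqr ger0_norm// rnorm_ge0. Qed.

Lemma hdot_CauchySchwarz x y : cabs (hdot H x y) <= rnorm x * rnorm y.
Proof. by rewrite -!hilbert_sdn; exact: (sdot_CauchySchwarz hilbert_semidot). Qed.

Lemma hdotDr x y z : hdot H z (x + y) = hdot H z x + hdot H z y.
Proof. exact: (sdotDr hilbert_semidot). Qed.

Lemma hdotBl x y z : hdot H (x - y) z = hdot H x z - hdot H y z.
Proof. exact: (sdotBl hilbert_semidot). Qed.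

Lemma hdotBr x y z : hdot H z (x - y) = hdot H z x - hdot H z y.
Proof. exact: (sdotBr hilbert_semidot). Qed.

Lemma hdotZl a x y : hdot H (a *: x) y = a * hdot H x y.
Proof. exact: (sdotZl hilbert_semidot). Qed.

Lemma hdotZr a x y : hdot H x (a *: y) = a^* * hdot H x y.
Proof. exact: (sdotZr hilbert_semidot). Qed.

Lemma hdot0l x : hdot H 0 x = 0.
Proof. exact: (sdot0l hilbert_semidot). Qed.

Lemma hdot0r x : hdot H x 0 = 0.
Proof. exact: (sdot0r hilbert_semidot). Qed.

Lemma hdot_suml I (r : seq I) (P : pred I) (F : I -> H) x :
  hdot H (\sum_(i <- r | P i) F i) x = \sum_(i <- r | P i) hdot H (F i) x.
Proof. exact: (sdot_suml hilbert_semidot). Qed.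

Lemma hdot_sumr I (r : seq I) (P : pred I) (F : I -> H) x :
  hdot H x (\sum_(i <- r | P i) F i) = \sum_(i <- r | P i) hdot H x (F i).
Proof. exact: (sdot_sumr hilbert_semidot). Qed.

Lemma hdot_inj x y : (forall z, hdot H x z = hdot H y z) -> x = y.
Proof.
move=> xy; apply/eqP; rewrite -subr_eq0 -normr_eq0 -(sqrf_eq0 `|_|) hdotE.
by rewrite hdotBl xy subrr.
Qed.

End HilbertSemidot.

(** * Separation from bounded balanced convex sets in finite dimension *)

Section Separation.
Variables (R : realType) (A : finType).
Let E := A -> R[i]^o.
Let d := family_semidot A (complex_semidot R).

Lemma family_sdsqC (x : E) : sdsq d x = \sum_a cabs (x a) ^+ 2.
Proof. by rewrite family_sdsq; apply: eq_bigr => a _; rewrite complex_sdsq. Qed.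

(* The nearest-point argument, run with an almost nearest point so that        *)
(* neither closedness of C nor compactness is needed.                          *)
Lemma balanced_convex_approx (C : set E) (c : E) (B : R) :
  C !=set0 ->
  (forall t x y, 0 <= t <= 1 -> C x -> C y ->
     C (t%:C *: x + (1 - t)%:C *: y)) ->
  (forall u x, cabs u = 1 -> C x -> C (u *: x)) ->
  (forall x, C x -> forall a, cabs (x a) <= B) ->
  (forall (l : A -> R[i]) M, 0 < M ->
     (forall x, C x -> cabs (\sum_a l a * x a) <= M) ->
     cabs (\sum_a l a * c a) <= M) ->
  forall e, 0 < e -> exists2 x, C x & forall a, cabs (c a - x a) < e.
Proof.
move=> Cne Cconv Cphase CB Cdual e e0; apply: contrapT => far.
pose S := [set sdsq d (c - x) | x in C].
have farS x : C x -> e ^+ 2 <= sdsq d (c - x).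
  move=> Cx; rewrite leNgt; apply/negP => lt; apply: far; exists x => // a.
  rewrite -ltr_sqr ?nnegrE ?cabs_ge0 ?ltW//; apply: le_lt_trans lt.
  by rewrite family_sdsqC (bigD1 a)//= lerDl sumr_ge0// => i _; rewrite sqr_ge0.
have Sinf : has_inf S.
  by split; [case: Cne => x Cx; exists (sdsq d (c - x)), x|
    exists 0 => _ [x _ <-]; exact: sdsq_ge0].
pose D := inf S.
have DS x : C x -> D <= sdsq d (c - x).
  by move=> Cx; apply: ge_inf; [case: Sinf|exists x].
have D0 : 0 < D.
  apply: (lt_le_trans (exprn_gt0 2 e0)); apply: lb_le_inf; first by case: Sinf.
  by move=> _ [x Cx <-]; exact: farS.
pose B' : R := #|A|%:R * B ^+ 2 + D + 1.
have B'D : D + 1 <= B' by rewrite /B' -addrA lerDr mulr_ge0// sqr_ge0.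
have CB' x : C x -> sdsq d x <= B'.
  move=> Cx; rewrite /B' -addrA family_sdsqC.
  rewrite (@le_trans _ _ (#|A|%:R * B ^+ 2))//; last first.
    by rewrite lerDl; lra.
  rewrite mulr_natl -sumr_const; apply: ler_sum => a _.
  by rewrite ler_sqr ?nnegrE ?cabs_ge0 ?(le_trans (cabs_ge0 (x a)))// CB.
(* The squared distance of two points of [C] is at most [4 * B'], and [t * (4 * B') = D / 2]: the
   quadratic term of a step of size [t] costs at most [t * D / 2]. *)
pose t : R := D / (8 * B').
have B'0 : 0 < B' by lra.
have t0 : 0 < t by rewrite divr_gt0// mulr_gt0.
have t1 : t <= 1 by rewrite ler_pdivrMr ?mulr_gt0// mul1r; lra.
have [_ [x Cx <-] xD] : exists2 r, S r & r < D + t * D / 2.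
  by apply: inf_adherent => //; rewrite divr_gt0// mulr_gt0.
(* Otherwise a step from [x] towards [y] would bring the squared distance from [c] below its infimum
   [D]. *)
have key y : C y -> Re (d (c - x) (y - x)) <= D / 2.
  move=> Cy.
  have := DS _ (Cconv t y x _ Cy Cx); rewrite (ltW t0) t1 => /(_ isT).
  have -> : c - (t%:C *: y + (1 - t)%:C *: x) = (c - x) - t%:C *: (y - x).
    rewrite rmorphB/= scalerBl scale1r scalerBr !opprD !opprK; ring.
  rewrite sdsqB sdotZr sdsqZ conj_real ReMl cabs_real real_normK ?num_real// => h.
  have hB : sdsq d (y - x) <= 4 * B'.
    have := parallelogram d y x; have := sdsq_ge0 d (y + x).
    by have := CB' _ Cy; have := CB' _ Cx; lra.
  have tB : t * (8 * B') = D by rewrite /t divfK// gt_eqF// mulr_gt0.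
  have h2 : t ^+ 2 * sdsq d (y - x) <= t * (D / 2).
    rewrite expr2 -mulrA ler_pM2l// (le_trans (ler_wpM2l (ltW t0) hB))//; lra.
  set r := Re _ in h *; rewrite -(ler_pM2l t0).
  by move: h; set q := t ^+ 2 * _ in h2 *; lra.
pose l a : R[i] := (c a - x a)^*.
have lE y : \sum_a l a * y a = d y (c - x).
  by apply: eq_bigr => a _; rewrite /= /complex_dot mulrC.
(* The functional [<., c - x>] is at most [M] in modulus on [C], while its real part at [c] is at
   least [M + D / 2]; the positive number [M + D / 4] separates the two. *)
pose M := Re (d x (c - x)) + D / 2.
have lM y : C y -> cabs (\sum_a l a * y a) <= M.
  move=> Cy; have [u u1 uz] := phase_exists (\sum_a l a * y a).
  have := key _ (Cphase u y u1 Cy); rewrite sdot_herm Re_conj sdotBl ReB sdotZl -lE uz.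
  by rewrite /M /=; lra.
have M0 : 0 <= M by have := lM _ Cx; apply: le_trans; exact: cabs_ge0.
have := Cdual l (M + D / 4); rewrite (_ : 0 < _); last lra.
move=> /(_ isT) h; have {}h : cabs (\sum_a l a * c a) <= M + D / 4.
  by apply: h => y /lM; lra.
have := le_trans (Re_le_cabs _) h; rewrite lE.
have := DS _ Cx; rewrite {1}/sdsq sdotBl ReB /M; lra.
Qed.

End Separation.

(** * Norms of operator matrices as norms of sesquilinear forms *)

Section OperatorMatrixNorm.
Variables (R : realType) (I : finType) (H K : normedModType R[i]) (d : semidot K).
Hypothesis dE : forall k, sdn d k = rnorm k.
Implicit Type T : I -> I -> H -> K.

(** One direction is Cauchy-Schwarz; in the other, [k] is the normalised image of [h]. The
    semi-inner product is a parameter so that Hilbert spaces and scalars are covered at once. *)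
Lemma opmx_norm_le T (s : R) : 0 <= s ->
  (opmx_norm T <= s%:E)%E <->
  forall (h : I -> H) (k : I -> K),
    \sum_j rnorm (h j) ^+ 2 <= 1 -> \sum_i rnorm (k i) ^+ 2 <= 1 ->
    cabs (\sum_i \sum_j d (T i j (h j)) (k i)) <= s.
Proof.
move=> s0.
have famE (k : I -> K) : sdsq (family_semidot I d) k = \sum_i rnorm (k i) ^+ 2.
  by rewrite family_sdsq; apply: eq_bigr => i _; rewrite -dE sdn_sqr.
have sumE (h : I -> H) (k : I -> K) : \sum_i \sum_j d (T i j (h j)) (k i) =
    family_semidot I d (fun i => \sum_j T i j (h j)) k.
  by apply: eq_bigr => i _; rewrite sdot_suml.
split=> [Ts h k h1 k1|Ts].
  have : ((Num.sqrt (\sum_i rnorm (\sum_j T i j (h j)) ^+ 2))%:E <= s%:E)%E.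
    by apply: le_trans Ts; apply: ereal_sup_ubound; exists h.
  rewrite lee_fin sumE -famE -/(sdn _ _) => hs.
  rewrite (le_trans (sdot_CauchySchwarz _ _ _))// -[leRHS]mulr1.
  rewrite ler_pM ?sdn_ge0// -sqrtr1 ler_sqrt// ?famE//.
apply: ge_ereal_sup => _ [h h1 <-]; rewrite lee_fin -famE -/(sdn _ _).
set v := (fun i => _ : K); set n := sdn _ v.
have [->//|n0] := eqVneq n 0.
have np : 0 < n by rewrite lt_neqAle eq_sym n0 sdn_ge0.
have := Ts h (n^-1%:C *: v) h1; rewrite -famE sumE sdsqZ -sdn_sqr -exprMn.
rewrite -/v -/n cabs_real ger0_norm ?invr_ge0 ?(ltW np)// mulVf// expr1n.
move=> /(_ (lexx _)).
rewrite sdotZr conj_real sdsqE -rmorphM/= cabs_real -sdn_sqr expr2 mulKf//.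
by rewrite ger0_norm ?(ltW np).
Qed.

End OperatorMatrixNorm.

Lemma bop_mxnorm_le (R : realType) (H K : hilbert R) n (T : 'M[bop H K]_n)
    (s : R) : 0 <= s ->
  (bop_mxnorm T <= s%:E)%E <->
  forall (h : 'I_n -> H) (k : 'I_n -> K),
    \sum_j rnorm (h j) ^+ 2 <= 1 -> \sum_i rnorm (k i) ^+ 2 <= 1 ->
    cabs (\sum_i \sum_j hdot K (T i j (h j)) (k i)) <= s.
Proof.
exact: (opmx_norm_le (d := hilbert_semidot K) (@hilbert_sdn R K)).
Qed.

Lemma scalar_mxnorm_le (R : realType) (I : finType) (A : I -> I -> R[i])
    (s : R) : 0 <= s ->
  (scalar_mxnorm A <= s%:E)%E <->
  forall a b : I -> R[i],
    \sum_j cabs (a j) ^+ 2 <= 1 -> \sum_i cabs (b i) ^+ 2 <= 1 ->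
    cabs (\sum_i \sum_j A i j * a j * (b i)^*) <= s.
Proof.
exact: (opmx_norm_le (d := complex_semidot R) (@complex_sdn R)).
Qed.

Lemma opmx_norm_ge0 (R : realType) (I : finType) (H K : normedModType R[i])
  (T : I -> I -> H -> K) : (0 <= opmx_norm T)%E.
Proof.
set h := (fun=> 0) : I -> H.
apply: (@le_trans _ _ (Num.sqrt (\sum_i rnorm (\sum_j T i j (h j)) ^+ 2))%:E).
  by rewrite lee_fin sqrtr_ge0.
apply: ereal_sup_ubound; exists h => //=.
by rewrite big1 ?ler01// => j _; rewrite rnorm0 expr0n.
Qed.

(** * Riesz representation and adjoints *)

Section RealRadii.
Variables (R : realType) (V : normedModType R[i]).
Implicit Types x y : V.

Lemma rnormN x : rnorm (- x) = rnorm x.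
Proof. by apply: (@complexI R); rewrite -!rnormE normrN. Qed.

Lemma rnorm_eq0 x : (rnorm x == 0) = (x == 0).
Proof. by rewrite -(inj_eq (@complexI R)) -rnormE normr_eq0. Qed.

(** Radii in a complex normed module are elements of [R[i]]; as positive ones are real, filters can
    be handled with radii in [R]. *)
Lemma gt0_real (e : R[i]) : 0 < e -> 0 < Re e /\ e = (Re e)%:C.
Proof. by case: e => a b; rewrite ltcE /= => /andP[/eqP -> ->]. Qed.

Lemma cvg_rnormP T (F : set_system T) (f : T -> V) y : Filter F ->
  f @ F --> y <-> forall e : R, 0 < e -> \forall t \near F, rnorm (y - f t) < e.
Proof.
move=> FF; split=> [/cvgrPdist_lt cf e e0|cf].
  have := cf e%:C; rewrite ltcR => /(_ e0); apply: filterS => t.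
  by rewrite rnormE ltcR.
apply/cvgrPdist_lt => e /gt0_real[e0 ->]; apply: filterS (cf _ e0) => t.
by rewrite rnormE ltcR.
Qed.

Lemma ball_rnormE x (e : R) : ball x e%:C = [set y | rnorm (x - y) < e].
Proof.
by rewrite -ball_normE; apply/seteqP; split => y /=; rewrite rnormE ltcR.
Qed.

Lemma closure_rnormP (A : set V) x :
  closure A x <-> forall e : R, 0 < e -> exists2 y, A y & rnorm (x - y) < e.
Proof.
split=> [cA e e0|cA B /nbhs_ballP[e /= /gt0_real[e0 ->]]].
  have [|y [Ay xy]] := cA (ball x e%:C); first by apply: nbhsx_ballx; rewrite ltcR.
  by exists y => //; move: xy; rewrite ball_rnormE.
rewrite ball_rnormE => eB; have [y Ay xy] := cA _ e0.
by exists y; split=> //; exact: eB.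
Qed.

Lemma rnorm_cauchy_cvg (F : set_system V) : ProperFilter F ->
  (forall e : R, 0 < e -> exists x, F [set y | rnorm (x - y) < e]) -> cauchy F.
Proof.
move=> FF h; apply/cauchyP => e /= /gt0_real[e0 ->].
by have [x Fx] := h _ e0; exists x; rewrite ball_rnormE.
Qed.

End RealRadii.

Section BuildBop.
Variables (R : realType) (V W : normedModType R[i]).

Lemma bop_of_bound (f : V -> W) (M : R) :
  (forall a x y, f (a *: x + y) = a *: f x + f y) ->
  (forall x, rnorm (f x) <= M * rnorm x) -> exists T : bop V W, f = T.
Proof.
move=> flin fM; suff fP : f \in @is_bop R V W by exists (Bop fP).
apply/asboolP; split=> // x; apply/(cvg_rnormP _ _ (nbhs_filter _)) => e e0.
have M0 : 0 < `|M| + 1 by rewrite ltr_pwDr.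
have : nbhs x (ball x (e / (`|M| + 1))%:C).
  by apply: nbhsx_ballx; rewrite ltcR divr_gt0.
apply: filterS => y; rewrite ball_rnormE /= ltr_pdivlMr// mulrC => xy.
have -> : f x - f y = f (x - y).
  by have := flin (-1) y x; rewrite !scaleN1r addrC => ->; rewrite addrC.
apply: le_lt_trans xy; apply: (le_trans (fM _)); apply: ler_wpM2r.
  exact: rnorm_ge0.
by rewrite (le_trans (ler_norm _))// lerDl.
Qed.

Lemma opnorm_le_bound (T : bop V W) (M : R) : 0 <= M ->
  (forall x, rnorm (T x) <= M * rnorm x) -> opnorm T <= M.
Proof.
move=> M0 TM; apply: opnorm_le => x x1; rewrite (le_trans (TM x))//.
by rewrite -[leRHS]mulr1 ler_wpM2l.
Qed.

Lemma rnorm_bop (T : bop V W) : rnorm T = opnorm T.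
Proof. by []. Qed.

Lemma bop_ext (S T : bop V W) : (forall x, S x = T x) -> S = T.
Proof. by move=> ST; apply/val_inj/funext. Qed.

Lemma bop_linearE a (S T : bop V W) x :
  bop_fun (a *: S + T) x = a *: bop_fun S x + bop_fun T x.
Proof. by []. Qed.

Lemma bop_scaleE a (T : bop V W) x : bop_fun (a *: T) x = a *: bop_fun T x.
Proof. by []. Qed.

Lemma bopZ (T : bop V W) a x : bop_fun T (a *: x) = a *: bop_fun T x.
Proof. exact: linearZ. Qed.

Lemma bop_sumZ (T : bop V W) I (r : seq I) (a : I -> R[i]) (x : I -> V) :
  bop_fun T (\sum_(i <- r) a i *: x i) = \sum_(i <- r) a i *: bop_fun T (x i).
Proof. by rewrite linear_sum; apply: eq_bigr => i _; exact: bopZ. Qed.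

Lemma bopBE (S T : bop V W) x : bop_fun (S - T) x = bop_fun S x - bop_fun T x.
Proof. by []. Qed.

End BuildBop.

(** The representing vector minimises [|y|^2 - 2 Re f(y)]. The parallelogram law makes the sets of
    near minimisers a Cauchy filter, and the first-order condition at near minimisers identifies its
    limit. *)
Lemma riesz (R : realType) (H : hilbert R) (f : H -> R[i]) (M : R) :
  (forall a x y, f (a *: x + y) = a * f x + f y) ->
  (forall x, cabs (f x) <= M * rnorm x) ->
  exists z, forall y, f y = hdot H y z.
Proof.
move=> flin fM; pose d := hilbert_semidot H.
have f0 : f 0 = 0 by have := flin (-1) 0 0; rewrite scaler0 addr0 mulN1r addNr.
have fZ a x : f (a *: x) = a * f x.
  by have := flin a x 0; rewrite f0 !addr0.
have fD x y : f (x + y) = f x + f y.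
  by have := flin 1 x y; rewrite scale1r mul1r.
pose J y := sdsq d y - 2 * Re (f y).
pose m := inf (range J).
have Jinf : has_inf (range J).
  split; first by exists (J 0), 0.
  exists (- M ^+ 2) => _ [y _ <-]; rewrite /J hilbert_sdsq.
  have := le_trans (Re_le_cabs _) (fM y); have := sqr_ge0 (rnorm y - M).
  rewrite sqrrB -mulr_natl; lra.
have Jm y : m <= J y by apply: ge_inf; [case: Jinf|exists y].
pose A e := [set y | J y < m + e].
have Ane (e : R) : 0 < e -> A e !=set0.
  by move=> e0; have [_ [y _ <-] ye] := inf_adherent e0 Jinf; exists y.
(* [J] is at least [m] at the midpoint too, and [J y + J y'] minus twice the value at the midpoint
   is half the squared distance of [y] and [y']. *)
have Adist e y y' : A e y -> A e y' -> sdsq d (y - y') < 4 * e.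
  rewrite /A /=; have := Jm (2^-1%:C *: (y + y')); have := parallelogram d y y'.
  rewrite /J sdsqZ fZ fD ReMl ReD cabs_real ger0_norm// => h1 h2 h3 h4.
  have h5 : (2^-1 : R) ^+ 2 * 4 = 1 by field.
  have h6 : (2^-1 : R) * 2 = 1 by field.
  nra.
pose F := filter_from [set e : R | 0 < e] A.
have FF : ProperFilter F.
  apply: filter_from_proper => [|e /= e0]; last exact: Ane.
  apply: filter_from_filter => [|e e' /= e0 e'0]; first by exists 1 => /=.
  exists (Num.min e e'); first by rewrite /= lt_min e0.
  by move=> y; rewrite /A /= /Num.min; case: ifP => ?; split; lra.
have /cauchy_cvg/cvg_ex[z Fz] : cauchy F.
  apply: rnorm_cauchy_cvg => e e0; pose e' := e ^+ 2 / 4.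
  have e'0 : 0 < e' by rewrite divr_gt0// exprn_gt0.
  have [x Ax] := Ane _ e'0; exists x, e' => //= y Ay.
  rewrite /= -ltr_sqr ?nnegrE ?rnorm_ge0 ?(ltW e0)// -hilbert_sdsq.
  by have := Adist _ _ _ Ax Ay; rewrite /e'; lra.
exists z => w.
have near (e : R) : 0 < e -> exists2 y, J y < m + e & rnorm (z - y) < e.
  move=> e0; have [|y [? ?]] := @filter_ex _ F _ (A e `&` [set y | rnorm (z - y) < e]).
    apply: filterI; first by exists e.
    exact: ((@cvg_rnormP _ _ _ F id z _).1 Fz e e0).
  by exists y.
have Re0 v : Re (f v - hdot H v z) = 0.
  apply/eqP; rewrite -normr_eq0 eq_le normr_ge0 andbT.
  apply/ler_addgt0Pr => /= e e0.
  rewrite add0r; pose N := rnorm v + 1; have N0 : 0 < N by rewrite ltr_pwDr ?rnorm_ge0.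
  have [e1 e10 eN] : exists2 e1 : R, 0 < e1 & e1 * N * 2 = e.
    exists (e / (2 * N)); first by rewrite divr_gt0// mulr_gt0.
    by field; rewrite gt_eqF.
  (* One tolerance for both demands: [y] within [e1] of [z], and [J y] within [e1 ^+ 2] of the
     infimum, the constant term of the quadratic in [t] below. *)
  pose e2 := Num.min e1 (e1 ^+ 2).
  have e20 : 0 < e2 by rewrite lt_min e10 exprn_gt0.
  have [y yJ zy] := near _ e20.
  have yJ' : J y < m + e1 ^+ 2 by rewrite (lt_le_trans yJ)// lerD2l ge_min lexx orbT.
  have zy' : rnorm (z - y) < e1 by rewrite (lt_le_trans zy)// ge_min lexx.
  have h : Re (f v - hdot H v y) ^+ 2 <= e1 ^+ 2 * sdsq d v.
    apply: discriminant_le; first exact: sdsq_ge0.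
    move=> t; have := Jm (y + t%:C *: v).
    rewrite /J sdsqD sdsqZ fD fZ sdotZr conj_real !ReD !ReMl cabs_real.
    rewrite real_normK ?num_real//.
    rewrite ReN (_ : Re (hdot H v y) = Re (d y v)); last first.
      by rewrite hdot_herm Re_conj.
    by move: yJ'; rewrite /J; lra.
  have h1 : `|Re (f v - hdot H v y)| <= e1 * N.
    rewrite -ler_sqr ?nnegrE ?mulr_ge0 ?(ltW e10) ?(ltW N0)//.
    rewrite real_normK ?num_real// exprMn (le_trans h)// ler_wpM2l ?sqr_ge0//.
    rewrite hilbert_sdsq ler_sqr ?nnegrE ?rnorm_ge0 ?(ltW N0)// /N; lra.
  have h2 : `|Re (hdot H v z - hdot H v y)| <= e1 * N.
    rewrite -hdotBr.
    apply: (le_trans (norm_Re_le _)); apply: (le_trans (hdot_CauchySchwarz _ _)).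
    by rewrite mulrC ler_pM ?rnorm_ge0 ?(ltW zy')// /N; lra.
  have -> : Re (f v - hdot H v z) = Re (f v - hdot H v y) - Re (hdot H v z - hdot H v y).
    by rewrite !ReB; lra.
  by rewrite (le_trans (ler_normB _ _))//; lra.
have [u u1 uz] := phase_exists (f w - hdot H w z).
have := Re0 (u *: w); rewrite fZ hdotZl -mulrBr uz /= => /eqP.
by rewrite cabs_eq0 subr_eq0 => /eqP.
Qed.

Section FormBop.
Variables (R : realType) (H K : hilbert R).

(** The vector [T x] represents the conjugate of [B x]; the norm bound follows by taking
    [y = T x]. *)
Lemma bop_of_form (B : H -> K -> R[i]) (M : R) : 0 <= M ->
  (forall a x y z, B (a *: x + y) z = a * B x z + B y z) ->
  (forall a x y z, B x (a *: y + z) = a^* * B x y + B x z) ->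
  (forall x y, cabs (B x y) <= M * rnorm x * rnorm y) ->
  exists2 T : bop H K, (forall x y, hdot K (T x) y = B x y) & opnorm T <= M.
Proof.
move=> M0 Bl Br BM.
have /choice[T TP] : forall x, exists z, forall y, hdot K z y = B x y.
  move=> x; have [|y|z zP] := @riesz _ K (fun y => (B x y)^*) (M * rnorm x).
  - by move=> a y z; rewrite Br rmorphD rmorphM/= conjCK.
  - by rewrite cabs_conj.
  by exists z => y; rewrite hdot_herm -zP conjCK.
have Tlin a x y : T (a *: x + y) = a *: T x + T y.
  apply: hdot_inj => z; rewrite TP Bl -!TP.
  by rewrite hdot_linear.
have TM x : rnorm (T x) <= M * rnorm x.
  have [->|Tx0] := eqVneq (rnorm (T x)) 0; first by rewrite mulr_ge0 ?rnorm_ge0.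
  have Tx : 0 < rnorm (T x) by rewrite lt_neqAle eq_sym Tx0 rnorm_ge0.
  have := BM x (T x); rewrite -TP hdotxx cabs_real.
  by rewrite ger0_norm ?sqr_ge0// expr2 ler_pM2r.
have [S TS] := bop_of_bound Tlin TM.
exists S => [x y|]; first by rewrite -TS TP.
by apply: opnorm_le_bound => // x; rewrite -TS.
Qed.

End FormBop.

Section Adjoint.
Variable R : realType.
Implicit Types H K : hilbert R.

Lemma adjoint_exists H K (T : bop H K) : exists S, is_adjoint T S.
Proof.
have [|a x y z|a x y z|x y|S ST _] :=
    @bop_of_form _ K H (fun y x => hdot K y (T x)) (opnorm T).
- exact: opnorm_ge0.
- exact: hdot_linear.
- by rewrite linearP hdotDr hdotZr.
- rewrite (le_trans (hdot_CauchySchwarz _ _))// mulrAC mulrC.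
  by rewrite ler_wpM2r ?rnorm_ge0// opnormP.
by exists S => x y; rewrite hdot_herm -ST -hdot_herm.
Qed.

Lemma is_adjoint_sym H K (T : bop H K) S : is_adjoint T S -> is_adjoint S T.
Proof. by move=> TS x y; rewrite hdot_herm -TS -hdot_herm. Qed.

Lemma adjoint_uniq H K (T : bop H K) S S' :
  is_adjoint T S -> is_adjoint T S' -> S = S'.
Proof.
move=> /is_adjoint_sym TS /is_adjoint_sym TS'; apply: bop_ext => y.
by apply: hdot_inj => x; rewrite TS TS'.
Qed.

End Adjoint.

(** * Quotient Hilbert spaces *)

(** Completeness is stated for sequences with geometric gaps, the form established in
    [bfam_complete]; the bound [2 * 2^-n] is the sum of the remaining gaps. *)
Record complete_semidot (R : realType) (E : lmodType R[i]) := CompleteSemidot {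
  csdot :> semidot E;
  csdotP : forall u : nat -> E, (forall n, sdn csdot (u n.+1 - u n) < 2^-1 ^+ n) ->
    exists l, forall n, sdn csdot (l - u n) <= 2 * 2^-1 ^+ n
}.

Definition is_repr (R : realType) (E : lmodType R[i]) (d : complete_semidot E) :
  {pred E -> R[i]} := fun f => `[< exists x, f = d x >].

(* The quotient of E by the kernel of d, realised as the image of the map      *)
(* x |-> d x, so that it is a subtype of a function space.                     *)
Record squo (R : realType) (E : lmodType R[i]) (d : complete_semidot E) := Squo {
  squo_fun :> E -> R[i];
  squoP : squo_fun \in is_repr d
}.

Section Squo.
Variables (R : realType) (E : lmodType R[i]) (d : complete_semidot E).

Lemma is_repr_submod : submod_closed (is_repr d : {pred E -> R[i]^o}).
Proof.
split; first by apply/asboolP; exists 0; apply/funext => y; rewrite sdot0l.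
move=> a f g /asboolP[x ->] /asboolP[y ->]; apply/asboolP; exists (a *: x + y).
by apply/funext => z; rewrite sdot_linear.
Qed.

HB.instance Definition _ := GRing.isSubmodClosed.Build R[i] (E -> R[i]^o)
  (is_repr d) is_repr_submod.
HB.instance Definition _ := [isSub for @squo_fun R E d].
HB.instance Definition _ := [Choice of squo d by <:].
HB.instance Definition _ := [SubChoice_isSubLmodule of squo d by <:].

Lemma squo_class_subproof (x : E) : (d x : E -> R[i]) \in is_repr d.
Proof. by apply/asboolP; exists x. Qed.

Definition squo_class (x : E) : squo d := Squo (squo_class_subproof x).

Lemma squo_class_linear : linear squo_class.
Proof.
move=> a x y; apply/val_inj/funext => z /=; exact: sdot_linear.
Qed.

HB.instance Definition _ := GRing.isLinear.Build R[i] E (squo d) *:%R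
  squo_class squo_class_linear.

Lemma squo_repr_exists (f : squo d) : exists x, squo_class x = f.
Proof.
by case: f => f fP; have /asboolP[x fx] := fP; exists x; apply: val_inj.
Qed.

Definition squo_repr (f : squo d) : E := sval (cid (squo_repr_exists f)).

Lemma squo_reprK f : squo_class (squo_repr f) = f.
Proof. by rewrite /squo_repr; case: cid. Qed.

Definition squo_dot (f g : squo d) : R[i] := d (squo_repr f) (squo_repr g).

(** The class of [x] is the function [d x] itself, so a change of representative does not affect its
    inner products. *)
Lemma squo_dotE x y : squo_dot (squo_class x) (squo_class y) = d x y.
Proof.
have h z t : d (squo_repr (squo_class z)) t = d z t.
  by have := squo_reprK (squo_class z) => /(congr1 (fun f : squo d => f t)).
by rewrite /squo_dot h sdot_herm h -sdot_herm.
Qed.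

Lemma squo_ind (P : squo d -> Prop) : (forall x, P (squo_class x)) -> forall f, P f.
Proof. by move=> h f; rewrite -(squo_reprK f). Qed.

Definition squo_norm (f : squo d) : R[i] := (sdn d (squo_repr f))%:C.

Lemma squo_normE x : squo_norm (squo_class x) = (sdn d x)%:C.
Proof. by rewrite /squo_norm /sdn /sdsq -/(squo_dot _ _) squo_dotE. Qed.

Lemma squo_normD f g : squo_norm (f + g) <= squo_norm f + squo_norm g.
Proof.
elim/squo_ind: f => x; elim/squo_ind: g => y.
by rewrite -linearD !squo_normE -rmorphD lecR sdnD.
Qed.

Lemma squo_normZ (a : R[i]) f : squo_norm (a *: f) = `|a| * squo_norm f.
Proof.
by elim/squo_ind: f => x; rewrite -linearZ !squo_normE sdnZ rmorphM/= -cabsE.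
Qed.

Lemma squo_norm0_eq0 f : squo_norm f = 0 -> f = 0.
Proof.
elim/squo_ind: f => x; rewrite squo_normE => /complexI x0.
by apply/val_inj/funext => y /=; rewrite sdn_eq0_dot.
Qed.

HB.instance Definition _ := @Lmodule_isNormed.Build R[i] (squo d)
  squo_norm squo_normD squo_normZ squo_norm0_eq0.

Lemma squo_rnormE x : rnorm (squo_class x) = sdn d x.
Proof. by apply: (@complexI R); rewrite -rnormE -squo_normE. Qed.

Lemma half_expr_small (e : R) : 0 < e -> exists n, 2^-1 ^+ n < e.
Proof.
move=> e0.
have /cvgrPdist_lt/(_ e e0)[n _ nP] : (fun n => 2^-1 ^+ n : R^o) @ \oo --> (0 : R^o).
  by apply: cvg_expr; rewrite ger0_norm// invf_lt1// ltr1n.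
exists n; have := nP n (leqnn n) => /=; rewrite sub0r normrN ger0_norm//.
Qed.

(** The filter is sampled at radii [2^-n / 4], so that consecutive sample points are less than
    [2^-n] apart and [csdotP] applies. *)
Lemma squo_complete (F : set_system (squo d)) : ProperFilter F -> cauchy F -> cvg F.
Proof.
move=> FF /cauchyP Fc.
have h0 n : 0 < (2^-1 : R) ^+ n by rewrite exprn_gt0.
have /choice[x xP] : forall n, exists x : E,
    F [set y : squo d | rnorm (squo_class x - y) < 2^-1 ^+ n / 4].
  move=> n; have [|f Ff] := Fc (2^-1 ^+ n / 4)%:C; first by rewrite ltcR divr_gt0.
  by exists (squo_repr f); rewrite squo_reprK -ball_rnormE.
have [|l lP] := @csdotP _ _ d x.
  move=> n; rewrite -squo_rnormE linearB/=.
  have [y [/= y1 y2]] := @filter_ex _ F _ _ (filterI (xP n) (xP n.+1)).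
  have -> : squo_class (x n.+1) - squo_class (x n) =
            (squo_class (x n.+1) - y) - (squo_class (x n) - y).
    by rewrite opprB addrA subrK.
  apply: (le_lt_trans (rnormD _ _)); rewrite rnormN.
  by move: y1 y2; rewrite exprS; have := h0 n; lra.
apply/cvg_ex; exists (squo_class l).
suff : id @ F --> squo_class l by [].
apply/(cvg_rnormP _ _) => e e0.
have [n ne] := half_expr_small (divr_gt0 e0 (ltr0n _ 3)).
apply: filterS (xP n) => y /= yn.
rewrite -(subrK (squo_class (x n)) (squo_class l)) -addrA.
apply: (le_lt_trans (rnormD _ _)); rewrite -linearB squo_rnormE.
by have := lP n; have := h0 n; move: yn ne; lra.
Qed.

HB.instance Definition _ := Uniform_isComplete.Build (squo d) squo_complete.

Lemma squo_dot_bilinear : bilinear_for ( *%R : R[i] -> R[i] -> R[i])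
  (Num.conj \; *%R : R[i] -> R[i] -> R[i]) squo_dot.
Proof.
split=> g a f h; elim/squo_ind: f => f; elim/squo_ind: g => g; elim/squo_ind: h => h.
  by rewrite -linearP !squo_dotE sdot_linear.
by rewrite -linearP !squo_dotE sdotDr sdotZr.
Qed.

HB.instance Definition _ := bilinear_isBilinear.Build R[i] (squo d) (squo d) R[i]
  ( *%R ) (Num.conj \; *%R) squo_dot squo_dot_bilinear.

Lemma squo_dot_herm (f g : squo d) :
  squo_dot f g = (-1) ^+ false * Num.conj (squo_dot g f).
Proof.
by elim/squo_ind: f => f; elim/squo_ind: g => g; rewrite !squo_dotE mul1r sdot_herm.
Qed.

HB.instance Definition _ := isHermitianSesquilinear.Build R[i] (squo d) false
  Num.conj squo_dot squo_dot_herm.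

Lemma squo_dot_gt0 (f : squo d) : f != 0 -> 0 < squo_dot f f.
Proof.
elim/squo_ind: f => f; rewrite squo_dotE sdsqE ltcR lt_neqAle sdsq_ge0 andbT.
apply: contraNneq => f0; rewrite -rnorm_eq0 squo_rnormE /sdn -f0 sqrtr0//.
Qed.

HB.instance Definition _ := isDotProduct.Build R[i] (squo d) squo_dot squo_dot_gt0.

Lemma squo_hdotE (f : squo d) : `|f| ^+ 2 = squo_dot f f.
Proof.
elim/squo_ind: f => f; rewrite rnormE squo_rnormE squo_dotE sdsqE -sdn_sqr.
by rewrite rmorphXn.
Qed.

Definition squo_hilbert : hilbert R := @Hilbert R (squo d) squo_dot squo_hdotE.

End Squo.

(** * Ultraproducts of Hilbert spaces and operators *)

(** The fibre over [i] has one coordinate more than [ui_rank i]. The depth tends to infinity along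
    the ultrafilter, which makes diagonal arguments over a sequence possible. *)
Record ultraindex := UltraIndex {
  ui_sort :> Type;
  ui_filter : set_system ui_sort;
  ui_ultra : UltraFilter ui_filter;
  ui_rank : ui_sort -> nat;
  ui_depth : ui_sort -> nat;
  ui_depth_infty : forall m, ui_filter [set i | (m <= ui_depth i)%N]
}.

#[local] Existing Instance ui_ultra.

(** * Limits along the ultrafilter *)

Section UltraLimit.
Variables (R : realType) (U : ultraindex).
Local Notation UF := (ui_filter (u:=U)).
Implicit Types (f g : U -> R[i]) (l : R[i]).

Definition ucvg f l := forall e : R, 0 < e -> \forall i \near UF, cabs (l - f i) < e.

Lemma ucvg_uniq f l l' : ucvg f l -> ucvg f l' -> l = l'.
Proof.
move=> fl fl'; apply/eqP; rewrite -subr_eq0 -cabs_eq0 eq_le cabs_ge0 andbT.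
apply/ler_addgt0Pr => /= e e0; rewrite add0r.
have e2 : 0 < e / 2 by rewrite divr_gt0.
have [i [/= h1 h2]] := filter_ex (filterI (fl _ e2) (fl' _ e2)).
rewrite -(subrK (f i) l) -addrA (le_trans (cabsD _ _))// [cabs (f i - l')]cabsB.
lra.
Qed.

Lemma ucvg_near f g l : (\forall i \near UF, f i = g i) -> ucvg f l -> ucvg g l.
Proof.
by move=> fg fl e e0; apply: filterS2 fg (fl _ e0) => i <-.
Qed.

Lemma ucvg_cst l : ucvg (fun=> l) l.
Proof. by move=> e e0; apply: nearW => i; rewrite subrr cabs0. Qed.

Lemma ucvgD f g l m : ucvg f l -> ucvg g m -> ucvg (fun i => f i + g i) (l + m).
Proof.
move=> fl gm e e0; have e2 : 0 < e / 2 by rewrite divr_gt0.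
apply: filterS2 (fl _ e2) (gm _ e2) => i h1 h2.
by rewrite opprD addrACA (le_lt_trans (cabsD _ _))//; lra.
Qed.

Lemma ucvgZ a f l : ucvg f l -> ucvg (fun i => a * f i) (a * l).
Proof.
move=> fl e e0; have a0 : 0 < cabs a + 1 by rewrite ltr_wpDl ?cabs_ge0.
apply: filterS (fl _ (divr_gt0 e0 a0)) => i; rewrite ltr_pdivlMr// => h.
rewrite -mulrBr cabsM; apply: le_lt_trans h; rewrite mulrC ler_wpM2l ?cabs_ge0//.
by rewrite lerDl.
Qed.

Lemma ucvg_conj f l : ucvg f l -> ucvg (fun i => (f i)^*) l^*.
Proof.
by move=> fl e e0; apply: filterS (fl _ e0) => i; rewrite -rmorphB cabs_conj.
Qed.

Lemma ucvg_Re_ge f l (c : R) : ucvg f l -> (\forall i \near UF, c <= Re (f i)) ->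
  c <= Re l.
Proof.
move=> fl f0; apply/ler_addgt0Pr => /= e e0.
have [i [/= h1 h2]] := filter_ex (filterI (fl _ e0) f0).
have := le_lt_trans (Re_le_cabs _) h1; have := le_lt_trans (Re_le_cabs (f i - l)).
rewrite cabsB => /(_ _ h1); rewrite !ReB; lra.
Qed.

(** The limit is the supremum of the levels below [f] on a set of the ultrafilter; above the
    supremum the ultrafilter must contain the complementary set. *)
Lemma real_ultralimit (f : U -> R) (B : R) : (forall i, `|f i| <= B) ->
  exists l : R, forall e : R, 0 < e -> \forall i \near UF, `|l - f i| < e.
Proof.
move=> fB; pose S := [set t | UF [set i | t <= f i]].
have hS : has_sup S.
  split.
    by exists (- B); apply: nearW => i; have := fB i; rewrite ler_norml => /andP[].
  exists B => t /filter_ex[i /= ti]; apply: (le_trans ti).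
  by have := fB i; rewrite ler_norml => /andP[].
exists (sup S) => e e0.
have h1 : \forall i \near UF, sup S - e < f i.
  have [t St lt] := sup_adherent e0 hS.
  by apply: filterS St => i; apply: lt_le_trans.
have h2 : \forall i \near UF, f i < sup S + e.
  have [h|] := in_ultra_setVsetC [set i | sup S + e <= f i] (ui_ultra U).
    by have := ub_le_sup hS.2 h; lra.
  by apply: filterS => i /=; move/negP; rewrite -ltNge.
apply: filterS2 h1 h2 => i h1 h2; rewrite ltr_norml; lra.
Qed.

Lemma ultralimit_exists f (B : R) : (forall i, cabs (f i) <= B) -> exists l, ucvg f l.
Proof.
move=> fB.
have [|a ha] := @real_ultralimit (fun i => Re (f i)) B.
  by move=> i; rewrite (le_trans (norm_Re_le _)).
have hIm z : Im z = Re (- 'i%C * z).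
  by case: z => x y /=; rewrite oppr0 mul0r sub0r mulN1r opprK.
have ci : cabs (- 'i%C : R[i]) = 1.
  apply/eqP; rewrite cabsN -(@pexpr_eq1 _ _ 2) ?cabs_ge0// cabs_sqr/=.
  by rewrite expr0n add0r expr1n.
have [|b hb] := @real_ultralimit (fun i => Im (f i)) B.
  by move=> i; rewrite hIm (le_trans (norm_Re_le _))// cabsM ci mul1r.
exists (a +i* b) => e e0; have e2 : 0 < e / 2 by rewrite divr_gt0.
apply: filterS2 (ha _ e2) (hb _ e2) => i h1 h2.
rewrite (complexE (_ - _)) (le_lt_trans (cabsD _ _))//.
rewrite -[X in _ + X]cabsN -mulNr cabsM ci mul1r !cabs_real.
by move: h1 h2; case: (f i) => x y /=; lra.
Qed.

(** The value [0] stands for divergent families; bounded ones converge, by [ulimP]. *)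
Definition ulim f : R[i] := xget 0 [set l | ucvg f l].

Lemma ulimP f (B : R) : (forall i, cabs (f i) <= B) -> ucvg f (ulim f).
Proof. by move=> /ultralimit_exists[l fl]; rewrite /ulim; case: xgetP => // /(_ l). Qed.

Lemma ulim_eq f l : ucvg f l -> ulim f = l.
Proof.
move=> fl; rewrite /ulim; case: xgetP => [y _ fy|/(_ l)//].
exact: ucvg_uniq fy fl.
Qed.

End UltraLimit.

(** * Bounded families and the ultraproduct space *)

Section Families.
Variables (R : realType) (U : ultraindex) (H : hilbert R).
Local Notation UF := (ui_filter (u:=U)).

(** The square of the norm in the fibre. The successor guarantees coordinate 0 in every fibre, where
    [const_family] places its vector. *)
Definition fibre_norm (x : U -> nat -> H) (i : U) : R :=
  \sum_(r < (ui_rank i).+1) rnorm (x i r) ^+ 2.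

Definition is_bfam : {pred U -> nat -> H} :=
  fun x => `[< exists B, forall i, fibre_norm x i <= B >].

(** Coordinates range over all of [nat] and those beyond the rank are ignored by the inner product;
    this avoids a type that varies with the index. *)
Record bfam := Bfam { bfam_fun :> U -> nat -> H; bfamP : bfam_fun \in is_bfam }.

Definition fibre_semidot (i : U) : semidot ('I_(ui_rank i).+1 -> H) :=
  family_semidot _ (hilbert_semidot H).

Definition fibre (x : U -> nat -> H) (i : U) : 'I_(ui_rank i).+1 -> H :=
  fun r => x i r.
Arguments fibre x i r : clear implicits.

Lemma fibre_normE x i : fibre_norm x i = sdsq (fibre_semidot i) (fibre x i).
Proof. by rewrite family_sdsq; apply: eq_bigr => r _; rewrite hilbert_sdsq. Qed.

Lemma fibre_linear a x y i : fibre (a *: x + y) i = a *: fibre x i + fibre y i.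
Proof. by []. Qed.

Lemma is_bfam_submod : submod_closed is_bfam.
Proof.
split.
  apply/asboolP; exists 0 => i; rewrite /fibre_norm big1// => r _.
  by rewrite [X in rnorm X](_ : _ = 0)// rnorm0 expr0n.
move=> a x y /asboolP[B xB] /asboolP[C yC]; apply/asboolP.
exists (2 * (cabs a ^+ 2 * B) + 2 * C) => i.
rewrite fibre_normE fibre_linear.
have := parallelogram (fibre_semidot i) (a *: fibre x i) (fibre y i).
have := sdsq_ge0 (fibre_semidot i) (a *: fibre x i - fibre y i).
rewrite sdsqZ -!fibre_normE; have := yC i.
have := ler_wpM2l (sqr_ge0 (cabs a)) (xB i); lra.
Qed.

HB.instance Definition _ := GRing.isSubmodClosed.Build R[i] (U -> nat -> H)
  is_bfam is_bfam_submod.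
HB.instance Definition _ := [isSub for bfam_fun].
HB.instance Definition _ := [Choice of bfam by <:].
HB.instance Definition _ := [SubChoice_isSubLmodule of bfam by <:].

Lemma bfam_linearE a (x y : bfam) i r :
  bfam_fun (a *: x + y) i r = a *: bfam_fun x i r + bfam_fun y i r.
Proof. by []. Qed.

Lemma bfamBE (x y : bfam) i r :
  bfam_fun (x - y) i r = bfam_fun x i r - bfam_fun y i r.
Proof. by []. Qed.

Lemma bfam_ext (x y : bfam) : (forall i r, x i r = y i r) -> x = y.
Proof.
by move=> xy; apply/val_inj/funext => i; apply/funext => r; exact: xy.
Qed.

Definition fibre_dot (x y : bfam) (i : U) : R[i] :=
  fibre_semidot i (fibre x i) (fibre y i).

Lemma fibre_dot_cvg (x y : bfam) : ucvg (fibre_dot x y) (ulim (fibre_dot x y)).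
Proof.
case: x => x xP; case: y => y yP.
have /asboolP[B xB] := xP; have /asboolP[C yC] := yP.
apply: (@ulimP _ _ _ (Num.sqrt B * Num.sqrt C)) => i.
rewrite (le_trans (sdot_CauchySchwarz _ _ _))// ler_pM ?sdn_ge0// ler_wsqrtr//.
  by rewrite -fibre_normE.
by rewrite -fibre_normE.
Qed.

Definition bfam_dot (x y : bfam) : R[i] := ulim (fibre_dot x y).

Lemma bfam_dot_linear a x y z :
  bfam_dot (a *: x + y) z = a * bfam_dot x z + bfam_dot y z.
Proof.
apply: ulim_eq; have := ucvgD (ucvgZ a (fibre_dot_cvg x z)) (fibre_dot_cvg y z).
by apply: ucvg_near; apply: nearW => i; rewrite /fibre_dot -sdot_linear.
Qed.

Lemma bfam_dot_herm x y : bfam_dot y x = (bfam_dot x y)^*.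
Proof.
apply: ulim_eq; have := ucvg_conj (fibre_dot_cvg x y).
by apply: ucvg_near; apply: nearW => i; rewrite -sdot_herm.
Qed.

Lemma bfam_dot_ge0 x : 0 <= bfam_dot x x.
Proof.
have xc := fibre_dot_cvg x x.
(* An ultralimit of real numbers is real. *)
have -> : bfam_dot x x = (Re (bfam_dot x x))%:C.
  apply: ulim_eq => e e0; apply: filterS (xc _ e0) => i.
  rewrite {2 3}/fibre_dot sdsqE => h; apply: le_lt_trans h.
  rewrite -rmorphB cabs_real -[X in `|_ - X|]/(Re (sdsq (fibre_semidot i) (fibre x i))%:C).
  by rewrite -ReB norm_Re_le.
rewrite lecR; apply: (ucvg_Re_ge xc); apply: nearW => i; exact: sdsq_ge0.
Qed.

Definition bfam_semidot : semidot bfam :=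
  Semidot bfam_dot_linear bfam_dot_herm bfam_dot_ge0.

(** Together with the next two lemmas, this moves norm estimates between the ultraproduct and its
    fibres. *)
Lemma bfam_sdsq_lt (x : bfam) (c : R) : sdsq bfam_semidot x < c ->
  \forall i \near UF, fibre_norm x i < c.
Proof.
move=> xc; have h : 0 < c - sdsq bfam_semidot x by rewrite subr_gt0.
apply: filterS (fibre_dot_cvg x x h) => i.
rewrite cabsB => /(le_lt_trans (Re_le_cabs _)); rewrite ReB fibre_normE.
rewrite -/(bfam_dot _ _) -[Re (bfam_dot _ _)]/(sdsq bfam_semidot x).
by rewrite -[Re (fibre_dot _ _ _)]/(sdsq _ _); lra.
Qed.

Lemma bfam_sdsq_le (x : bfam) (c : R) : (\forall i \near UF, fibre_norm x i <= c) ->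
  sdsq bfam_semidot x <= c.
Proof.
move=> xc; have := ucvg_Re_ge (ucvgZ (-1) (fibre_dot_cvg x x)) (c := - c).
rewrite !mulN1r ReN lerN2; apply; apply: filterS xc => i.
by rewrite mulN1r ReN lerN2 fibre_normE.
Qed.

Lemma bfam_sdsq_near (x : bfam) (e : R) : 0 < e ->
  \forall i \near UF, sdsq bfam_semidot x <= fibre_norm x i + e.
Proof.
move=> e0; apply: filterS (fibre_dot_cvg x x e0) => i.
move=> /(le_lt_trans (Re_le_cabs _)); rewrite ReB fibre_normE /sdsq /=.
by rewrite -/(bfam_dot x x) ltrBlDl => /ltW.
Qed.

(* Countable saturation: in the fibre over i the limit is u n for the last     *)
(* n <= ui_depth i up to which consecutive gaps in that fibre are small.       *)
Lemma bfam_complete (u : nat -> bfam) :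
  (forall n, sdn bfam_semidot (u n.+1 - u n) < 2^-1 ^+ n) ->
  exists l, forall n, sdn bfam_semidot (l - u n) <= 2 * 2^-1 ^+ n.
Proof.
move=> uc; pose a n : R := 2^-1 ^+ n.
have a0 n : 0 < a n by rewrite exprn_gt0.
have aS n : a n = 2 * a n.+1 by rewrite /a exprS mulrA divff ?mul1r.
pose p i (x : bfam) := sdn (fibre_semidot i) (fibre x i).
have pE i x : p i x ^+ 2 = fibre_norm x i by rewrite sdn_sqr -fibre_normE.
have pD i x y : p i (x + y) <= p i x + p i y.
  exact: (sdnD (fibre_semidot i) (fibre x i) (fibre y i)).
pose good n i := p i (u n.+1 - u n) < a n.
have goodU n : \forall i \near UF, good n i.
  apply: filterS (@bfam_sdsq_lt (u n.+1 - u n) (a n ^+ 2) _) => [i|].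
    by rewrite -pE ltr_sqr ?nnegrE ?sdn_ge0 ?(ltW (a0 n)).
  by rewrite -sdn_sqr ltr_sqr ?nnegrE ?sdn_ge0 ?(ltW (a0 n)).
(* [find] returns the length [ui_depth i] when every gap below the depth is good. *)
pose m i := find (fun n => ~~ good n i) (iota 0 (ui_depth i)).
have good_lt i n : (n < m i)%N -> good n i.
  move=> nm; have := before_find 0%N nm; rewrite nth_iota ?add0n.
    by move=> /negbFE.
  by rewrite -[X in (_ < X)%N](size_iota 0) (leq_trans nm)// find_size.
have m_ge i k : (k <= ui_depth i)%N -> (forall n, (n < k)%N -> good n i) -> (k <= m i)%N.
  move=> kd kg; rewrite leqNgt; apply/negP => mk.
  have hm : (m i < size (iota 0 (ui_depth i)))%N by rewrite size_iota (leq_trans mk).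
  have hh : has (fun n => ~~ good n i) (iota 0 (ui_depth i)) by rewrite has_find.
  have := nth_find 0%N hh; rewrite -[find _ _]/(m i) nth_iota ?add0n ?kg//.
  by rewrite size_iota in hm.
(* [2 * a k - 2 * a n] is the sum of [a j] over [k <= j < n]. *)
have tele i k n : (k <= n <= m i)%N -> p i (u n - u k) <= 2 * a k - 2 * a n.
  move=> /andP[kn]; elim: n kn => [|n IH]; rewrite leq_eqVlt => /orP[/eqP <-|].
  - by move=> _; rewrite subrr /p [fibre _ i](_ : _ = 0)// sdn0 subrr.
  - by [].
  - by move=> _; rewrite subrr /p [fibre _ i](_ : _ = 0)// sdn0 subrr.
  move=> kn nm; have h1 := IH kn (ltnW nm); have h2 : p i _ < a n := good_lt _ _ nm.
  have -> : u n.+1 - u k = (u n.+1 - u n) + (u n - u k) by rewrite addrA subrK.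
  apply: (le_trans (pD _ _ _)); move: h1 h2 (aS n).
  by move: (p _ _) (p _ _) (a n) (a n.+1) (a k) => *; lra.
pose l i := u (m i) i.
have lP : l \in is_bfam.
  have /asboolP[B uB] := bfamP (u 0%N).
  apply/asboolP; exists ((2 + Num.sqrt B) ^+ 2) => i.
  have -> : fibre_norm l i = p i (u (m i)) ^+ 2 by rewrite pE.
  rewrite ler_sqr ?nnegrE ?sdn_ge0 ?addr_ge0 ?sqrtr_ge0//.
  rewrite -(subrK (u 0%N) (u (m i))).
  have h1 := tele i 0%N (m i) (leqnn _).
  have h2 : p i (u 0%N) <= Num.sqrt B by rewrite /p /sdn ler_wsqrtr// -fibre_normE.
  apply: (le_trans (pD _ _ _)); have := a0 (m i).
  have a01 : a 0%N = 1 by [].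
  rewrite a01 in h1; move: h1 h2.
  by move: (p _ _) (p _ _) (a _) (Num.sqrt _) => *; lra.
exists (Bfam lP) => n.
rewrite -ler_sqr ?nnegrE ?sdn_ge0 ?mulr_ge0 ?(ltW (a0 n))// sdn_sqr.
apply: bfam_sdsq_le.
(* For almost every [i] the first [n] gaps are good and the depth is at least [n]; then [m i] is at
   least [n] and the telescoped bound reaches the limit. *)
have : \forall i \near UF, forall k, (k < n)%N -> good k i.
  elim: n => [|n IH]; first exact: nearW.
  apply: filterS2 IH (goodU n) => i h1 h2 k; rewrite ltnS leq_eqVlt.
  by move=> /orP[/eqP->//|]; exact: h1.
move=> goodn; apply: filterS2 (@ui_depth_infty U n) goodn => i /= ni gi.
have nm := m_ge _ _ ni gi.
rewrite [leLHS](_ : _ = p i (u (m i) - u n) ^+ 2); last by rewrite pE.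
rewrite ler_sqr ?nnegrE ?sdn_ge0 ?mulr_ge0 ?(ltW (a0 n))//.
apply: (le_trans (tele i n (m i) _)); first by rewrite nm leqnn.
by rewrite gerBl mulr_ge0// ltW.
Qed.

(* The space H^U of the introduction; uop below is T |-> T^U.                  *)
Definition up : hilbert R := squo_hilbert (CompleteSemidot bfam_complete).

Definition ucl (x : bfam) : up := squo_class (CompleteSemidot bfam_complete) x.

Lemma ucl_linear a x y : ucl (a *: x + y) = a *: ucl x + ucl y.
Proof. exact: squo_class_linear. Qed.

Lemma uclB x y : ucl (x - y) = ucl x - ucl y.
Proof. by rewrite addrC -scaleN1r ucl_linear scaleN1r addrC. Qed.

Lemma ucl_surj (f : up) : exists x, ucl x = f.
Proof. exact: squo_repr_exists. Qed.

Lemma ucl_dot x y : hdot up (ucl x) (ucl y) = ulim (fibre_dot x y).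
Proof. exact: (squo_dotE (CompleteSemidot bfam_complete)). Qed.

Lemma ucl_rnorm x : rnorm (ucl x) = sdn bfam_semidot x.
Proof. exact: (squo_rnormE (CompleteSemidot bfam_complete)). Qed.

End Families.

Lemma map_sub (R : realType) (V W : lmodType R[i]) (f : V -> W) :
  linear f -> forall x y, f (x - y) = f x - f y.
Proof. by move=> flin x y; rewrite addrC -scaleN1r flin scaleN1r addrC. Qed.

Lemma map_0 (R : realType) (V W : lmodType R[i]) (f : V -> W) :
  linear f -> f 0 = 0.
Proof. by move=> flin; rewrite -[in LHS](subrr 0) (map_sub flin) subrr. Qed.

(** * Diagonal operators on ultraproducts *)

Section Operators.
Variables (R : realType) (U : ultraindex).
Implicit Types H K L : hilbert R.

Lemma bop_family_bound H K (T : bop H K) (x : U -> nat -> H) (i : U) :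
  fibre_norm (fun i r => T (x i r)) i <= opnorm T ^+ 2 * fibre_norm x i.
Proof.
rewrite /fibre_norm mulr_sumr ler_sum// => r _.
by rewrite -exprMn ler_sqr ?nnegrE ?rnorm_ge0 ?mulr_ge0 ?opnorm_ge0 ?rnorm_ge0// opnormP.
Qed.

Lemma bop_family_subproof H K (T : bop H K) (x : bfam U H) :
  (fun i r => T (x i r)) \in @is_bfam R U K.
Proof.
case: x => x xP; have /asboolP[B xB] := xP; apply/asboolP.
exists (opnorm T ^+ 2 * B) => i; apply: (le_trans (bop_family_bound _ _ _)).
by rewrite ler_wpM2l ?sqr_ge0.
Qed.

Definition bop_family H K (T : bop H K) (x : bfam U H) : bfam U K :=
  Bfam (bop_family_subproof T x).

Lemma bop_family_linear H K (T : bop H K) a x y :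
  bop_family T (a *: x + y) = a *: bop_family T x + bop_family T y.
Proof.
apply: bfam_ext => i r; rewrite bfam_linearE -[LHS]/(T (bfam_fun (a *: x + y) i r)).
by rewrite bfam_linearE bop_linear.
Qed.

(** This estimate makes the diagonal action well defined on classes and bounds its norm. *)
Lemma ucl_bop_family_le H K (T : bop H K) x :
  rnorm (ucl (bop_family T x)) <= opnorm T * rnorm (ucl x).
Proof.
rewrite !ucl_rnorm -ler_sqr ?nnegrE ?sdn_ge0 ?mulr_ge0 ?opnorm_ge0 ?sdn_ge0//.
apply/ler_addgt0Pr => e e0; rewrite exprMn !sdn_sqr.
have h : 0 < opnorm T ^+ 2 + 1 by rewrite ltr_wpDl ?sqr_ge0.
apply: bfam_sdsq_le.
have := @bfam_sdsq_lt _ _ _ x (sdsq (bfam_semidot U H) x + e / (opnorm T ^+ 2 + 1)).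
rewrite ltrDl divr_gt0// => /(_ isT); apply: filterS => i xi.
apply: (le_trans (bop_family_bound T x i)).
apply: (le_trans (ler_wpM2l (sqr_ge0 _) (ltW xi))).
rewrite mulrDr lerD2l mulrCA ger_pMr// ler_pdivrMr// mul1r lerDl//.
Qed.

Lemma uop_exists H K (T : bop H K) : exists T' : bop (up U H) (up U K),
  (forall x, T' (ucl x) = ucl (bop_family T x)) /\ opnorm T' <= opnorm T.
Proof.
have /choice[g gP] : forall f : up U H, exists x, ucl x = f by exact: ucl_surj.
have gE x : ucl (bop_family T (g (ucl x))) = ucl (bop_family T x).
  apply/eqP; rewrite -subr_eq0 -rnorm_eq0 eq_le rnorm_ge0 andbT.
  have -> : ucl (bop_family T (g (ucl x))) - ucl (bop_family T x) =
            ucl (bop_family T (g (ucl x) - x)).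
    rewrite -uclB; congr ucl; apply: bfam_ext => i r.
    by rewrite bfamBE -[RHS]/(T (bfam_fun (_ - _) i r)) bfamBE linearB.
  apply: (le_trans (ucl_bop_family_le _ _)).
  by rewrite uclB gP subrr rnorm0 mulr0.
have lin a x y : ucl (bop_family T (g (a *: x + y))) =
    a *: ucl (bop_family T (g x)) + ucl (bop_family T (g y)).
  have [x' <-] := ucl_surj x; have [y' <-] := ucl_surj y.
  by rewrite -ucl_linear !gE bop_family_linear ucl_linear.
have bnd x : rnorm (ucl (bop_family T (g x))) <= opnorm T * rnorm x.
  by rewrite (le_trans (ucl_bop_family_le _ _))// gP.
have [T' T'E] := bop_of_bound lin bnd.
exists T'; split=> [x|]; first by rewrite -T'E gE.
by apply: opnorm_le_bound => [|x]; [exact: opnorm_ge0|rewrite -T'E].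
Qed.

Definition uop H K (T : bop H K) : bop (up U H) (up U K) :=
  sval (cid (uop_exists T)).
Arguments uop {H K} T.

Lemma uopE H K (T : bop H K) x : uop T (ucl x) = ucl (bop_family T x).
Proof. by rewrite /uop; case: cid => S [/= ->]. Qed.

Lemma uop_opnorm_le H K (T : bop H K) : opnorm (uop T) <= opnorm T.
Proof. by rewrite /uop; case: cid => S []. Qed.

Lemma uop_linear H K : linear (@uop H K).
Proof.
move=> a S T; apply: bop_ext => f; have [x <-] := ucl_surj f.
rewrite bop_linearE !uopE -ucl_linear.
by congr ucl; apply: bfam_ext.
Qed.

Lemma uop_comp H K L (S : bop K L) (T : bop H K) :
  uop (bop_comp S T) = bop_comp (uop S) (uop T).
Proof.
apply: bop_ext => f; have [x <-] := ucl_surj f.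
by rewrite /= !uopE; congr ucl; apply: bfam_ext.
Qed.

Lemma uop_dotE H K (T : bop H K) x y :
  hdot (up U K) (uop T (ucl x)) (ucl y) =
  ulim (fun i => \sum_(r < (ui_rank i).+1) hdot K (T (x i r)) (y i r)).
Proof. by rewrite uopE ucl_dot. Qed.

Lemma uop_adjoint H K (T : bop H K) (S : bop K H) :
  is_adjoint T S -> is_adjoint (uop T) (uop S).
Proof.
move=> TS f g; have [x <-] := ucl_surj f; have [y <-] := ucl_surj g.
rewrite !uopE !ucl_dot; congr ulim; apply/funext => i.
by apply: eq_bigr => r _; exact: TS.
Qed.

Lemma uop_adjoints H K (M : set (bop H K)) :
  adjoints (uop @` M) = uop @` adjoints M.
Proof.
apply/seteqP; split=> [S [_ [T MT <-] TS]|_ [S [T MT TS] <-]].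
  have [T' TT'] := adjoint_exists T.
  exists T'; first by exists T.
  exact: adjoint_uniq (uop_adjoint TT') TS.
by exists (uop T); [exists T|exact: uop_adjoint].
Qed.

Lemma const_family_subproof H (v : H) :
  (fun (i : U) r => if r == 0%N then v else 0) \in @is_bfam R U H.
Proof.
apply/asboolP; exists (rnorm v ^+ 2) => i.
by rewrite /fibre_norm big_ord_recl/= big1 ?addr0// => r _; rewrite rnorm0 expr0n.
Qed.

(** Only coordinate 0 is filled, so inner products are preserved whatever the rank. *)
Definition const_family H (v : H) : bfam U H := Bfam (const_family_subproof v).

Definition uconst H (v : H) : up U H := ucl (const_family v).

Lemma uconst_linear H a (v w : H) :
  uconst (a *: v + w) = a *: uconst v + uconst w.
Proof.
rewrite /uconst -ucl_linear; congr ucl; apply: bfam_ext => i r.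
by rewrite bfam_linearE /=; case: ifP => // _; rewrite scaler0 addr0.
Qed.

Lemma uconst_dot H K (T : bop H K) v w :
  hdot (up U K) (uop T (uconst v)) (uconst w) = hdot K (T v) w.
Proof.
rewrite uop_dotE; apply: ulim_eq; apply: (ucvg_near _ (ucvg_cst _ _)).
by apply: nearW => i; rewrite big_ord_recl /= big1 ?addr0// => r _; rewrite hdot0r.
Qed.

Lemma uconst_rnorm H (v : H) : rnorm (uconst v) <= rnorm v.
Proof.
rewrite ucl_rnorm -ler_sqr ?nnegrE ?sdn_ge0 ?rnorm_ge0// sdn_sqr.
apply: bfam_sdsq_le; apply: nearW => i.
by rewrite /fibre_norm big_ord_recl/= big1 ?addr0// => r _; rewrite rnorm0 expr0n.
Qed.

(** Compression to the embedded copies of [H] and [K]; by [uconst_dot] it is a contractive left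
    inverse of [uop]. *)
Lemma compression_exists H K (T : bop (up U H) (up U K)) : exists2 S : bop H K,
  (forall v w, hdot K (S v) w = hdot _ (T (uconst v)) (uconst w)) &
  opnorm S <= opnorm T.
Proof.
apply: bop_of_form; first exact: opnorm_ge0.
- by move=> a v w z; rewrite uconst_linear linearP hdot_linear.
- by move=> a v w z; rewrite uconst_linear hdotDr hdotZr.
- move=> v w; rewrite (le_trans (hdot_CauchySchwarz _ _))// ler_pM ?rnorm_ge0//.
    by rewrite (le_trans (opnormP _ _))// ler_wpM2l ?opnorm_ge0// uconst_rnorm.
  exact: uconst_rnorm.
Qed.

(** A limit [T] of operators [uop m] is [uop] of its own compression, because compressing does not
    increase the distance to [m]. *)
Lemma uop_closed H K (M : set (bop H K)) : closed M -> closed (uop @` M).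
Proof.
move=> Mcl T /closure_rnormP TM.
have [S ST _] := compression_exists T.
have close m : opnorm (S - m) <= opnorm (T - uop m).
  have [S' S'T S'le] := compression_exists (T - uop m).
  suff -> : S - m = S' by [].
  apply: bop_ext => v; apply: hdot_inj => w.
  by rewrite S'T !bopBE !hdotBl ST uconst_dot.
have MS : M S.
  apply: Mcl; apply/closure_rnormP => e e0; have [_ [m Mm <-] Tm] := TM _ e0.
  by exists m => //; apply: le_lt_trans Tm; exact: close.
exists S => //; apply/eqP; rewrite -subr_eq0 -rnorm_eq0 eq_le rnorm_ge0 andbT.
apply/ler_addgt0Pr => /= e e0; rewrite add0r.
have [_ [m Mm <-] Tm] := TM _ (divr_gt0 e0 (ltr0n _ 2)).
have -> : uop S - T = uop (S - m) - (T - uop m).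
  have -> : uop (S - m) = uop S - uop m.
    exact: map_sub (@uop_linear H K) _ _.
  by rewrite opprB addrA subrK.
apply: (le_trans (rnormD _ _)); rewrite rnormN.
have := le_trans (uop_opnorm_le (S - m)) (close m).
rewrite -!rnorm_bop; move: Tm.
by move: (rnorm _) (rnorm _) => *; lra.
Qed.

Lemma linear_image_subspace (V W : lmodType R[i]) (f : V -> W) (A : set V) :
  linear f -> linear_subspace A -> linear_subspace (f @` A).
Proof.
move=> flin [A0 Alin]; split.
  by rewrite inE; exists 0; [rewrite inE in A0|exact: map_0].
move=> a x y; rewrite !inE => -[v Av <-] [w Aw <-]; exists (a *: v + w); last exact: flin.
by have := Alin a v w; rewrite !inE; exact.
Qed.

Lemma uop_tro H K (M : set (bop H K)) : tro M -> tro (uop @` M).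
Proof.
move=> [[Mlin Mcl] Mtro]; split; first split.
- exact: linear_image_subspace (@uop_linear H K) Mlin.
- exact: uop_closed.
rewrite uop_adjoints => _ [_ [_ [T MT <-] [_ [S MS <-] <-]] [_ [V MV <-] <-]].
rewrite -!uop_comp; exists (bop_comp (bop_comp T S) V) => //.
by apply: Mtro; exists (bop_comp T S); [exists T => //; exists S|exists V].
Qed.

End Operators.

(** * Functionals on matrices as vector functionals *)

(* The rank has to dominate arbitrary functions of S i and of the depth        *)
(* because the number of vectors needed to approximate a functional on S i to  *)
(* a given precision depends on the functional.                                *)
Definition adapted (U : ultraindex) (V : eqType) (S : U -> seq V) : Prop :=
  (forall z, ui_filter [set i | z \in S i]) /\
  (forall rho : seq V -> nat -> nat,
     ui_filter [set i | (rho (S i) (ui_depth i) <= ui_rank i)%N]).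

(** An index consists of two finite lists, a depth and a rank. The rank is chosen last and can
    exceed any prescribed function of the rest, so the sets [base] generate a proper filter. One
    ultrafilter serves both spaces, since the TRO's act between their ultraproducts. *)
Lemma adapted_exists (V W : choiceType) : exists (U : ultraindex)
  (S : U -> seq V) (T : U -> seq W), adapted S /\ adapted T.
Proof.
pose I : Type := (seq V * seq W * nat * nat)%type.
pose base (p : seq V * seq W * nat * (seq V -> seq W -> nat -> nat)) : set I :=
  [set i : I | [/\ {subset p.1.1.1 <= i.1.1.1}, {subset p.1.1.2 <= i.1.1.2},
     (p.1.2 <= i.1.2)%N & (p.2 i.1.1.1 i.1.1.2 i.1.2 <= i.2)%N]].
pose F := filter_from setT base.
have FF : ProperFilter F.
  apply: filter_from_proper; last first.
    move=> [[[S T] N] rho] _; exists (S, T, N, rho S T N); split => //=.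
  apply: filter_fromT_filter; first by exists ([::], [::], 0%N, fun _ _ _ => 0%N).
  move=> [[[S T] N] rho] [[[S' T'] N'] rho'].
  exists (S ++ S', T ++ T', maxn N N', fun s t n => maxn (rho s t n) (rho' s t n)).
  move=> [[[s t] n] r] [/= hS hT]; rewrite !geq_max => /andP[? ?] /andP[? ?].
  by split; split => //= z zs; (apply: hS || apply: hT); rewrite mem_cat zs ?orbT.
have [G [GU FG]] := ultraFilterLemma FF.
have Fin p (A : set I) : base p `<=` A -> G A.
  by move=> pA; apply: FG; exists p.
have Gdepth m : G [set i : I | (m <= i.1.2)%N].
  by apply: (Fin ([::], [::], m, fun _ _ _ => 0%N)) => i [].
exists (@UltraIndex I G GU (fun i => i.2) (fun i => i.1.2) Gdepth).
exists (fun i => i.1.1.1), (fun i => i.1.1.2); split; split=> [z|rho].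
- apply: (Fin ([:: z], [::], 0%N, fun _ _ _ => 0%N)) => i [/= h _ _ _].
  by apply: h; rewrite mem_head.
- by apply: (Fin ([::], [::], 0%N, fun s _ n => rho s n)) => i [].
- apply: (Fin ([::], [:: z], 0%N, fun _ _ _ => 0%N)) => i [/= _ h _ _].
  by apply: h; rewrite mem_head.
- by apply: (Fin ([::], [::], 0%N, fun _ t n => rho t n)) => i [].
Qed.

Lemma linear_functional_sum (R : realType) (V : lmodType R[i]) (f : V -> R[i])
    I (r : seq I) (P : pred I) (a : I -> R[i]) (F : I -> V) :
  (forall a x y, f (a *: x + y) = a * f x + f y) ->
  f (\sum_(i <- r | P i) a i *: F i) = \sum_(i <- r | P i) a i * f (F i).
Proof.
move=> flin; elim/big_rec2: _ => [|i y x _ <-]; last by rewrite flin.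
by have := flin (-1) 0 0; rewrite scaler0 addr0 mulN1r addNr.
Qed.

(** A list laid out over [m] coordinates is either truncated or padded with the default entry, which
    contributes nothing. *)
Lemma sum_nth_take (W : nmodType) (T : Type) (x0 : T) (s : seq T) (G : T -> W) m :
  G x0 = 0 -> \sum_(r < m) G (nth x0 s r) = \sum_(p <- take m s) G p.
Proof.
move=> G0; elim: s m => [|p s IH] [|m]; rewrite ?big_ord0 ?big_nil//.
  by rewrite big1// => r _; rewrite nth_nil.
by rewrite big_ord_recl big_cons IH.
Qed.

Section MatrixFunctionals.
Variables (R : realType) (V : mxnormed R) (K1 K2 : hilbert R).
Variables (phi : {linear V -> bop K1 K2}) (n : nat).
Hypothesis phi_ci : complete_isometry phi.
Variables (g : 'I_n -> 'I_n -> V -> R[i]) (c : R).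
Hypothesis g_linear : forall k l a x y, g k l (a *: x + y) = a * g k l x + g k l y.
Hypothesis c_gt0 : 0 < c.
Hypothesis g_bound : forall (z : 'M[V]_n) (s : R), 0 < s ->
  (mxnorm z <= s%:E)%E -> cabs (\sum_k \sum_l g k l (z k l)) <= c * s.

(** A list of pairs of tuples encodes a matrix functional, a finite sum of vector functionals with
    entries [value]; [small] normalises the two tuples so that [c] bounds its norm. *)
Let pairs := seq (('I_n -> K1) * ('I_n -> K2)).

Let small (hs : pairs) :=
  \sum_(p <- hs) \sum_j rnorm (p.1 j) ^+ 2 <= 1 /\
  \sum_(p <- hs) \sum_j rnorm (p.2 j) ^+ 2 <= 1.

Let value (hs : pairs) (z : V) k l : R[i] :=
  c%:C * \sum_(p <- hs) hdot K2 (phi z (p.1 l)) (p.2 k).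

(** Concatenating lists scaled for [t] and for [1 - t] is how [functional_approx] forms convex
    combinations of values. *)
Lemma small_scale (t : R) (hs : pairs) : 0 <= t ->
  let hs' := [seq ((fun j => (Num.sqrt t)%:C *: p.1 j),
                   (fun j => (Num.sqrt t)%:C *: p.2 j)) | p <- hs] in
  [/\ \sum_(p <- hs') \sum_j rnorm (p.1 j) ^+ 2 =
        t * \sum_(p <- hs) \sum_j rnorm (p.1 j) ^+ 2,
      \sum_(p <- hs') \sum_j rnorm (p.2 j) ^+ 2 =
        t * \sum_(p <- hs) \sum_j rnorm (p.2 j) ^+ 2 &
      forall z k l, value hs' z k l = t%:C * value hs z k l].
Proof.
move=> t0 hs'; have nZ (H : hilbert R) (v : H) :
    rnorm ((Num.sqrt t)%:C *: v) ^+ 2 = t * rnorm v ^+ 2.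
  by rewrite rnormZ exprMn -/(cabs _) cabs_real ger0_norm ?sqrtr_ge0// sqr_sqrtr.
split.
- rewrite big_map mulr_sumr; apply: eq_bigr => p _; rewrite mulr_sumr.
  by apply: eq_bigr => j _; rewrite nZ.
- rewrite big_map mulr_sumr; apply: eq_bigr => p _; rewrite mulr_sumr.
  by apply: eq_bigr => j _; rewrite nZ.
move=> z k l; rewrite /value big_map mulrCA; congr (_ * _).
rewrite mulr_sumr; apply: eq_bigr => p _ /=.
by rewrite bopZ hdotZl hdotZr conj_real mulrA -rmorphM/= -expr2 sqr_sqrtr.
Qed.

Lemma term_bound (H : hilbert R) (hs : seq ('I_n -> H)) j :
  \sum_(p <- hs) rnorm (p j) ^+ 2 <= \sum_(p <- hs) \sum_j rnorm (p j) ^+ 2.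
Proof.
apply: ler_sum => p _; rewrite (bigD1 j)//= lerDl sumr_ge0// => i _.
by rewrite sqr_ge0.
Qed.

Lemma value_bound hs z k l : small hs -> cabs (value hs z k l) <= c * opnorm (phi z).
Proof.
move=> [h1 h2]; rewrite cabsM cabs_real gtr0_norm// ler_pM2l//.
apply: (le_trans (cabs_sum _ _ _)).
apply: (@le_trans _ _ (\sum_(p <- hs) opnorm (phi z) *
    ((rnorm (p.1 l) ^+ 2 + rnorm (p.2 k) ^+ 2) / 2))).
  apply: ler_sum => p _; apply: (le_trans (hdot_CauchySchwarz _ _)).
  apply: (le_trans (ler_wpM2r (rnorm_ge0 _) (opnormP _ _))).
  rewrite -mulrA ler_wpM2l ?opnorm_ge0//.
  by have := sqr_ge0 (rnorm (p.1 l) - rnorm (p.2 k)); rewrite sqrrB; lra.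
rewrite -mulr_sumr -[leRHS]mulr1 ler_wpM2l ?opnorm_ge0// -mulr_suml big_split/=.
have := term_bound [seq p.1 | p <- hs] l; have := term_bound [seq p.2 | p <- hs] k.
by rewrite !big_map; lra.
Qed.

(** Weights [lam] bounded by [M] on all values combine the elements of [S] into a matrix [z] with
    [|z| <= M / c], as lists with a single pair [(h, k)] already test the norm of [phi z]. Then
    [g_bound] bounds the same combination of the entries of [g] by [M], and [balanced_convex_approx]
    applies. *)
Lemma functional_approx (S : seq V) (e : R) : 0 < e -> exists2 hs, small hs &
  forall z, z \in S -> forall k l, cabs (g k l z - value hs z k l) < e.
Proof.
move=> e0; pose A := ('I_n * 'I_n * 'I_(size S))%type.
pose s (i : 'I_(size S)) := nth 0 S i.
pose C : set (A -> R[i]^o) :=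
  [set (fun a => value hs (s a.2) a.1.1 a.1.2) | hs in small].
have [|||||_ [hs hsmall <-] hsP] := @balanced_convex_approx R A C
  (fun a => g a.1.1 a.1.2 (s a.2)) (c * \sum_(i < size S) opnorm (phi (s i)))
  _ _ _ _ _ e e0.
- by exists (fun a => value [::] (s a.2) a.1.1 a.1.2), [::] => //;
    rewrite /small !big_nil ler01.
- move=> t _ _ /andP[t0 t1] [hs [h1 h2] <-] [hs' [h1' h2'] <-].
  have [e1 e2 e3] := small_scale hs t0.
  have t1' : 0 <= 1 - t by rewrite subr_ge0.
  have [e1' e2' e3'] := small_scale hs' t1'.
  eexists; last first.
    apply/funext => a; rewrite [RHS](_ : _ = t%:C * value hs (s a.2) a.1.1 a.1.2 +
       (1 - t)%:C * value hs' (s a.2) a.1.1 a.1.2)//.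
    by rewrite -e3 -e3' /value -mulrDr -big_cat.
  rewrite /small !big_cat/= e1 e2 e1' e2'; split; nra.
- move=> u _ u1 [hs [h1 h2] <-].
  exists [seq ((fun j => u *: p.1 j), p.2) | p <- hs].
    rewrite /small !big_map; split=> //; apply: le_trans h1; apply: ler_sum => p _.
    by apply: ler_sum => j _; rewrite rnormZ -/(cabs _) u1 mul1r.
  apply/funext => a; rewrite [RHS](_ : _ = u * value hs (s a.2) a.1.1 a.1.2)//.
  rewrite /value big_map mulrCA; congr (_ * _); rewrite mulr_sumr.
  by apply: eq_bigr => p _; rewrite /= bopZ hdotZl.
- move=> _ [hs hsmall <-] a; apply: (le_trans (value_bound _ _ _ hsmall)).
  rewrite ler_pM2l// (bigD1 a.2)//= lerDl sumr_ge0// => i _; exact: opnorm_ge0.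
- move=> lam M M0 CM.
  pose z : 'M[V]_n := \matrix_(k, l) \sum_i lam (k, l, i) *: s i.
  have sumA (F : 'I_n -> 'I_n -> 'I_(size S) -> R[i]) :
      \sum_(a : A) F a.1.1 a.1.2 a.2 = \sum_k \sum_l \sum_i F k l i.
    by rewrite pair_bigA/= pair_bigA.
  have lamE (a : A) : lam a = lam (a.1.1, a.1.2, a.2) by case: a => [[]].
  have zM : (mxnorm z <= (M / c)%:E)%E.
    rewrite -phi_ci; apply/bop_mxnorm_le; first by rewrite divr_ge0 ?ltW.
    move=> h k h1 k1; rewrite ler_pdivlMr// mulrC.
    have := CM (fun a => value [:: (h, k)] (s a.2) a.1.1 a.1.2).
    rewrite (eq_bigr (fun a : A => lam (a.1.1, a.1.2, a.2) *
      value [:: (h, k)] (s a.2) a.1.1 a.1.2)) => [|a _]; last by rewrite -lamE.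
    rewrite (sumA (fun k' l i => lam (k', l, i) * value [:: (h, k)] (s i) k' l)).
    move=> hM; rewrite -[c in c * _]gtr0_norm// -cabs_real -cabsM.
    apply: le_trans (hM _); last by exists [:: (h, k)]; rewrite /small ?big_seq1.
    rewrite mulr_sumr le_eqVlt; apply/orP; left; apply/eqP; congr cabs.
    apply: eq_bigr => k' _; rewrite mulr_sumr; apply: eq_bigr => l _.
    rewrite !mxE (@linear_functional_sum _ _
      (fun z => c%:C * hdot K2 (phi z (h l)) (k k'))) => [|a x y].
      by apply: eq_bigr => i _; rewrite /value big_seq1.
    by rewrite linearP hdot_linear mulrDr mulrCA.
  have := g_bound (divr_gt0 M0 c_gt0) zM; rewrite mulrCA divff ?gt_eqF// mulr1.
  apply: le_trans; rewrite le_eqVlt; apply/orP; left; apply/eqP; congr cabs.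
  rewrite (eq_bigr (fun a : A => lam (a.1.1, a.1.2, a.2) *
      g a.1.1 a.1.2 (s a.2))) => [|a _]; last by rewrite -lamE.
  rewrite (sumA (fun k l i => lam (k, l, i) * g k l (s i))).
  by apply: eq_bigr => k _; apply: eq_bigr => l _; rewrite mxE linear_functional_sum.
exists hs => // z zS k l.
have zi : (index z S < size S)%N by rewrite index_mem.
by have := hsP (k, l, Ordinal zi); rewrite /s /= nth_index.
Qed.

Variables (U : ultraindex) (S : U -> seq V).
Hypothesis S_adapted : adapted S.

(** The fibre over [i] holds a list approximating [g] on [S i] within [2^-1 ^+ ui_depth i], spread
    over the coordinates. For almost every [i] the given [z] is in [S i] and the rank is at least
    the length of the list, so the ultralimit is exact. *)
Lemma matrix_functional_repr :
  exists (h : 'I_n -> up U K1) (k : 'I_n -> up U K2),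
  [/\ \sum_j rnorm (h j) ^+ 2 <= 1, \sum_i rnorm (k i) ^+ 2 <= 1 &
     forall i j z, g i j z = c%:C * hdot _ (uop U (phi z) (h j)) (k i)].
Proof.
have [Smem Srank] := S_adapted.
have /choice[hs hsP] : forall p : seq V * nat, exists hs, small hs /\
    forall z, z \in p.1 -> forall k l, cabs (g k l z - value hs z k l) < 2^-1 ^+ p.2.
  move=> p; have e0 : (0 : R) < 2^-1 ^+ p.2 by rewrite exprn_gt0.
  by have [hs h1 h2] := functional_approx p.1 e0; exists hs.
pose d0 : ('I_n -> K1) * ('I_n -> K2) := (fun=> 0, fun=> 0).
pose hsi i := hs (S i, ui_depth i).
(* The projection [q] selects either component of the pairs; cutting a list off at the rank only
   lowers its sum of squares. *)
have fam_le (H : hilbert R) (q : ('I_n -> K1) * ('I_n -> K2) -> 'I_n -> H) :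
    (forall j, q d0 j = 0) ->
    (forall p, \sum_(x <- hs p) \sum_j rnorm (q x j) ^+ 2 <= 1) ->
    exists x : 'I_n -> bfam U H, (forall j i r, x j i r = q (nth d0 (hsi i) r) j) /\
      \sum_j rnorm (ucl (x j)) ^+ 2 <= 1.
  move=> q0 q1.
  pose G x := \sum_j rnorm (q x j) ^+ 2.
  have G0 : G d0 = 0 by rewrite /G big1// => j _; rewrite q0 rnorm0 expr0n.
  have Gge0 x : 0 <= G x by rewrite sumr_ge0// => j _; rewrite sqr_ge0.
  have Gsum i : \sum_(r < (ui_rank i).+1) G (nth d0 (hsi i) r) <= 1.
    rewrite sum_nth_take//; apply: le_trans (q1 (S i, ui_depth i)).
    rewrite -/(hsi i) -[in leRHS](cat_take_drop (ui_rank i).+1 (hsi i)) big_cat/=.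
    by rewrite lerDl sumr_ge0// => p _; exact: Gge0.
  have xP j : (fun i r => q (nth d0 (hsi i) r) j) \in @is_bfam R U H.
    apply/asboolP; exists 1 => i; apply: le_trans (Gsum i).
    apply: ler_sum => r _; rewrite /G (bigD1 j)//= lerDl sumr_ge0// => l _.
    by rewrite sqr_ge0.
  exists (fun j => Bfam (xP j)); split=> //.
  apply: ler_eps => e e0.
  (* The tolerance is shared by the [n] entries; the added 1 covers [n = 0]. *)
  have en : 0 < e / (n%:R + 1) by rewrite divr_gt0// ltr_wpDl.
  have near_le : \forall i \near ui_filter (u:=U), forall j : 'I_n,
      rnorm (ucl (Bfam (xP j))) ^+ 2 <= fibre_norm (Bfam (xP j)) i + e / (n%:R + 1).
    apply: filter_forall => j.
    apply: filterS (bfam_sdsq_near (Bfam (xP j)) en) => i.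
    by rewrite ucl_rnorm sdn_sqr.
  have [i iP] := filter_ex near_le.
  apply: (@le_trans _ _ (\sum_j (fibre_norm (Bfam (xP j)) i + e / (n%:R + 1)))).
    by apply: ler_sum => j _.
  rewrite big_split/= sumr_const card_ord; apply: lerD.
    by rewrite /fibre_norm exchange_big/=; exact: Gsum.
  by rewrite -[leLHS]mulr_natr mulrAC ler_pdivrMr ?ltr_wpDl// ler_pM2l// lerDl.
have [|p|x [xE x1]] := fam_le K1 (fun p => p.1) => //; first by case: (hsP p) => [[]].
have [|p|y [yE y1]] := fam_le K2 (fun p => p.2) => //; first by case: (hsP p) => [[]].
exists (fun j => ucl (x j)), (fun i => ucl (y i)); split=> // i j z.
rewrite uopE ucl_dot.
have dc := ucvgZ c%:C (fibre_dot_cvg (bop_family (phi z) (x j)) (y i)).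
apply: ucvg_uniq dc => e e0; have [N Ne] := half_expr_small e0.
near=> t.
have tS : z \in S t by near: t; exact: Smem.
have tN : (N <= ui_depth t)%N by near: t; exact: ui_depth_infty.
have tr : (size (hsi t) <= ui_rank t)%N.
  by near: t; exact: (Srank (fun s m => size (hs (s, m)))).
have -> : c%:C * fibre_dot (bop_family (phi z) (x j)) (y i) t = value (hsi t) z i j.
  congr (_ * _).
  have := @sum_nth_take _ _ d0 (hsi t)
    (fun p => hdot K2 (phi z (p.1 j)) (p.2 i)) (ui_rank t).+1.
  rewrite take_oversize ?(leqW tr)//= hdot0r => <- //.
  by apply: eq_bigr => r _; rewrite /fibre /= xE yE.
apply: lt_le_trans ((hsP (S t, ui_depth t)).2 z tS i j) _.
rewrite (le_trans _ (ltW Ne))// ler_wiXn2l// ?invr_ge0// invf_le1// ler1n//.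
Unshelve. all: by end_near. Qed.

End MatrixFunctionals.

(** * Matrix norms and coordinates *)

Section MatrixNormForms.
Variables (R : realType) (H K : hilbert R) (n : nat).
Implicit Types (T : 'M[bop H K]_n) (s : R).

Lemma sum_rnorm_eq0 (L : hilbert R) (h : 'I_n -> L) :
  \sum_j rnorm (h j) ^+ 2 = 0 -> forall j, h j = 0.
Proof.
move=> /eqP; rewrite psumr_eq0 => [/allP h0 j|j _]; last exact: sqr_ge0.
by have := h0 j; rewrite mem_index_enum sqrf_eq0 rnorm_eq0 => /(_ isT) /eqP.
Qed.

Lemma sum_rnormZ (L : hilbert R) (h : 'I_n -> L) (t : R) :
  \sum_j rnorm (t%:C *: h j) ^+ 2 = t ^+ 2 * \sum_j rnorm (h j) ^+ 2.
Proof.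
rewrite mulr_sumr; apply: eq_bigr => j _.
by rewrite rnormZ exprMn -/(cabs _) cabs_real real_normK ?num_real.
Qed.

(** The product of the two norms is relaxed to the mean of their squares, which is additive and can
    be summed over the coordinates of a fibre. *)
Lemma bop_mxnorm_form T s : 0 <= s -> (bop_mxnorm T <= s%:E)%E ->
  forall (h : 'I_n -> H) (k : 'I_n -> K),
  cabs (\sum_i \sum_j hdot K (T i j (h j)) (k i)) <=
  s * ((\sum_j rnorm (h j) ^+ 2 + \sum_i rnorm (k i) ^+ 2) / 2).
Proof.
move=> s0 /(bop_mxnorm_le _ s0) Ts h k.
set A := \sum_j rnorm (h j) ^+ 2; set B := \sum_i rnorm (k i) ^+ 2.
have A0 : 0 <= A by rewrite sumr_ge0// => j _; rewrite sqr_ge0.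
have B0 : 0 <= B by rewrite sumr_ge0// => j _; rewrite sqr_ge0.
have rhs0 : 0 <= s * ((A + B) / 2) by rewrite mulr_ge0// divr_ge0// addr_ge0.
have [A00|An0] := eqVneq A 0.
  rewrite big1 ?cabs0// => i _; rewrite big1// => j _.
  by rewrite (sum_rnorm_eq0 A00) linear0 hdot0l.
have [B00|Bn0] := eqVneq B 0.
  rewrite big1 ?cabs0// => i _; rewrite big1// => j _.
  by rewrite (sum_rnorm_eq0 B00) hdot0r.
have rA : 0 < Num.sqrt A by rewrite sqrtr_gt0 lt_neqAle eq_sym An0.
have rB : 0 < Num.sqrt B by rewrite sqrtr_gt0 lt_neqAle eq_sym Bn0.
have := Ts (fun j => (Num.sqrt A)^-1%:C *: h j) (fun i => (Num.sqrt B)^-1%:C *: k i).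
rewrite !sum_rnormZ -/A -/B !exprVn !sqr_sqrtr// !mulVf// => /(_ (lexx _) (lexx _)).
rewrite (eq_bigr (fun i => ((Num.sqrt A)^-1 * (Num.sqrt B)^-1)%:C *
    \sum_j hdot K (T i j (h j)) (k i))) => [|i _]; last first.
  rewrite mulr_sumr; apply: eq_bigr => j _.
  by rewrite bopZ hdotZl hdotZr conj_real rmorphM mulrA.
rewrite -mulr_sumr cabsM cabs_real ger0_norm ?mulr_ge0 ?invr_ge0 ?sqrtr_ge0//.
rewrite -invfM mulrC ler_pdivrMr ?mulr_gt0// => /le_trans; apply.
rewrite ler_wpM2l//; have := sqr_ge0 (Num.sqrt A - Num.sqrt B).
by rewrite sqrrB !sqr_sqrtr// -mulr_natr; lra.
Qed.

Lemma bop_mxnorm_entry T s i j : (bop_mxnorm T <= s%:E)%E -> opnorm (T i j) <= s.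
Proof.
move=> Ts; apply: opnorm_le => x x1.
pose h j' := if j' == j then x else 0.
have hs : ((Num.sqrt (\sum_i' rnorm (\sum_j' T i' j' (h j')) ^+ 2))%:E <= s%:E)%E.
  apply: le_trans Ts; apply: ereal_sup_ubound; exists h => //=.
  rewrite (bigD1 j)//= /h eqxx big1 ?addr0 ?expr_le1 ?rnorm_ge0// => j' /negPf ->.
  by rewrite rnorm0 expr0n.
rewrite lee_fin in hs; apply: le_trans hs.
rewrite -[leLHS]ger0_norm ?rnorm_ge0// -sqrtr_sqr ler_wsqrtr//.
rewrite (bigD1 i)//= (bigD1 j)//= /h eqxx big1 ?addr0; last first.
  by move=> j' /negPf ->; rewrite linear0.
by rewrite lerDl sumr_ge0// => i' _; rewrite sqr_ge0.
Qed.

(** The form of the image matrix is an ultralimit of sums over [r] of the form of [T], each bounded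
    by [bop_mxnorm_form]; all approximations are compared at one index [t]. *)
Lemma uop_bop_mxnorm (U : ultraindex) T s : 0 <= s -> (bop_mxnorm T <= s%:E)%E ->
  (bop_mxnorm (map_mx (@uop R U H K) T) <= s%:E)%E.
Proof.
move=> s0 Ts; apply/(bop_mxnorm_le _ s0) => h k h1 k1.
have /choice[x xh] : forall j, exists x, ucl x = h j by move=> j; exact: ucl_surj.
have /choice[y yk] : forall j, exists x, ucl x = k j by move=> j; exact: ucl_surj.
apply: ler_eps => e e0.
(* The [n * n] entry errors, and [s] times the excess [n * d] of the norms, add up to
   [d * (D - 1)]. *)
pose D := s * n%:R + n%:R * n%:R + 1.
have D0 : 0 < D by rewrite /D ltr_wpDl// addr_ge0// mulr_ge0.
pose d := e / D; have d0 : 0 < d by rewrite divr_gt0.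
near (ui_filter (u := U)) => t.
have hx : forall j, fibre_norm (x j) t <= rnorm (h j) ^+ 2 + d.
  near: t; apply: filter_forall => j;
  apply: filterS (@bfam_sdsq_lt _ _ _ (x j) (rnorm (h j) ^+ 2 + d) _) => [i /ltW//|].
  by rewrite -sdn_sqr -ucl_rnorm xh ltrDl.
have ky : forall j, fibre_norm (y j) t <= rnorm (k j) ^+ 2 + d.
  near: t; apply: filter_forall => j;
  apply: filterS (@bfam_sdsq_lt _ _ _ (y j) (rnorm (k j) ^+ 2 + d) _) => [i /ltW//|].
  by rewrite -sdn_sqr -ucl_rnorm yk ltrDl.
pose q i j t := \sum_(r < (ui_rank t).+1) hdot K (T i j (x j t r)) (y i t r).
have hq : forall i j, cabs (hdot _ (map_mx (@uop R U H K) T i j (h j)) (k i) - q i j t) <= d.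
  near: t; apply: filter_forall => i; apply: filter_forall => j.
  rewrite mxE -xh -yk uopE ucl_dot.
  by apply: filterS (fibre_dot_cvg (bop_family (T i j) (x j)) (y i) d0) => ? /ltW.
have sum_le (L : hilbert R) (z : 'I_n -> bfam U L) (v : 'I_n -> up U L) :
    (forall j, fibre_norm (z j) t <= rnorm (v j) ^+ 2 + d) ->
    \sum_j rnorm (v j) ^+ 2 <= 1 ->
    \sum_(r < (ui_rank t).+1) \sum_j rnorm (z j t r) ^+ 2 <= 1 + n%:R * d.
  move=> zv v1; rewrite exchange_big/=; apply: le_trans (ler_sum _ (fun j _ => zv j)) _.
  by rewrite big_split/= sumr_const card_ord mulr_natl lerD2r.
have qs : cabs (\sum_i \sum_j q i j t) <= s * (1 + n%:R * d).
  rewrite (eq_bigr (fun i => \sum_(r < (ui_rank t).+1)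
      \sum_j hdot K (T i j (x j t r)) (y i t r))) => [|i _]; last exact: exchange_big.
  rewrite exchange_big/=; apply: (le_trans (cabs_sum _ _ _)).
  apply: le_trans (ler_sum _ (fun r _ => bop_mxnorm_form s0 Ts _ _)) _.
  rewrite -mulr_sumr -mulr_suml big_split/= ler_wpM2l// ler_pdivrMr//.
  have := sum_le _ _ _ hx h1; have := sum_le _ _ _ ky k1.
  by move: (n%:R * d) => ?; lra.
have diff : cabs (\sum_i \sum_j hdot _ (map_mx (@uop R U H K) T i j (h j)) (k i) -
    \sum_i \sum_j q i j t) <= n%:R * (n%:R * d).
  rewrite -sumrB; apply: (le_trans (cabs_sum _ _ _)).
  rewrite [leRHS]mulr_natl -[X in _ *+ X]card_ord -sumr_const; apply: ler_sum => i _.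
  rewrite -sumrB; apply: (le_trans (cabs_sum _ _ _)).
  by rewrite [leRHS]mulr_natl -[X in _ *+ X]card_ord -sumr_const; apply: ler_sum.
rewrite -[X in cabs X](subrK (\sum_i \sum_j q i j t)) (le_trans (cabsD _ _))//.
apply: (le_trans (lerD diff qs)).
have dD : d * D = e by rewrite /d divfK// gt_eqF.
have -> : n%:R * (n%:R * d) + s * (1 + n%:R * d) = s + (d * D - d).
  by rewrite /D; ring.
by rewrite lerD2l dD gerBl ltW.
Unshelve. all: by end_near. Qed.

End MatrixNormForms.

(** A vector dependent on the others yields a zero [w t], which keeps the index type ['I_n]. *)
Lemma gram_schmidt (R : realType) (H : hilbert R) (n : nat) (h : 'I_n -> H) :
  exists w : 'I_n -> H,
  [/\ forall s t, s != t -> hdot H (w s) (w t) = 0,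
      forall t, w t = 0 \/ rnorm (w t) = 1 &
      forall l, h l = \sum_t hdot H (h l) (w t) *: w t].
Proof.
elim: n h => [|n IH] h.
  by exists (fun=> 0); split=> [|t|[]//]; [move=> []|left].
have [w [w_ort w_unit wh]] := IH (fun i => h (lift ord0 i)).
pose r := h ord0 - \sum_t hdot H (h ord0) (w t) *: w t.
have w_dot t : hdot H (w t) (w t) *: w t = w t.
  by case: (w_unit t) => [->|w1]; rewrite ?scaler0// hdotxx w1 expr1n scale1r.
have sum_dot (c : 'I_n -> R[i]) t :
    hdot H (\sum_s c s *: w s) (w t) = c t * hdot H (w t) (w t).
  rewrite hdot_suml (bigD1 t)//= hdotZl big1 ?addr0// => s st.
  by rewrite hdotZl w_ort// mulr0.
have r_ort t : hdot H r (w t) = 0.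
  rewrite hdotBl sum_dot; case: (w_unit t) => [->|w1]; first by rewrite !hdot0r mulr0 subrr.
  by rewrite hdotxx w1 expr1n mulr1 subrr.
have r_ort' t : hdot H (w t) r = 0 by rewrite hdot_herm r_ort conjC0.
pose w0 := (rnorm r)^-1%:C *: r.
pose v i := oapp w w0 (unlift ord0 i).
have v0 : v ord0 = w0 by rewrite /v unlift_none.
have vS i : v (lift ord0 i) = w i by rewrite /v liftK.
have w0_unit : w0 = 0 \/ rnorm w0 = 1.
  have [r0|r0] := eqVneq r 0; first by left; rewrite /w0 r0 scaler0.
  right; rewrite /w0 rnormZ -/(cabs _) cabs_real ger0_norm ?invr_ge0 ?rnorm_ge0//.
  by rewrite mulVf// rnorm_eq0.
exists v; split.
- move=> s t; case: (unliftP ord0 s) => [s' ->|->]; case: (unliftP ord0 t) => [t' ->|->];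
    rewrite ?v0 ?vS ?eqxx//.
  + by rewrite (inj_eq lift_inj); exact: w_ort.
  + by rewrite hdotZr r_ort' mulr0.
  + by rewrite hdotZl r_ort mulr0.
- by move=> t; case: (unliftP ord0 t) => [t' ->|->]; rewrite ?v0 ?vS.
move=> l; rewrite big_ord_recl v0.
rewrite (eq_bigr (fun t => hdot H (h l) (w t) *: w t)) => [|t _]; last by rewrite vS.
case: (unliftP ord0 l) => [l' ->|->].
  rewrite -wh [X in X *: _](_ : _ = 0) ?scale0r ?add0r//.
  rewrite hdotZr wh hdot_suml big1 ?mulr0// => t _.
  by rewrite hdotZl r_ort' mulr0.
rewrite -[LHS](subrK (\sum_t hdot H (h ord0) (w t) *: w t)) -/r; congr (_ + _).
have [r0|r0] := eqVneq r 0; first by rewrite /w0 r0 !scaler0.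
have rr : hdot H (h ord0) r = (rnorm r ^+ 2)%:C.
  rewrite -hdotxx {2}/r hdotBl hdot_suml big1 ?subr0// => t _.
  by rewrite hdotZl r_ort' mulr0.
rewrite /w0 hdotZr conj_real rr scalerA -!rmorphM/=.
rewrite (_ : _ * _ * _ = 1) ?scale1r//; field.
by rewrite rnorm_eq0.
Qed.

(** The form in which matrix norms use Gram-Schmidt. Synthesis from coordinates is only contractive,
    because some [w t] may be zero. *)
Lemma orthonormal_coordinates (R : realType) (H : hilbert R) (n : nat) (h : 'I_n -> H) :
  exists (w : 'I_n -> H) (a : 'I_n -> 'I_n -> R[i]),
  [/\ forall l, h l = \sum_t a l t *: w t,
      forall l, \sum_t cabs (a l t) ^+ 2 = rnorm (h l) ^+ 2 &
      forall c : 'I_n -> R[i], rnorm (\sum_t c t *: w t) ^+ 2 <= \sum_t cabs (c t) ^+ 2].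
Proof.
have [w [w_ort w_unit wh]] := gram_schmidt h.
have pyth (c : 'I_n -> R[i]) :
    rnorm (\sum_t c t *: w t) ^+ 2 = \sum_t cabs (c t) ^+ 2 * rnorm (w t) ^+ 2.
  apply: (@complexI R); rewrite -hdotxx hdot_suml rmorph_sum/=; apply: eq_bigr => s _.
  rewrite hdotZl hdot_sumr (bigD1 s)//= hdotZr big1 ?addr0 => [|t ts].
    by rewrite mulrA mul_conj hdotxx -rmorphM.
  by rewrite hdotZr w_ort ?mulr0// eq_sym.
exists w, (fun l t => hdot H (h l) (w t)); split=> // [l|c].
  rewrite [in RHS]wh pyth; apply: eq_bigr => t _.
  by case: (w_unit t) => [->|->]; rewrite ?expr1n ?mulr1// hdot0r cabs0 expr0n/= mul0r.
rewrite pyth; apply: ler_sum => t _; rewrite -[leRHS]mulr1 ler_wpM2l ?sqr_ge0//.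
by case: (w_unit t) => [->|->]; rewrite ?rnorm0 ?expr1n// expr0n ler01.
Qed.

(** * The w*-topologies *)

Lemma initial_cvgP (S : choiceType) (T : topologicalType) (g : S -> T)
    (F : set_system S) (s : S) :
  Filter F -> F --> (s : initial_topology g) <-> g @ F --> g s.
Proof.
move=> FF; split=> [Fs|Fs A [_ [[B oB <-] Bs] BA]].
  by apply: cvg_comp Fs _; exact: initial_continuous.
by apply: filterS BA _; apply: Fs; exact: open_nbhs_nbhs.
Qed.

(** Both w*-topologies are initial for a map into a pointwise topology, so w*-convergence is
    convergence of each evaluation. *)
Lemma initial_ptws_cvgP (S : choiceType) (I : Type) (Y : topologicalType)
    (f : S -> I -> Y) (F : set_system S) (s : S) : Filter F ->
  F --> (s : initial_topology (f : S -> {ptws I -> Y})) <->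
  forall i, (fun t => f t i) @ F --> f s i.
Proof.
move=> FF; split.
  move=> /initial_cvgP /cvg_sup h i.
  exact: (@initial_cvgP _ Y (fun q : I -> Y => q i) (f @ F) (f s) _).1 (h i).
move=> h; apply/initial_cvgP/cvg_sup => i.
exact: (@initial_cvgP _ Y (fun q : I -> Y => q i) (f @ F) (f s) _).2 (h i).
Qed.

Section WeakStar.
Variables (R : realType) (H K : hilbert R).
Implicit Types (w : bop H K -> R[i]^o) (T S : bop H K).

Lemma wstar_bop_cvgP (F : set_system (bop H K)) T : Filter F ->
  F --> (T : wstar_bop H K) <->
  forall w, sigma_weak w -> w @ F --> w T.
Proof.
move=> FF; split=> [FT w sw|h].
  exact: (initial_ptws_cvgP _ _ FF).1 FT (exist _ w sw).
by apply/initial_ptws_cvgP => -[w sw]; exact: h.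
Qed.

Lemma square_summable_tail (L : hilbert R) (xi : nat -> L) : square_summable xi ->
  forall e : R, 0 < e -> exists N, forall n m, (N <= n)%N ->
    \sum_(n <= k < m) rnorm (xi k) ^+ 2 <= e.
Proof.
move=> xs e e0.
have x0 (k : nat) : true -> (0 <= (rnorm (xi k) ^+ 2)%:E)%E by rewrite lee_fin sqr_ge0.
have := @nneseries_tail_cvg R (fun k => (rnorm (xi k) ^+ 2)%:E) xpredT xs x0.
have e0' : (0 < e%:E)%E by rewrite lte_fin.
move=> /(_ [set x | (x < e%:E)%E]) [|N _ hN]; first exact: lt_nbhsl.
exists N => n m Nn; rewrite -lee_fin -sumEFin.
apply: le_trans (ltW (hN n Nn)); apply: (nneseries_lim_ge m) => k _ _.
by rewrite lee_fin sqr_ge0.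
Qed.

(** Cauchy-Schwarz and the mean inequality bound the tail of the series by [e * opnorm T], uniformly
    in [T]. So finite sums of vector functionals approximate [w] in norm, from which its linearity,
    boundedness and compatibility with [Phi] follow. *)
Lemma sigma_weak_approx w : sigma_weak w -> exists (xi : nat -> H) (eta : nat -> K),
  forall e : R, 0 < e -> exists N, forall T,
    cabs (w T - \sum_(0 <= n < N) hdot K (T (xi n)) (eta n)) <= e * opnorm T.
Proof.
move=> [xi [eta [xs es wlim]]]; exists xi, eta => e e0.
have [N1 h1] := square_summable_tail xs e0; have [N2 h2] := square_summable_tail es e0.
pose N := maxn N1 N2; exists N => T; apply: ler_eps => d d0.
have /(cvg_rnormP _ _ _) /(_ d d0) [M _ hM] := wlim T.
have := hM (maxn M N) (leq_maxl _ _).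
rewrite /series /= (big_cat_nat (n := N))//= ?leq_maxr//.
set A := \sum_(0 <= n < N) _; set B := \sum_(N <= n < _) _ => /ltW wAB.
have BB : cabs B <= e * opnorm T.
  apply: (le_trans (cabs_sum _ _ _)).
  apply: (@le_trans _ _ (\sum_(N <= n < maxn M N) opnorm T *
      ((rnorm (xi n) ^+ 2 + rnorm (eta n) ^+ 2) / 2))).
    apply: ler_sum => n _; apply: (le_trans (hdot_CauchySchwarz _ _)).
    apply: (le_trans (ler_wpM2r (rnorm_ge0 _) (opnormP _ _))).
    rewrite -mulrA ler_wpM2l ?opnorm_ge0//.
    by have := sqr_ge0 (rnorm (xi n) - rnorm (eta n)); rewrite sqrrB; lra.
  rewrite -mulr_sumr mulrC ler_wpM2r ?opnorm_ge0// -mulr_suml big_split/=.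
  have := h1 N (maxn M N) (leq_maxl _ _); have := h2 N (maxn M N) (leq_maxr _ _).
  lra.
have -> : w T - A = (w T - (A + B)) + B by rewrite opprD addrA subrK.
by rewrite (le_trans (cabsD _ _))// addrC lerD.
Qed.

Lemma cabs_le_eps (z : R[i]) (C : R) : 0 <= C ->
  (forall e : R, 0 < e -> cabs z <= e * C) -> z = 0.
Proof.
move=> C0 h; apply/eqP; rewrite -cabs_eq0 eq_le cabs_ge0 andbT.
apply: ler_eps => e e0; rewrite add0r.
have C1 : 0 < C + 1 by rewrite ltr_wpDl.
apply: (le_trans (h _ (divr_gt0 e0 C1))).
by rewrite mulrAC ler_pdivrMr// ler_pM2l// lerDl.
Qed.

Lemma sigma_weak_linear w : sigma_weak w -> forall a S T,
  w (a *: S + T) = a * w S + w T.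
Proof.
move=> /sigma_weak_approx[xi [eta wN]] a S T; apply/eqP; rewrite -subr_eq0; apply/eqP.
apply: (@cabs_le_eps _ (opnorm (a *: S + T) + cabs a * opnorm S + opnorm T)).
  by rewrite !addr_ge0 ?mulr_ge0 ?opnorm_ge0 ?cabs_ge0.
move=> e e0; have [N hN] := wN e e0.
pose p Q := \sum_(0 <= n < N) hdot K (bop_fun Q (xi n)) (eta n).
have pl : p (a *: S + T) = a * p S + p T.
  rewrite /p mulr_sumr -big_split/=; apply: eq_bigr => n _.
  by rewrite -hdot_linear.
have -> : w (a *: S + T) - (a * w S + w T) = (w (a *: S + T) - p (a *: S + T)) +
    (- (a * (w S - p S)) - (w T - p T)) by rewrite pl; ring.
apply: (le_trans (cabsD _ _)).
rewrite [leRHS]mulrDr [X in _ <= X + _]mulrDr -[leRHS]addrA lerD//.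
apply: (le_trans (cabsD _ _)); rewrite !cabsN lerD//.
by rewrite cabsM mulrCA ler_wpM2l ?cabs_ge0//; exact: hN.
Qed.

Lemma sigma_weak_bound w : sigma_weak w -> exists2 C : R, 0 <= C &
  forall T, cabs (w T) <= C * opnorm T.
Proof.
move=> /sigma_weak_approx[xi [eta /(_ 1 ltr01)[N hN]]].
exists (1 + \sum_(0 <= n < N) rnorm (xi n) * rnorm (eta n)).
  by rewrite addr_ge0// sumr_ge0// => n _; rewrite mulr_ge0 ?rnorm_ge0.
move=> T; rewrite mulrDl.
rewrite -[X in cabs X](subrK (\sum_(0 <= n < N) hdot K (T (xi n)) (eta n))).
apply: (le_trans (cabsD _ _)); rewrite lerD//.
apply: (le_trans (cabs_sum _ _ _)); rewrite mulr_suml; apply: ler_sum => n _.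
apply: (le_trans (hdot_CauchySchwarz _ _)).
by rewrite mulrAC ler_wpM2r ?rnorm_ge0// mulrC opnormP.
Qed.

Lemma vector_functional_sigma_weak (xi : H) (eta : K) :
  sigma_weak (fun T : bop H K => hdot K (T xi) eta : R[i]^o).
Proof.
have summable (L : hilbert R) (v : L) :
    square_summable (fun n : nat => if n == 0%N then v else 0).
  rewrite /square_summable (nneseries_split _ 1) => [|k _]; last by rewrite lee_fin sqr_ge0.
  rewrite eseries0 ?adde0 ?big_nat1 ?ltry// => k k1 _.
  by case: k k1 => //= k _; rewrite rnorm0 expr0n.
exists (fun n => if n == 0%N then xi else 0), (fun n => if n == 0%N then eta else 0).
split=> // T; apply: (@cvg_near_cst).
near=> n.
have n0 : (0 < n)%N by near: n; exists 1%N.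
rewrite /series /= big_ltn// big1_seq ?addr0// => k /andP[_].
by rewrite mem_index_iota => /andP[k1 _]; rewrite gtn_eqF// hdot0r.
Unshelve. all: by end_near. Qed.

(** A finite sum of vector functionals is w*-continuous, so its zero set is w*-closed. The list of
    triples [(a, xi, eta)] encodes such a sum, here and below. *)
Lemma wstar_closure_vanish (A : set (bop H K)) T (l : seq (R[i] * H * K)) :
  @closure (wstar_bop H K) A T ->
  (forall S, A S -> \sum_(p <- l) p.1.1 * hdot K (S p.1.2) p.2 = 0) ->
  \sum_(p <- l) p.1.1 * hdot K (T p.1.2) p.2 = 0.
Proof.
rewrite closureEcvg => -[G GF [GT AG]] l0.
have GTv xi eta : (fun S : bop H K => hdot K (S xi) eta : R[i]^o) @ G
    --> (hdot K (T xi) eta : R[i]^o).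
  exact: (wstar_bop_cvgP _ _).1 GT _ (vector_functional_sigma_weak xi eta).
pose C := \sum_(p <- l) cabs p.1.1.
have C0 : 0 <= C by rewrite sumr_ge0// => p _; exact: cabs_ge0.
apply: (cabs_le_eps C0) => e e0.
have Gl : G [set S : bop H K | forall p, p \in l ->
    cabs (hdot K (T p.1.2) p.2 - hdot K (S p.1.2) p.2) < e].
  elim: (l) => [|p l' IH]; first by apply: nearW.
  have /(cvg_rnormP _ _ _) /(_ e e0) := GTv p.1.2 p.2.
  apply: filterS2 IH => S h1 h2 p'; rewrite inE => /orP[/eqP ->//|]; exact: h1.
have GA : G A by apply: AG.
have [S [/= AS Sl]] := filter_ex (filterI GA Gl).
have -> : \sum_(p <- l) p.1.1 * hdot K (T p.1.2) p.2 =
    \sum_(p <- l) p.1.1 * (hdot K (T p.1.2) p.2 - hdot K (S p.1.2) p.2).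
  rewrite -[LHS]subr0 -[X in _ - X = _](l0 S AS) -sumrB.
  by apply: eq_bigr => p _; rewrite mulrBr.
apply: (le_trans (cabs_sum _ _ _)); rewrite mulr_sumr big_seq [leRHS]big_seq.
apply: ler_sum => p pl; rewrite cabsM mulrC ler_wpM2r ?cabs_ge0// ltW//.
exact: Sl.
Qed.

End WeakStar.

(** * The representation of the bidual *)

Section BidualRepresentation.
Variables (R : realType) (U : ultraindex) (V : mxnormed R) (K1 K2 : hilbert R).
Variable phi : {linear V -> bop K1 K2}.
Hypothesis phi_ci : complete_isometry phi.
Hypothesis phi_iso : forall x : V, rnorm x = opnorm (phi x).
Variable S : U -> seq V.
Hypothesis S_adapted : adapted S.

Local Notation L1 := (up U K1).
Local Notation L2 := (up U K2).
Local Notation V1 := (bop V R[i]^o).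
Local Notation V2 := (bop V1 R[i]^o).

Lemma uphi_linear a x y xi :
  uop U (phi (a *: x + y)) xi = a *: uop U (phi x) xi + uop U (phi y) xi.
Proof. by rewrite linearP uop_linear bop_linearE. Qed.

Lemma coeff_exists (xi : L1) (eta : L2) : exists f : V1,
  (forall x, f x = hdot L2 (uop U (phi x) xi) eta) /\
  opnorm f <= rnorm xi * rnorm eta.
Proof.
pose f x : R[i]^o := hdot L2 (uop U (phi x) xi) eta.
have fb x : rnorm (f x) <= rnorm xi * rnorm eta * rnorm x.
  apply: (le_trans (hdot_CauchySchwarz _ _)).
  rewrite mulrAC ler_wpM2r ?rnorm_ge0// mulrC.
  apply: (le_trans (opnormP _ _)); rewrite ler_wpM2r ?rnorm_ge0//.
  by rewrite phi_iso uop_opnorm_le.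
have [a x y|g gE] := @bop_of_bound _ _ _ f _ _ fb.
  by rewrite /f uphi_linear hdot_linear.
exists g; split=> [x|]; first by rewrite -gE.
by apply: opnorm_le_bound => [|x]; [rewrite mulr_ge0 ?rnorm_ge0|rewrite -gE].
Qed.

Definition coeff xi eta : V1 := sval (cid (coeff_exists xi eta)).

Lemma coeffE xi eta x : coeff xi eta x = hdot L2 (uop U (phi x) xi) eta.
Proof. by rewrite /coeff; case: cid => f [/= ->]. Qed.

Lemma coeff_opnorm xi eta : opnorm (coeff xi eta) <= rnorm xi * rnorm eta.
Proof. by rewrite /coeff; case: cid => f []. Qed.

Lemma coeff_linearl a xi xi' eta :
  coeff (a *: xi + xi') eta = a *: coeff xi eta + coeff xi' eta.
Proof.
by apply: bop_ext => x; rewrite bop_linearE !coeffE linearP hdot_linear.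
Qed.

Lemma coeff_linearr a xi eta eta' :
  coeff xi (a *: eta + eta') = a^* *: coeff xi eta + coeff xi eta'.
Proof.
by apply: bop_ext => x; rewrite bop_linearE !coeffE hdotDr hdotZr.
Qed.

Lemma Phi_exists (F : V2) : exists2 T : bop L1 L2,
  (forall xi eta, hdot L2 (T xi) eta = F (coeff xi eta)) & opnorm T <= opnorm F.
Proof.
apply: bop_of_form; first exact: opnorm_ge0.
- by move=> a x y z; rewrite coeff_linearl linearP.
- by move=> a x y z; rewrite coeff_linearr linearP.
- move=> x y; apply: (le_trans (opnormP _ _)).
  by rewrite -mulrA ler_wpM2l ?opnorm_ge0// coeff_opnorm.
Qed.

Definition Phi (F : V2) : bop L1 L2 := sval (cid2 (Phi_exists F)).

Lemma PhiE F xi eta : hdot L2 (Phi F xi) eta = F (coeff xi eta).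
Proof. by rewrite /Phi; case: cid2. Qed.

Lemma Phi_linear a F G : Phi (a *: F + G) = a *: Phi F + Phi G.
Proof.
apply: bop_ext => xi; apply: hdot_inj => eta.
by rewrite bop_linearE hdot_linear !PhiE.
Qed.

Definition Phi_linear_map : {linear bidual V -> bop L1 L2} :=
  HB.pack (Phi : bidual V -> bop L1 L2)
    (GRing.isLinear.Build R[i] (bidual V) (bop L1 L2) *:%R Phi Phi_linear).

(* A single pair of vectors suffices: this makes the range of Phi w*-closed    *)
(* (Phi_range) without the Krein-Smulian theorem.                              *)
Lemma coeff_surj (f : V1) : exists xi eta,
  f = coeff xi eta /\ rnorm xi * rnorm eta <= opnorm f.
Proof.
have [f0|f0] := eqVneq (opnorm f) 0.
  exists 0, 0; split; last by rewrite rnorm0 mul0r opnorm_ge0.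
  apply: bop_ext => x; rewrite coeffE hdot0r; apply/eqP.
  rewrite -(@rnorm_eq0 _ R[i]^o) eq_le rnorm_ge0 andbT.
  by rewrite (le_trans (opnormP _ _))// f0 mul0r.
have c0 : 0 < opnorm f by rewrite lt_neqAle eq_sym f0 opnorm_ge0.
have [k l a x y|z s s0 zs|h [k [h1 k1 hk]]] := @matrix_functional_repr _ V _ _ phi 1
    phi_ci (fun _ _ x => f x) _ _ c0 _ U S S_adapted.
- by rewrite linearP.
- rewrite !big_ord1; apply: (le_trans (opnormP _ _)).
  rewrite ler_wpM2l ?opnorm_ge0// phi_iso.
  move: zs; rewrite -phi_ci => /(bop_mxnorm_entry 0 0); by rewrite mxE.
exists ((opnorm f)%:C *: h 0), (k 0); split.
  by apply: bop_ext => x; rewrite coeffE bopZ hdotZl -hk.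
have n1 (L : hilbert R) (v : 'I_1 -> L) : \sum_j rnorm (v j) ^+ 2 <= 1 -> rnorm (v 0) <= 1.
  by rewrite big_ord1 expr_le1 ?rnorm_ge0.
rewrite rnormZ -/(cabs _) cabs_real ger0_norm ?(ltW c0)// -mulrA ler_piMr ?(ltW c0)//.
by rewrite mulr_ile1 ?rnorm_ge0 ?n1.
Qed.

(** Taken with [b = 0], this also serves as multiplication by a scalar. *)
Definition mxcomb n (a b : R[i]) (x y : 'M[V]_n) : 'M[V]_n :=
  \matrix_(i, j) (a *: x i j + b *: y i j).

Lemma mxnorm_comb n (x y : 'M[V]_n) (a b : R[i]) (r s : R) : 0 <= r -> 0 <= s ->
  (mxnorm x <= r%:E)%E -> (mxnorm y <= s%:E)%E ->
  (mxnorm (mxcomb a b x y) <=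
     (cabs a * r + cabs b * s)%:E)%E.
Proof.
move=> r0 s0; rewrite -!phi_ci => /(bop_mxnorm_le _ r0) xr /(bop_mxnorm_le _ s0) ys.
apply/bop_mxnorm_le; first by rewrite addr_ge0// mulr_ge0 ?cabs_ge0.
move=> h k h1 k1.
rewrite (eq_bigr (fun i => a * (\sum_j hdot K2 (map_mx phi x i j (h j)) (k i)) +
    b * (\sum_j hdot K2 (map_mx phi y i j (h j)) (k i)))) => [|i _].
  rewrite big_split/= -!mulr_sumr (le_trans (cabsD _ _))// !cabsM.
  by apply: lerD; rewrite ler_wpM2l ?cabs_ge0//; [exact: xr|exact: ys].
rewrite !mulr_sumr -big_split/=; apply: eq_bigr => j _.
by rewrite !mxE linearP bop_linearE hdot_linear linearZ bop_scaleE hdotZl.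
Qed.

Lemma mxnorm0_le n (r : R) : 0 <= r -> (mxnorm (@const_mx V n n 0%R) <= r%:E)%E.
Proof.
move=> r0; rewrite -phi_ci; apply/bop_mxnorm_le => // h k _ _.
rewrite big1 ?cabs0// => i _; rewrite big1// => j _.
by rewrite !mxE linear0 hdot0l.
Qed.

(** Weights bounded by [M] on the values of matrices of norm at most [r] define a matrix functional
    of norm at most [M / r], which is a vector functional on the ultraproduct. Applying [F] to it
    gives [M / r] times the form of [Phi F] at two tuples of the unit ball, hence at most [M]. The
    bound is assumed for [Phi F], as [Phi_ge] needs. *)
Lemma goldstine n (F : 'M[V2]_n) (r : R) : 0 < r ->
  (bop_mxnorm (map_mx Phi F) <= r%:E)%E ->
  forall (fs : seq V1) (e : R), 0 < e ->
  exists2 x : 'M[V]_n, (mxnorm x <= r%:E)%E &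
    forall f, f \in fs -> forall k l, cabs (F k l f - f (x k l)) < e.
Proof.
move=> r0 Fr fs e e0; pose A := ('I_n * 'I_n * 'I_(size fs))%type.
pose s (i : 'I_(size fs)) := nth 0 fs i.
pose C : set (A -> R[i]^o) := [set (fun a => s a.2 (x a.1.1 a.1.2)) |
  x in [set x : 'M[V]_n | (mxnorm x <= r%:E)%E]].
have r0' := ltW r0.
have [|||||_ [x xr <-] hx] := @balanced_convex_approx R A C
  (fun a => F a.1.1 a.1.2 (s a.2)) ((\sum_(i < size fs) opnorm (s i)) * r)
  _ _ _ _ _ e e0.
- exists (fun a => s a.2 0), (@const_mx V n n 0); first exact: mxnorm0_le.
  by apply/funext => a; rewrite mxE.
- move=> t _ _ /andP[t0 t1] [x xr <-] [y yr <-].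
  exists (mxcomb t%:C (1 - t)%:C x y) => /=.
    apply: (le_trans (mxnorm_comb _ _ r0' r0' xr yr)).
    by rewrite !cabs_real !ger0_norm ?subr_ge0// -mulrDl addrC subrK mul1r.
  by apply/funext => a; rewrite mxE linearP linearZ.
- move=> u _ u1 [x xr <-].
  exists (mxcomb u 0 x x) => /=.
    apply: (le_trans (mxnorm_comb _ _ r0' r0' xr xr)).
    by rewrite u1 cabs0 mul1r mul0r addr0.
  by apply/funext => a; rewrite mxE scale0r addr0 linearZ.
- move=> _ [x xr <-] a; apply: (le_trans (opnormP _ _)).
  apply: ler_pM; rewrite ?opnorm_ge0 ?rnorm_ge0//.
    by rewrite (bigD1 a.2)//= lerDl sumr_ge0// => i _; exact: opnorm_ge0.
  move: xr => /=; rewrite -phi_ci => /(bop_mxnorm_entry a.1.1 a.1.2).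
  by rewrite mxE phi_iso.
- move=> lam M M0 CM.
  have sumA (G : 'I_n -> 'I_n -> 'I_(size fs) -> R[i]) :
      \sum_(a : A) lam a * G a.1.1 a.1.2 a.2 =
      \sum_k \sum_l \sum_i lam (k, l, i) * G k l i.
    by rewrite !pair_bigA/=; apply: eq_bigr => -[[]].
  pose g k l : V1 := \sum_i lam (k, l, i) *: s i.
  have gE k l x : g k l x = \sum_i lam (k, l, i) * s i x.
    exact: (@linear_functional_sum _ _ (fun f : V1 => f x)).
  have c0 : 0 < M / r by rewrite divr_gt0.
  have [k l a x y|z t t0 zt|h [k [h1 k1 hk]]] := @matrix_functional_repr _ V _ _ phi n
      phi_ci (fun k l x => g k l x) _ _ c0 _ U S S_adapted.
  + by rewrite linearP.
  (* Rescaling to norm at most [r] brings [z] into the range of [CM]. *)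
  + pose z' := mxcomb (r / t)%:C 0 z z.
    have := CM (fun a => s a.2 (z' a.1.1 a.1.2)).
    rewrite (sumA (fun k l i => s i (z' k l))).
    have zr : (mxnorm z' <= r%:E)%E.
      apply: (le_trans (mxnorm_comb _ _ (ltW t0) (ltW t0) zt zt)).
      rewrite cabs0 mul0r addr0 cabs_real ger0_norm ?divr_ge0 ?(ltW t0)//.
      by rewrite divfK// gt_eqF.
    have Cz' : C (fun a => s a.2 (z' a.1.1 a.1.2)) by exists z'.
    move=> /(_ Cz').
    rewrite (eq_bigr (fun k => (r / t)%:C * \sum_l g k l (z k l))) => [|k _].
      rewrite -mulr_sumr cabsM cabs_real ger0_norm ?divr_ge0 ?(ltW t0)//.
      rewrite mulrAC ler_pdivrMr// mulrC -ler_pdivlMr// => h.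
      by rewrite mulrAC.
    rewrite mulr_sumr; apply: eq_bigr => l _; rewrite gE mulr_sumr.
    by apply: eq_bigr => i _; rewrite mxE scale0r addr0 linearZ mulrCA.
  rewrite (sumA (fun k l i => F k l (s i))).
  have gco k' l : g k' l = (M / r)%:C *: coeff (h l) (k k') + 0.
    by apply: bop_ext => x; rewrite bop_linearE hk coeffE addr0.
  rewrite (eq_bigr (fun k' => (M / r)%:C *
      \sum_l hdot L2 (map_mx Phi F k' l (h l)) (k k'))) => [|k' _].
    rewrite -mulr_sumr cabsM cabs_real gtr0_norm//.
    have := (bop_mxnorm_le _ r0').1 Fr h k h1 k1 => /(ler_wpM2l (ltW c0)).
    by rewrite divfK// gt_eqF.
  rewrite mulr_sumr; apply: eq_bigr => l _.
  rewrite mxE PhiE -(@linear_functional_sum _ _ (F k' l)) => [|*]; last by rewrite linearP.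
  by rewrite -/(g k' l) gco addr0 linearZ.
exists x => // f fin k l.
have fi : (index f fs < size fs)%N by rewrite index_mem.
by have := hx (k, l, Ordinal fi); rewrite /s /= nth_index.
Qed.

(** * Complete isometry of the representation *)

Lemma sum_coeff n p (F : 'M[V2]_n) (w : 'I_p -> L1) (v : 'I_p -> L2)
    (a b : 'I_n -> 'I_p -> R[i]) :
  \sum_k \sum_l hdot L2 (Phi (F k l) (\sum_t a l t *: w t)) (\sum_s b k s *: v s) =
  \sum_(s : 'I_n * 'I_p) \sum_(t : 'I_n * 'I_p)
    F s.1 t.1 (coeff (w t.2) (v s.2)) * a t.1 t.2 * (b s.1 s.2)^*.
Proof.
rewrite sum_pair; apply: eq_bigr => k _.
under [RHS]eq_bigr do rewrite sum_pair.
rewrite exchange_big; apply: eq_bigr => l _.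
rewrite hdot_sumr; apply: eq_bigr => s _.
rewrite bop_sumZ hdotZr hdot_suml mulr_sumr; apply: eq_bigr => t _.
by rewrite hdotZl PhiE mulrC [a l t * _]mulrC.
Qed.

(** Evaluated at [x], this matrix is [x^U] compressed by the contractions that [w] and [v] define,
    so [uop_bop_mxnorm] bounds it. *)
Lemma coeff_mxnorm n (w : 'I_n -> L1) (v : 'I_n -> L2) :
  (forall c : 'I_n -> R[i], rnorm (\sum_t c t *: w t) ^+ 2 <= \sum_t cabs (c t) ^+ 2) ->
  (forall c : 'I_n -> R[i], rnorm (\sum_t c t *: v t) ^+ 2 <= \sum_t cabs (c t) ^+ 2) ->
  (dual_mxnorm (V := V) (\matrix_(s, t) coeff (w t) (v s)) <= 1)%E.
Proof.
move=> wc vc; apply: ge_ereal_sup => _ [q [x [x1 ->]]].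
apply/scalar_mxnorm_le => // a b a1 b1.
have xu : (bop_mxnorm (map_mx (@uop R U K1 K2) (map_mx phi x)) <= 1%:E)%E.
  by apply: uop_bop_mxnorm => //; rewrite phi_ci.
pose h j := \sum_t a (t, j) *: w t; pose k i := \sum_s b (s, i) *: v s.
have sumn (L : hilbert R) (c : 'I_n * 'I_q -> R[i]) (z : 'I_n -> L) :
    (forall c : 'I_n -> R[i], rnorm (\sum_t c t *: z t) ^+ 2 <= \sum_t cabs (c t) ^+ 2) ->
    \sum_j cabs (c j) ^+ 2 <= 1 ->
    \sum_j rnorm (\sum_t c (t, j) *: z t) ^+ 2 <= 1.
  move=> zc c1; apply: le_trans c1; apply: le_trans (ler_sum _ (fun j _ => zc _)) _.
  by rewrite [leRHS]sum_pair exchange_big.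
have := (bop_mxnorm_le _ ler01).1 xu h k (sumn _ _ _ wc a1) (sumn _ _ _ vc b1).
apply: le_trans; rewrite le_eqVlt; apply/orP; left; apply/eqP; congr cabs.
rewrite sum_pair exchange_big; apply: eq_bigr => i _.
under [LHS]eq_bigr do rewrite sum_pair exchange_big.
rewrite exchange_big; apply: eq_bigr => j _.
rewrite hdot_sumr; apply: eq_bigr => s _.
rewrite !mxE bop_sumZ hdotZr hdot_suml mulr_sumr; apply: eq_bigr => t _.
by rewrite mxE hdotZl coeffE mulrC [a _ * _]mulrC.
Qed.

(** A supremum over the empty set would be [-oo]; a matrix in the unit ball rules this out. *)
Lemma dual_mxnorm_ge0 (W : mxnormed R) n (f : 'M[bop W R[i]^o]_n) :
  (exists p, exists x : 'M[W]_p, (mxnorm x <= 1)%E) -> (0 <= dual_mxnorm f)%E.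
Proof.
move=> [p [x x1]]; apply: le_trans (opmx_norm_ge0 _) _; last first.
  by apply: ereal_sup_ubound; exists p, x; split=> //; reflexivity.
Qed.

(** In orthonormal coordinates the form of [Phi F] at [h] and [k] becomes that of the scalar matrix
    of values of [F] on the [coeff (w t) (v s)], and these form an [n] by [n] matrix in the unit
    ball over the dual. *)
Lemma Phi_le n (F : 'M[V2]_n) (r : R) : 0 <= r ->
  (dual_mxnorm (V := Dual V) F <= r%:E)%E -> (bop_mxnorm (map_mx Phi F) <= r%:E)%E.
Proof.
move=> r0 Fr; apply/bop_mxnorm_le => // h k h1 k1.
have [w [a [ha a1 wc]]] := orthonormal_coordinates h.
have [v [b [kb b1 vc]]] := orthonormal_coordinates k.
have : (scalar_mxnorm (fun s t : 'I_n * 'I_n => F s.1 t.1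
    ((\matrix_(s, t) coeff (w t) (v s)) s.2 t.2)) <= r%:E)%E.
  apply: le_trans Fr; apply: ereal_sup_ubound.
  by exists n, (\matrix_(s, t) coeff (w t) (v s)); split=> //; exact: coeff_mxnorm.
move=> /(scalar_mxnorm_le _ r0).
move=> /(_ (fun t => a t.1 t.2) (fun s => b s.1 s.2)).
rewrite (sum_pair (fun l => cabs (a l.1 l.2) ^+ 2)).
rewrite (sum_pair (fun l => cabs (b l.1 l.2) ^+ 2))/=.
rewrite (eq_bigr _ (fun l _ => a1 l)) (eq_bigr _ (fun l _ => b1 l)) => /(_ h1 k1).
apply: le_trans; rewrite le_eqVlt; apply/orP; left; apply/eqP; congr cabs.
transitivity (\sum_i \sum_j hdot L2 (Phi (F i j) (\sum_t a j t *: w t))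
    (\sum_s b i s *: v s)).
  by apply: eq_bigr => i _; apply: eq_bigr => j _; rewrite mxE -ha -kb.
rewrite sum_coeff; apply: eq_bigr => s _; apply: eq_bigr => t _.
by rewrite mxE.
Qed.

(** By [goldstine] the finitely many values [F k l (f i j)] are close to [f i j (x k l)] with
    [|x| <= r]. The matrix [x / r] is admissible in the norm of [f], once the two components of the
    index pairs are interchanged. *)
Lemma Phi_ge n (F : 'M[V2]_n) (r : R) : 0 < r ->
  (bop_mxnorm (map_mx Phi F) <= r%:E)%E -> (dual_mxnorm (V := Dual V) F <= r%:E)%E.
Proof.
move=> r0 Fr; apply: ge_ereal_sup => _ [p [f [f1 ->]]].
apply/scalar_mxnorm_le; first exact: ltW.
move=> a b a1 b1; apply: ler_eps => e e0.
pose N : R := (#|{: 'I_n * 'I_p}|)%:R; have N0 : 0 <= N by [].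
(* There are [N * N] terms, each with an error below [d] and coefficients of modulus at most 1. *)
pose d := e / (N * N + 1); have NN : 0 < N * N + 1 by rewrite ltr_wpDl ?mulr_ge0.
have d0 : 0 < d by rewrite divr_gt0.
have [x xr xf] := goldstine r0 Fr [seq f st.1 st.2 | st <- enum {: 'I_p * 'I_p}] d0.
have {}xf i j k l : cabs (F k l (f i j) - f i j (x k l)) < d.
  by apply: xf; apply/mapP; exists (i, j); rewrite ?mem_enum.
have le1 (I : finType) (c : I -> R[i]) i : \sum_j cabs (c j) ^+ 2 <= 1 -> cabs (c i) <= 1.
  move=> c1; rewrite -(@expr_le1 _ 2) ?cabs_ge0//; apply: le_trans c1.
  by rewrite (bigD1 i)//= lerDl sumr_ge0// => j _; rewrite sqr_ge0.
pose A := \sum_(s : 'I_n * 'I_p) \sum_(t : 'I_n * 'I_p)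
  F s.1 t.1 (f s.2 t.2) * a t * (b s)^*.
pose B := \sum_(s : 'I_n * 'I_p) \sum_(t : 'I_n * 'I_p)
  f s.2 t.2 (x s.1 t.1) * a t * (b s)^*.
have AB : cabs (A - B) <= N * (N * d).
  rewrite -sumrB; apply: (le_trans (cabs_sum _ _ _)).
  rewrite [leRHS]mulr_natl -sumr_const; apply: ler_sum => s _.
  rewrite -sumrB; apply: (le_trans (cabs_sum _ _ _)).
  rewrite [leRHS]mulr_natl -sumr_const; apply: ler_sum => t _.
  rewrite -!mulrBl !cabsM cabs_conj -mulrA -[leRHS]mulr1.
  apply: ler_pM; rewrite ?mulr_ge0 ?cabs_ge0//; first exact: ltW (xf _ _ _ _).
  by rewrite mulr_ile1 ?cabs_ge0// le1.
have Br : cabs B <= r.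
  pose x' := mxcomb r^-1%:C 0 x x.
  have x'1 : (mxnorm x' <= 1)%E.
    apply: (le_trans (mxnorm_comb _ _ (ltW r0) (ltW r0) xr xr)).
    by rewrite cabs0 mul0r addr0 cabs_real gtr0_norm ?invr_gt0// mulVf// gt_eqF.
  have : (scalar_mxnorm (fun s t : 'I_p * 'I_n => f s.1 t.1 (x' s.2 t.2)) <= 1%:E)%E.
    by apply: le_trans f1; apply: ereal_sup_ubound; exists n, x'.
  move=> /(scalar_mxnorm_le _ ler01).
  move=> /(_ (fun t => a (t.2, t.1)) (fun s => b (s.2, s.1))).
  rewrite -(sum_swap (fun t => cabs (a t) ^+ 2)) -(sum_swap (fun t => cabs (b t) ^+ 2)).
  move=> /(_ a1 b1).
  suff -> : \sum_(s : 'I_p * 'I_n) \sum_(t : 'I_p * 'I_n) f s.1 t.1 (x' s.2 t.2) *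
      a (t.2, t.1) * (b (s.2, s.1))^* = r^-1%:C * B.
    rewrite cabsM cabs_real gtr0_norm ?invr_gt0//.
    by rewrite mulrC ler_pdivrMr// mul1r.
  rewrite /B [in RHS]sum_swap mulr_sumr; apply: eq_bigr => s _.
  rewrite [in RHS]sum_swap mulr_sumr; apply: eq_bigr => t _.
  by rewrite mxE scale0r addr0 bopZ !mulrA.
rewrite -/A -(subrK B A) (le_trans (cabsD _ _))// addrC lerD// (le_trans AB)//.
have dN : d * (N * N + 1) = e by rewrite /d divfK// gt_eqF.
rewrite -dN (_ : N * (N * d) = d * (N * N)); last ring.
by rewrite mulrDr mulr1 lerDl ltW.
Qed.

Lemma Phi_complete_isometry : complete_isometry Phi_linear_map.
Proof.
move=> n F; change (bop_mxnorm (map_mx Phi F) = dual_mxnorm (V := Dual V) F).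
have h1 : (0 <= bop_mxnorm (map_mx Phi F))%E by exact: opmx_norm_ge0.
have h2 : (0 <= dual_mxnorm (V := Dual V) F)%E.
  (* The empty matrix over the dual is in the unit ball, as the scalar matrices it yields are empty
     too. *)
  apply: dual_mxnorm_ge0; exists 0%N, (@const_mx V1 0 0 0%R).
  apply: ge_ereal_sup => _ [q [x [x1 ->]]]; apply/scalar_mxnorm_le => // a b _ _.
  by rewrite sum_pair big_ord0 cabs0.
apply/eqP; rewrite eq_le; apply/andP; split.
  have := @Phi_le n F; move: h2; case: (dual_mxnorm _) => [r| |]// r0.
    by apply; rewrite // -lee_fin.
  by rewrite leey.
have := @Phi_ge n F; move: h1; case: (bop_mxnorm _) => [r| |]// r0; last by rewrite leey.
(* [Phi_ge] takes a positive bound, hence the passage through [r + e]. *)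
move=> h; apply/lee_addgt0Pr => e e0; apply: h.
  by rewrite ltr_wpDl// -lee_fin.
by rewrite lee_fin lerDl ltW.
Qed.

(** Evaluating [T] at representing vectors of [f] defines a functional on the dual. The relations
    give its linearity and its independence of the chosen vectors; the norm condition on the single
    representing pair gives its boundedness. *)
Lemma Phi_range (T : bop L1 L2) :
  (forall l : seq (R[i] * L1 * L2),
     (forall x, \sum_(p <- l) p.1.1 * hdot L2 (uop U (phi x) p.1.2) p.2 = 0) ->
     \sum_(p <- l) p.1.1 * hdot L2 (T p.1.2) p.2 = 0) ->
  exists F, Phi F = T.
Proof.
move=> Tvan.
have /choice[rep repP] : forall f : V1, exists p : L1 * L2,
    f = coeff p.1 p.2 /\ rnorm p.1 * rnorm p.2 <= opnorm f.
  by move=> f; have [xi [eta h]] := coeff_surj f; exists (xi, eta).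
pose G f : R[i]^o := hdot L2 (T (rep f).1) (rep f).2.
have repE f x : hdot L2 (uop U (phi x) (rep f).1) (rep f).2 = f x.
  by rewrite [in RHS](repP f).1 coeffE.
have Glin a f g : G (a *: f + g) = a *: G f + G g.
  have := Tvan [:: (a, (rep f).1, (rep f).2); (1, (rep g).1, (rep g).2);
    (-1, (rep (a *: f + g)).1, (rep (a *: f + g)).2)].
  rewrite !big_cons !big_nil /= !addr0 !mul1r !mulN1r => h.
  have {}h : a * G f + (G g - G (a *: f + g)) = 0.
    apply: h => x; rewrite !big_cons big_nil /= addr0 mul1r mulN1r !repE.
    by rewrite bop_linearE addrA subrr.
  by apply/eqP; rewrite -subr_eq0 -oppr_eq0 opprB -addrA h.
have Gb f : rnorm (G f) <= opnorm T * rnorm f.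
  apply: (le_trans (hdot_CauchySchwarz _ _)).
  apply: (le_trans (ler_wpM2r (rnorm_ge0 _) (opnormP _ _))).
  by rewrite -mulrA ler_wpM2l ?opnorm_ge0// (repP f).2.
have [F FE] := bop_of_bound Glin Gb.
exists F; apply: bop_ext => xi; apply: hdot_inj => eta; rewrite PhiE -FE.
have := Tvan [:: (1, (rep (coeff xi eta)).1, (rep (coeff xi eta)).2); (-1, xi, eta)].
rewrite !big_cons !big_nil /= !addr0 !mul1r !mulN1r => h.
apply/eqP; rewrite -subr_eq0; apply/eqP/h => x.
by rewrite !big_cons big_nil /= addr0 mul1r mulN1r repE coeffE subrr.
Qed.

(** The relation says that a combination of functionals [coeff] is zero in the dual, and [F] is
    linear. *)
Lemma Phi_vanish F (l : seq (R[i] * L1 * L2)) :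
  (forall x, \sum_(p <- l) p.1.1 * hdot L2 (uop U (phi x) p.1.2) p.2 = 0) ->
  \sum_(p <- l) p.1.1 * hdot L2 (Phi F p.1.2) p.2 = 0.
Proof.
move=> l0; pose g : V1 := \sum_(p <- l) p.1.1 *: coeff p.1.2 p.2.
have g0 : g = 0.
  apply: bop_ext => x.
  rewrite (@linear_functional_sum _ _ (fun f : V1 => f x))//.
  by rewrite -[RHS](l0 x); apply: eq_bigr => p _; rewrite coeffE.
have Fg : F g = 0 by rewrite g0 linear0.
rewrite -[RHS]Fg (@linear_functional_sum _ _ F) => [|*].
  by apply: eq_bigr => p _; rewrite PhiE.
by rewrite linearP.
Qed.

(** [F] is evaluation at [x], the canonical image of [x] in the bidual. *)
Lemma Phi_eval (x : V) : exists F : V2, Phi F = uop U (phi x).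
Proof.
have [|f|F FE] := @bop_of_bound _ V1 R[i]^o (fun f => f x) (rnorm x) => //.
  by rewrite mulrC; exact: opnormP.
exists F; apply: bop_ext => xi; apply: hdot_inj => eta.
by rewrite PhiE -FE coeffE.
Qed.

(** For a vector functional this is [PhiE]. Finite sums approximate [w] in norm, and their
    restrictions approximate [f] in the norm of the dual, on which [F] is continuous. *)
Lemma sigma_weak_Phi (w : bop L1 L2 -> R[i]^o) : sigma_weak w ->
  exists f : V1, (forall x, f x = w (uop U (phi x))) /\ forall F, w (Phi F) = F f.
Proof.
move=> sw; have wlin := sigma_weak_linear sw.
have [C C0 wC] := sigma_weak_bound sw.
have opn x : opnorm (uop U (phi x)) <= rnorm x by rewrite phi_iso uop_opnorm_le.
have [a x y|x|f fE] := @bop_of_bound _ V R[i]^o (fun x => w (uop U (phi x))) C.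
- by rewrite linearP uop_linear wlin.
- by apply: (le_trans (wC _)); rewrite ler_wpM2l.
exists f; split=> [x|F]; first by rewrite -fE.
apply/eqP; rewrite -subr_eq0; apply/eqP.
apply: (@cabs_le_eps _ _ (opnorm (Phi F) + opnorm F)).
  by rewrite addr_ge0 ?opnorm_ge0.
have [xi [eta wN]] := sigma_weak_approx sw.
move=> e e0; have [N hN] := wN e e0.
pose g : V1 := \sum_(0 <= n < N) (1 : R[i]) *: coeff (xi n) (eta n).
have Fg : F g = \sum_(0 <= n < N) hdot L2 (Phi F (xi n)) (eta n).
  rewrite (@linear_functional_sum _ _ F) => [|*]; last by rewrite linearP.
  by apply: eq_bigr => n _; rewrite mul1r PhiE.
have gE x : g x = \sum_(0 <= n < N) hdot L2 (uop U (phi x) (xi n)) (eta n).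
  rewrite (@linear_functional_sum _ _ (fun f : V1 => f x))//.
  by apply: eq_bigr => n _; rewrite mul1r coeffE.
have -> : w (Phi F) - F f = (w (Phi F) - F g) - F (f - g).
  by rewrite linearB opprB addrA subrK.
apply: (le_trans (cabsD _ _)); rewrite mulrDr cabsN lerD//; first by rewrite Fg.
apply: (le_trans (opnormP F _)); rewrite mulrC ler_wpM2r ?opnorm_ge0//.
apply: opnorm_le_bound; first exact: ltW.
move=> x; rewrite bopBE -fE gE; apply: (le_trans (hN _)).
by rewrite ler_wpM2l// ltW.
Qed.

Lemma Phi_wstar_continuous : wstar_continuous Phi_linear_map.
Proof.
move=> F.
have FF : Filter (nbhs (F : wstar_dual (bidual V))) by exact: nbhs_filter.
apply: (@wstar_bop_cvgP R L1 L2 (Phi @ nbhs (F : wstar_dual (bidual V))) (Phi F) _).2.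
move=> w sw.
have [f [_ wf]] := sigma_weak_Phi sw.
rewrite wf.
have e : w \o Phi = (fun G : V2 => G f : R[i]^o) by apply/funext.
suff : (w \o Phi) @ nbhs (F : wstar_dual (bidual V)) --> ((F : V2) f : R[i]^o) by [].
rewrite e.
have h : nbhs (F : wstar_dual (bidual V)) --> (F : wstar_dual (bidual V)) by [].
exact: (initial_ptws_cvgP _ _ _).1 h f.
Qed.

(** The filter is the trace on [V] of the w*-neighbourhoods of [F]. It is proper by [goldstine] at
    size 1, and [sigma_weak_Phi] turns convergence on each functional of the dual into
    w*-convergence. *)
Lemma Phi_wstar_limit (F : V2) : exists2 G : set_system V, ProperFilter G &
  (fun x => uop U (phi x)) @ G --> (Phi F : wstar_bop L1 L2).
Proof.
pose base (p : seq V1 * R) := [set x : V | forall f, f \in p.1 -> cabs (F f - f x) < p.2].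
pose G := filter_from [set p : seq V1 * R | 0 < p.2] base.
have r0 : 0 < opnorm (Phi F) + 1 by rewrite ltr_wpDl ?opnorm_ge0.
have GP : ProperFilter G.
  apply: filter_from_proper; last first.
    move=> [fs e] /= e0; pose F1 : 'M[V2]_1 := const_mx F.
    have F1r : (bop_mxnorm (map_mx Phi F1) <= (opnorm (Phi F) + 1)%:E)%E.
      apply/bop_mxnorm_le; first exact: ltW.
      move=> h k; rewrite !big_ord1 !mxE !expr_le1 ?rnorm_ge0// => h1 k1.
      apply: (le_trans (hdot_CauchySchwarz _ _)).
      rewrite -[leRHS]mulr1 ler_pM ?rnorm_ge0//.
      apply: (le_trans (opnormP _ _)).
      by rewrite (le_trans (ler_piMr (opnorm_ge0 _) h1))// lerDl.
    have [x _ xf] := goldstine r0 F1r fs e0.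
    by exists (x 0 0) => f ff; have := xf f ff 0 0; rewrite mxE.
  apply: filter_from_filter; first by exists ([::], 1) => /=.
  move=> [fs e] [fs' e'] /= e0 e'0; exists (fs ++ fs', Num.min e e').
    by rewrite /= lt_min e0.
  move=> x /= h; split=> f ff /=; have := h f; rewrite mem_cat ff ?orbT => /(_ isT).
    by rewrite lt_min => /andP[].
  by rewrite lt_min => /andP[].
exists G => //; apply/wstar_bop_cvgP => w sw; have [f [fE wf]] := sigma_weak_Phi sw.
apply/cvg_rnormP => e e0; exists ([:: f], e) => //= x /= /(_ f (mem_head _ _)).
by rewrite wf fE.
Qed.

End BidualRepresentation.

(** * Transfer of the TRO equivalence *)

Section SpanTransfer.
Variable R : realType.

(** Continuity from the norm to the w*-topology, which carries norm closures into w*-closures: [uop]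
    is contractive and every [w] is bounded. *)
Lemma uop_wstar_continuous (U : ultraindex) (H K : hilbert R) :
  continuous (@uop R U H K : bop H K -> wstar_bop (up U H) (up U K)).
Proof.
move=> T; apply: (@wstar_bop_cvgP R (up U H) (up U K) (@uop R U H K @ nbhs T) (uop U T) _).2.
move=> w sw; have [C C0 wC] := sigma_weak_bound sw.
have C1 : 0 < C + 1 by rewrite ltr_wpDl.
suff : (w \o @uop R U H K) @ nbhs T --> w (uop U T) by [].
apply/cvg_rnormP => e e0.
have : nbhs T (ball T (e / (C + 1))%:C) by apply: nbhsx_ballx; rewrite ltcR divr_gt0.
apply: filterS => S; rewrite ball_rnormE /= ltr_pdivlMr// mulrC => ST.
have -> : w (uop U T) - w (uop U S) = w (uop U (T - S)).
  have wS := sigma_weak_linear sw (-1) (uop U S) (uop U T).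
  rewrite mulN1r in wS; rewrite [LHS]addrC -wS; congr w.
  by rewrite -uop_linear scaleN1r addrC.
apply: le_lt_trans ST; apply: (le_trans (wC _)).
by rewrite ler_pM ?opnorm_ge0// ?lerDl// uop_opnorm_le.
Qed.

Lemma sub_lspan (V : lmodType R[i]) (A : set V) : A `<=` lspan A.
Proof. exact: sub_gen_smallest. Qed.

Lemma lspan_sub (V : lmodType R[i]) (A B : set V) :
  linear_subspace B -> A `<=` B -> lspan A `<=` B.
Proof. by move=> Blin AB; exact: smallest_sub. Qed.

Lemma lspan_subspace (V : lmodType R[i]) (A : set V) : linear_subspace (lspan A).
Proof.
split; first by rewrite inE => B [[]]; rewrite inE.
move=> a x y; rewrite !inE => xA yA B BA.
have [[_ Blin] _] := BA; have := Blin a x y; rewrite !inE; apply.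
  exact: xA.
exact: yA.
Qed.

Lemma lspan_vanish (H K : hilbert R) (A : set (bop H K)) (l : seq (R[i] * H * K)) :
  (forall S, A S -> \sum_(p <- l) p.1.1 * hdot K (S p.1.2) p.2 = 0) ->
  forall S, lspan A S -> \sum_(p <- l) p.1.1 * hdot K (S p.1.2) p.2 = 0.
Proof.
move=> A0; apply: (@lspan_sub _ _
  [set S : bop H K | \sum_(p <- l) p.1.1 * hdot K (S p.1.2) p.2 = 0]) A0.
split; first by rewrite inE /= big1// => p _; rewrite hdot0l mulr0.
move=> a S T; rewrite !inE /= => S0 T0.
rewrite (eq_bigr (fun p => a * (p.1.1 * hdot K (S p.1.2) p.2) +
    p.1.1 * hdot K (T p.1.2) p.2)) => [|p _].
  by rewrite big_split/= -mulr_sumr S0 T0 mulr0 addr0.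
by rewrite mulrCA -mulrDr -hdot_linear.
Qed.

(** The sets [P1] and [P2] are left general so that both equations of the equivalence are
    instances. *)
Lemma bidual_range (U : ultraindex) (V W : mxnormed R) (K1 K2 H1 H2 : hilbert R)
    (phi : {linear V -> bop K1 K2}) (psi : {linear W -> bop H1 H2})
    (phi_iso : forall x : V, rnorm x = opnorm (phi x))
    (psi_iso : forall y : W, rnorm y = opnorm (psi y))
    (S : U -> seq V) (P2 : set (bop H2 K2)) (P1 : set (bop K1 H1)) :
  complete_isometry phi -> adapted S ->
  range phi = norm_span (prod_set (prod_set P2 (range psi)) P1) ->
  range (Phi_linear_map U phi_iso) =
  wstar_span (prod_set (prod_set (@uop R U H2 K2 @` P2)
    (range (Phi_linear_map U psi_iso))) (@uop R U K1 H1 @` P1)).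
Proof.
move=> phi_ci S_adapted phi_range; set Q := prod_set (prod_set (_ @` _) _) _.
apply/seteqP; split=> [_ [F _ <-]|T TQ].
  (* As [Phi F] is a w*-limit of operators [uop (phi x)], it suffices to place these in the
     w*-closed span. *)
  have [G GP GF] := Phi_wstar_limit phi_ci phi_iso S_adapted F.
  have clQ : @closed (wstar_bop (up U K1) (up U K2)) (wstar_span Q).
    exact: closed_closure.
  apply: clQ => D /GF GD; have [x Dx] := @filter_ex _ G _ _ GD.
  exists (uop U (phi x)); split=> // {D GD Dx}.
  have : norm_span (prod_set (prod_set P2 (range psi)) P1) (phi x).
    by rewrite -phi_range; exists x.
  move=> px C /uop_wstar_continuous /px [T [PT CT]]; exists (uop U T); split=> //.
  move: T PT {CT}; apply: (@lspan_sub _ _ (@uop R U K1 K2 @^-1` lspan Q)).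
    have [Q0 Qlin] := @lspan_subspace _ Q.
    split; first by rewrite inE /= (map_0 (@uop_linear R U K1 K2)); rewrite inE in Q0.
    move=> a A B; rewrite !inE /= => QA QB; rewrite uop_linear.
    by have := Qlin a (uop U A) (uop U B); rewrite !inE; exact.
  move=> _ [_ [m2 Pm2 [_ [y _ <-] <-]] [m1 Pm1 <-]]; apply: sub_lspan.
  rewrite !uop_comp; exists (bop_comp (uop U m2) (uop U (psi y))).
    exists (uop U m2); first by exists m2.
    by exists (uop U (psi y)) => //; have [F' F'E] := Phi_eval U psi_iso y; exists F'.
  by exists (uop U m1) => //; exists m1.
(* Conversely, [T] is in the range once it satisfies all relations of the operators [uop (phi x)];
   spans and closures reduce this to products. *)
have [|F <-] := @Phi_range R U V K1 K2 phi phi_ci phi_iso S S_adapted T; last by exists F.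
move=> l l0; apply: (wstar_closure_vanish TQ); apply: lspan_vanish.
move=> _ [_ [_ [m2 Pm2 <-] [_ [G _ <-] <-]] [_ [m1 Pm1 <-] <-]].
have [n2 m2n2] := adjoint_exists (uop U m2).
(* Moving [m1] and the adjoint of [m2] onto the vectors turns a relation for [phi] into one for
   [psi]. *)
pose l' := [seq (p.1.1, uop U m1 p.1.2, n2 p.2) | p <- l].
transitivity (\sum_(p <- l') p.1.1 * hdot _ (Phi U psi_iso G p.1.2) p.2).
  by rewrite big_map; apply: eq_bigr => p _; rewrite /= -m2n2.
apply: Phi_vanish => y; rewrite big_map.
(* The new relation holds at [psi y] because the product of [m2], [psi y] and [m1] is some
   [phi x]. *)
have [x _ xE] : range phi (bop_comp (bop_comp m2 (psi y)) m1).
  rewrite phi_range; apply: subset_closure; apply: sub_lspan.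
  by exists (bop_comp m2 (psi y)); [exists m2 => //; exists (psi y)|exists m1].
rewrite -[RHS](l0 x); apply: eq_bigr => p _.
by rewrite xE !uop_comp /= m2n2.
Qed.

Lemma bop_mxnorm1 (H K : hilbert R) (T : bop H K) :
  bop_mxnorm (const_mx T : 'M_1) = (opnorm T)%:E.
Proof.
apply/eqP; rewrite eq_le; apply/andP; split.
  apply/bop_mxnorm_le; first exact: opnorm_ge0.
  move=> h k; rewrite !big_ord1 mxE !expr_le1 ?rnorm_ge0// => h1 k1.
  apply: (le_trans (hdot_CauchySchwarz _ _)).
  rewrite -[leRHS]mulr1 ler_pM ?rnorm_ge0//.
  by apply: (le_trans (opnormP _ _)); rewrite ler_piMr ?opnorm_ge0.
have := opmx_norm_ge0 (fun i j => (const_mx T : 'M_1) i j : H -> K).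
have := @bop_mxnorm_entry R H K 1 (const_mx T); rewrite -/(bop_mxnorm _).
case: (bop_mxnorm _) => [r E _|_ _|_].
- by have := E r 0 0 (lexx _); rewrite mxE lee_fin.
- by rewrite leey.
- by [].
Qed.

(** Complete isometry at size 1, where the matrix norm of an operator space is its operator norm. *)
Lemma complete_isometry_opspace (H K H' K' : hilbert R) (X : opspace H K)
    (phi : {linear X -> bop H' K'}) : complete_isometry phi ->
  forall x : X, rnorm x = opnorm (phi x).
Proof.
move=> phi_ci x; have := phi_ci 1%N (const_mx x).
rewrite (_ : map_mx phi (const_mx x) = const_mx (phi x)); last first.
  by apply/matrixP => i j; rewrite !mxE.
rewrite /= (_ : (\matrix_(i, j) _) = const_mx (opelt_val x)); last first.
  by apply/matrixP => i j; rewrite !mxE.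
by rewrite !bop_mxnorm1 => -[->].
Qed.

End SpanTransfer.

Theorem theorem5p9 (R : realType) (H1 H2 K1 K2 : hilbert R)
    (X : opspace K1 K2) (Y : opspace H1 H2) :
  strongly_Delta_equivalent X Y ->
  Delta_equivalent_dual (bidual X) (bidual Y).
Proof.
move=> [L1 [L2 [G1 [G2 [phi [psi [phi_ci psi_ci [M1 [M2 [M1_tro M2_tro phiE psiE]]]]]]]]]].
have phi_iso := complete_isometry_opspace phi_ci.
have psi_iso := complete_isometry_opspace psi_ci.
have [U [S [T [S_ad T_ad]]]] := adapted_exists (opelt X) (opelt Y).
exists (up U L1), (up U L2), (up U G1), (up U G2).
exists (Phi_linear_map U phi_iso), (Phi_linear_map U psi_iso).
exists (@uop R U G1 L1 @` M1), (@uop R U G2 L2 @` M2); split.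
- split; first exact: (Phi_complete_isometry phi_ci phi_iso S_ad).
  exact: Phi_wstar_continuous.
- split; first exact: (Phi_complete_isometry psi_ci psi_iso T_ad).
  exact: Phi_wstar_continuous.
- by split; exact: uop_tro.
- rewrite uop_adjoints; exact: (bidual_range phi_iso psi_iso phi_ci S_ad phiE).
- rewrite uop_adjoints; exact: (bidual_range psi_iso phi_iso psi_ci T_ad psiE).
Qed.
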